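(* Let $u_0\in C^\infty(M)$ be an admissible initial value (for the boundary condition under consideration). For $\varepsilon>0$ let $u_\varepsilon$ be the solution of $\partial_t u_\varepsilon=\varepsilon\Delta_t u_\varepsilon$ and let $\overline u_\varepsilon$ be the solution of $\partial_t\overline u_\varepsilon=\varepsilon\overline\Delta\,\overline u_\varepsilon$ on $[0,1]\times M$, both with initial value $u_0$ at $t=0$ and, if $\partial M\neq\emptyset$, both with homogeneous Dirichlet boundary conditions or both with homogeneous Neumann boundary conditions. Then $$u_\varepsilon(1,x)=\overline u_\varepsilon(1,x)+O(\varepsilon^2),\qquad \varepsilon\to 0,$$ uniformly in $x\in M$; that is, there exist $C,\varepsilon_0>0$ (depending on $u_0$) with $\sup_{x\in M}|u_\varepsilon(1,x)-\overline u_\varepsilon(1,x)|\le C\varepsilon^2$ for all $0<\varepsilon<\varepsilon_0$.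
   Context: $M$ is a compact, oriented smooth manifold whose boundary $\partial M$, if nonempty, is smooth. $\omega$ is a fixed smooth volume form on $M$. $(g_t)_{t\in[0,1]}$ is a family of Riemannian metrics on $M$ depending smoothly on $(t,x)\in[0,1]\times M$ (in the application these are the pullbacks of diffusion-adapted metrics under the flow of a time-dependent velocity field, and $\omega$ is the initial fluid mass form). A metric $g$ is identified with the bundle map $g:TM\to T^*M$, with inverse $g^{-1}:T^*M\to TM$. The divergence $\operatorname{div}_\omega F$ of a vector field $F$ is defined by $(\operatorname{div}_\omega F)\,\omega=d(\iota_F\omega)$. Set $$\Delta_t u=\operatorname{div}_\omega(g_t^{-1}\,du),\qquad \overline\Delta=\int_0^1\Delta_t\,dt,\qquad \overline g=\Big(\int_0^1 g_t^{-1}\,dt\Big)^{-1},$$ so that $\overline\Delta u=\operatorname{div}_\omega(\overline g^{-1}du)$ (the dynamic Laplacian). Boundary conditions (if $\partial M\ne\emptyset$): homogeneous Dirichlet means $u(t,\cdot)=0$ on $\partial M$ for both equations; homogeneous Neumann means $du_\varepsilon(t,\cdot)(\nu_t)=0$ on $\partial M$ for each $t$, where $\nu_t$ is the $g_t$-unit normal field on $\partial M$, and $d\overline u_\varepsilon(t,\cdot)(\overline\nu)=0$ on $\partial M$, where $\overline\nu$ is the $\overline g$-unit normal field. $u_0\in C^\infty(M)$ is called admissible if (Dirichlet case) it is compactly supported in the interior of $M$, respectively (Neumann case) it is constant in a neighborhood of $\partial M$. (No condition if $\partial M=\emptyset$.) Solutions: in the Dirichlet (or boundaryless) case, for admissible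 $u_0$ each equation has a unique solution, which is in $C^\infty([0,1]\times M)$; in the Neumann case the analogous existence, uniqueness and regularity are taken for granted. *)

(* Defs.v *)
From HB Require Import structures.
From mathcomp Require Import all_boot all_order all_algebra.
From mathcomp Require Import all_classical all_reals all_analysis.

Set Implicit Arguments.
Unset Strict Implicit.
Unset Printing Implicit Defensive.

Import Order.TTheory GRing.Theory Num.Theory.
Import numFieldNormedType.Exports.

Local Open Scope classical_set_scope.
Local Open Scope ring_scope.

Section Calculus.
Context {R : realType} {V W : normedModType R}.

(* C^oo on an open set: every iterated directional derivative exists and is
   Frechet differentiable. *)
Definition iter_derive (vs : seq V) (f : V -> W) : V -> W :=
  foldr (fun v g x => 'D_v g x) f vs.

Definition smooth_open (U : set V) (f : V -> W) : Prop :=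
  forall (vs : seq V) (x : V), U x -> differentiable (iter_derive vs f) x.

(* Smoothness on an arbitrary set, by local smooth extension; this gives
   smoothness up to the boundary on relatively open subsets of a half-space,
   or of [0,1] times a half-space. *)
Definition smooth_on (A : set V) (f : V -> W) : Prop :=
  forall x, A x -> exists (U : set V) (F : V -> W),
    [/\ open U, U x, smooth_open U F & forall y, U y -> A y -> F y = f y].

(* Directional derivative using only points of A. If A is a relatively open
   subset of a half-space it is the usual derivative at interior points and a
   one-sided derivative in the directions transverse to the boundary at
   boundary points; for f smooth on A it is in both cases the differential of
   any smooth local extension of f, applied to v. *)
Definition derive_in (A : set V) (f : V -> W) (v x : V) : W :=
  lim (h^-1 *: (f (x + h *: v) - f x)
    @[h --> within [set h : R | A (x + h *: v)] 0^']).

End Calculus.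

Section HalfSpace.
Context {R : realType} {n : nat}.

(* The coordinate of index 0 is the nonnegative one. For n = 0 there is no such
   index, so that the half-space is everything and its boundary is empty. *)
Definition halfspace : set 'rV[R]_n :=
  [set p | forall i : 'I_n, i = 0%N :> nat -> 0 <= p 0 i].

Definition halfspace_bd : set 'rV[R]_n :=
  [set p | exists2 i : 'I_n, i = 0%N :> nat & p 0 i = 0].

Definition halfspace_tangent : set 'rV[R]_n :=
  [set v | forall i : 'I_n, i = 0%N :> nat -> v 0 i = 0].

End HalfSpace.

(* Smooth n-manifold with (possibly empty) boundary, given by an atlas indexed
   by [chart]. The inverse charts are total functions, meaningful only on the
   images of the charts. *)
Record manifold (R : realType) (n : nat) := Manifold {
  points :> topologicalType;
  chart : Type;
  dom : chart -> set points;
  phi : chart -> points -> 'rV[R]_n;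
  phiV : chart -> 'rV[R]_n -> points;
  manifold_hausdorff : hausdorff_space points;
  manifold_second_countable : @second_countable points;
  dom_cover : forall x, exists a, dom a x;
  dom_open : forall a, open (dom a);
  img_open : forall a, exists2 U : set 'rV[R]_n,
    open U & phi a @` dom a = U `&` halfspace;
  phiK : forall a, {in dom a, cancel (phi a) (phiV a)};
  phi_continuous : forall a, {within dom a, continuous (phi a)};
  phiV_continuous : forall a, {within phi a @` dom a, continuous (phiV a)};
  transition_smooth : forall a b,
    smooth_on (phi a @` (dom a `&` dom b)) (phi b \o phiV a)
}.

Section ManifoldTheory.
Context {R : realType} {n : nat} {M : manifold R n}.

Implicit Types (a b : chart M) (x : M).

Definition img a : set 'rV[R]_n := phi a @` dom a.

Definition boundary : set M :=
  [set x | exists2 a, dom a x & halfspace_bd (phi a x)].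

(* Tangent vectors are written in charts as row vectors: v in chart a becomes
   v *m jac a b x in chart b. *)
Definition jac a b x : 'M[R]_n :=
  \matrix_(i, j) (derive_in (phi a @` (dom a `&` dom b)) (phi b \o phiV a)
                    (delta_mx 0 i) (phi a x)) 0 j.

Definition smooth_fun (f : M -> R) : Prop :=
  forall a, smooth_on (img a) ((f \o phiV a) : 'rV[R]_n -> R^o).

(* Smoothness of a time-dependent function on [0,1] times the set A. *)
Definition smooth_in_time (A : set 'rV[R]_n) (f : R -> 'rV[R]_n -> R) : Prop :=
  smooth_on ((`[0, 1]%classic : set R^o) `*` A)
    ((fun p => f p.1 p.2) : R^o * 'rV[R]_n -> R^o).

Definition smooth_evolution (u : R -> M -> R) : Prop :=
  forall a, smooth_in_time (img a) (fun t p => u t (phiV a p)).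

End ManifoldTheory.

Arguments boundary {R n} M.

(* An orientation of each tangent space, locally constant: [positive a x] tells
   whether the coordinate basis of chart a at x is positively oriented. (An
   atlas of half-space charts with positive Jacobians would not do: [0,1] has
   none.) *)
Record orientation (R : realType) (n : nat) (M : manifold R n) := Orientation {
  positive : chart M -> M -> bool;
  positive_locally_constant : forall a x, dom a x ->
    \forall y \near x, positive a y = positive a x;
  positive_transition : forall a b x, dom a x -> dom b x ->
    (positive a x == positive b x) = (0 < \det (jac a b x))
}.

(* Nowhere vanishing top-degree form; it is density * dx^1 /\ ... /\ dx^n in
   each chart. *)
Record volume_form (R : realType) (n : nat) (M : manifold R n) := VolumeForm {
  density : chart M -> M -> R;
  density_neq0 : forall a x, dom a x -> density a x != 0;
  density_transition : forall a b x, dom a x -> dom b x ->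
    density a x = \det (jac a b x) * density b x;
  density_smooth : forall a,
    smooth_on (img a) ((density a \o phiV a) : 'rV[R]_n -> R^o)
}.

(* [metric t a x] is the Gram matrix at x of the coordinate basis of chart a. *)
Record metric_family (R : realType) (n : nat) (M : manifold R n) :=
  MetricFamily {
  metric :> R -> chart M -> M -> 'M[R]_n;
  metric_sym : forall t a x, 0 <= t <= 1 -> dom a x ->
    (metric t a x)^T = metric t a x;
  metric_pos : forall t a x (v : 'rV[R]_n), 0 <= t <= 1 -> dom a x -> v != 0 ->
    0 < (v *m metric t a x *m v^T) 0 0;
  metric_transition : forall t a b x, 0 <= t <= 1 -> dom a x -> dom b x ->
    metric t a x = jac a b x *m metric t b x *m (jac a b x)^T;
  metric_smooth : forall a i j,
    smooth_in_time (img a) (fun t p => metric t a (phiV a p) i j)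
}.

Section Forms.
Context {R : realType} {n : nat} {M : manifold R n}.

(* In a chart, the value of a k-form is a function of the list of its k vector
   arguments. *)
Definition eval_form (omega : volume_form M) (a : chart M) (x : M)
    (vs : seq 'rV[R]_n) : R :=
  density omega a x * \det (\matrix_(i < n, j < n) (nth 0 vs i) 0 j).

Definition interior_product (F : 'rV[R]_n) (eta : seq 'rV[R]_n -> R) :
    seq 'rV[R]_n -> R :=
  fun vs => eta (F :: vs).

(* Exterior derivative on a subset A of R^n, on constant vector fields:
   (d eta)(v_0, .., v_k)
     = \sum_i (-1)^i D_(v_i) (eta (v_0, .., v_(i-1), v_(i+1), .., v_k)). *)
Definition exterior_derivative (A : set 'rV[R]_n)
    (eta : 'rV[R]_n -> seq 'rV[R]_n -> R) (p : 'rV[R]_n)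
    (vs : seq 'rV[R]_n) : R :=
  \sum_(i < size vs) (-1) ^+ i *
    derive_in A ((fun q => eta q (take i vs ++ drop i.+1 vs)) : 'rV[R]_n -> R^o)
      (nth 0 vs i) p.

(* A vector field, given by its components in each chart, has a divergence at
   x equal to the c such that c omega = d (iota_F omega) there. *)
Definition divergence (omega : volume_form M) (F : chart M -> M -> 'rV[R]_n)
    (x : M) : R :=
  xget 0 [set c : R | forall a, dom a x ->
    forall vs : seq 'rV[R]_n, size vs = n ->
      c * eval_form omega a x vs =
      exterior_derivative (img a)
        (fun q => interior_product (F a (phiV a q))
                    (eval_form omega a (phiV a q)))
        (phi a x) vs].

Definition differential (f : M -> R) (a : chart M) (x : M) : 'rV[R]_n :=
  \row_j derive_in (img a) ((f \o phiV a) : 'rV[R]_n -> R^o)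
           (delta_mx 0 j) (phi a x).

(* As a bundle map TM -> T*M, a metric with Gram matrix G is v |-> v *m G. *)
Definition gradient (G : chart M -> M -> 'M[R]_n) (f : M -> R)
    (a : chart M) (x : M) : 'rV[R]_n :=
  differential f a x *m invmx (G a x).

Definition laplacian (omega : volume_form M) (G : chart M -> M -> 'M[R]_n)
    (f : M -> R) : M -> R :=
  divergence omega (gradient G f).

Definition averaged_laplacian (omega : volume_form M) (g : metric_family M)
    (f : M -> R) (x : M) : R :=
  \int[lebesgue_measure]_(t in `[0, 1]) laplacian omega (g t) f x.

Definition averaged_metric (g : metric_family M) (a : chart M) (x : M) :
    'M[R]_n :=
  invmx (\matrix_(i, j)
    \int[lebesgue_measure]_(t in `[0, 1]) (invmx (g t a x) i j)).

(* There are two such vectors at each boundary point, opposite to each other. *)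
Definition unit_normal (G : 'M[R]_n) (nu : 'rV[R]_n) : Prop :=
  (forall v, halfspace_tangent v -> (nu *m G *m v^T) 0 0 = 0) /\
  (nu *m G *m nu^T) 0 0 = 1.

End Forms.

(* If the boundary is empty, both conditions and both notions of admissibility
   below are void: a closed set avoiding it is just a closed set, compact when
   M is, and the empty set is a neighborhood of it. *)
Variant boundary_condition := Dirichlet | Neumann.

Section Problem.
Context {R : realType} {n : nat} {M : manifold R n}.

Definition satisfies_bc (bc : boundary_condition)
    (G : chart M -> M -> 'M[R]_n) (f : M -> R) : Prop :=
  match bc with
  | Dirichlet => forall x, boundary M x -> f x = 0
  | Neumann => forall x (a : chart M) (nu : 'rV[R]_n),
      boundary M x -> dom a x -> unit_normal (G a x) nu ->
      (differential f a x *m nu^T) 0 0 = 0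
  end.

Definition admissible (bc : boundary_condition) (u0 : M -> R) : Prop :=
  smooth_fun u0 /\
  match bc with
  | Dirichlet => let supp := closure [set x | u0 x != 0] in
      compact supp /\ supp `<=` ~` boundary M
  | Neumann => exists (U : set M) (c : R),
      [/\ open U, boundary M `<=` U & forall x, U x -> u0 x = c]
  end.

(* The equation d/dt u = eps * L_t u on [0,1] x M with initial value u0; the
   unit normals of the Neumann condition at time t are those of [G t]. *)
Definition is_solution (bc : boundary_condition)
    (L : R -> (M -> R) -> M -> R) (G : R -> chart M -> M -> 'M[R]_n)
    (u0 : M -> R) (eps : R) (u : R -> M -> R) : Prop :=
  [/\ smooth_evolution u,
      forall x, u 0 x = u0 x,
      forall t x, 0 <= t <= 1 ->
        derive_in (`[0, 1]%classic : set R^o) ((fun s => u s x) : R^o -> R^o)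
          1 t = eps * L t (u t) x
    & forall t, 0 <= t <= 1 -> satisfies_bc bc (G t) (u t)].

End Problem.

(* Main.v *)
Require Import Defs.
From HB Require Import structures.
From mathcomp Require Import all_boot all_order all_algebra.
From mathcomp Require Import all_classical all_reals all_analysis.
From mathcomp Require Import perm.
From mathcomp Require Import ring lra.

(** Write [Q s] for the Laplacian of [u0] at time [s]. Up to terms of order
[eps ^+ 2], both solutions at time 1 equal [u0] plus [eps] times the time
average of [Q]. The proof makes this precise with explicit approximate
solutions: for the averaged equation [w t = u0 + eps * t * q], with [q] the
[N]-th Riemann sum of the average of [Q]; for the time-dependent equation the
function that is affine in time between the nodes [k / N], with slope
[eps * Q (k / N)]. Both have the same value at time 1. Replacing the average by
Riemann sums keeps every approximation a finite linear combination of the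
smooth functions [Q (j / N)], so that integrals over time need not be
differentiated in space. Inserted in its equation, the approximate solution
leaves a residual [eps * eta + eps ^+ 2 * C1]: [eta] is the oscillation of [Q]
over a time step, which is at most [eps] for [N] large, and [C1] bounds the
Laplacians at time [t] of all [Q s] ([laplacian_bounded]). The maximum
principle ([comparison], [step]) turns the bound on the residual into a bound
on the difference with the true solution.

The maximum principle rests on [laplacian_max_le0]: where a function is maximal
its Laplacian is nonpositive, also on the boundary. On a Neumann boundary the
normal and the tangential derivatives vanish at a maximum, so the whole
differential does, and second derivatives in inward directions are nonpositive;
a quadratic form takes the same value at [v] and [- v], so the full Hessian is
nonpositive. On a Dirichlet boundary the difference of the two functions
vanishes. Admissibility enters because [u0] is constant near the boundary, so
that [Q s] vanishes there and the approximate solutions satisfy either boundary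
condition.

The divergence is defined by one identity required in all charts at once. That
it has a solution, namely the usual coordinate expression ([laplacianE]), is
the invariance of the divergence under changes of charts: [piola], which
combines the chain rule, the derivative of a determinant ([dv_det]) and the
symmetry of second derivatives ([derive_sym]). All this is done on relatively
open subsets of a half-space by a calculus of functions with smooth local
extensions ([regular]) and of their directional derivatives ([dv]). *)

Set Implicit Arguments.
Unset Strict Implicit.
Unset Printing Implicit Defensive.

Import Order.TTheory GRing.Theory Num.Theory.
Import numFieldNormedType.Exports.

Local Open Scope classical_set_scope.
Local Open Scope ring_scope.

Local Notation "''e_' j" := (delta_mx 0 j) (at level 8, j at level 2).

(** * Smooth functions on open sets *)

Section SmoothCalculus.
Context {R : realType}.

(** Differentiability is local. The differential is a choice made for each
function, so equality near the point is transported through its uniqueness. *)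
Lemma near_eq_differentiable (V W : normedModType R) (f g : V -> W) x :
  (\near x, f x = g x) -> differentiable f x -> differentiable g x.
Proof.
move=> fg df.
have fgx : f x = g x by exact: nbhs_singleton fg.
have [dfc fE] := (diff_locallyP _ _).1 df.
have gE : g \o shift x = cst (g x) + 'd f x +o_ 0 id.
  apply/eqaddoP => e e0.
  have /eqaddoP/(_ e e0) := fE.
  apply: filterS2 (_ : \forall h \near 0, f (h + x) = g (h + x)).
    by move=> h; rewrite /= !fctE /= fgx => ->.
  by move: fg; rewrite (near_shift 0 x); apply: filterS => h /=; rewrite subr0.
apply/diff_locallyP.
have -> : 'd g x = 'd f x :> (V -> W) by exact: diff_unique.
by split.
Qed.

(** Unlike a quantification over lists of directions, recursion on the order
matches the Leibniz and chain rules, which express a derivative of a product or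
a composite by products of functions of lower order. *)
Fixpoint smooth_upto (V : normedModType R) (k : nat) (U : set V) (f : V -> R) :=
  (forall x, U x -> differentiable f x) /\
  (if k is k'.+1 then forall v, smooth_upto k' U ('D_v f) else True).

Definition smooth (V : normedModType R) (U : set V) (f : V -> R) :=
  forall k, smooth_upto k U f.

Section Closure.
Context {V : normedModType R}.
Implicit Types (U : set V) (f g : V -> R).

Lemma smooth_uptoW k U f : smooth_upto k.+1 U f -> smooth_upto k U f.
Proof.
elim: k f => [|k IH] f [df Df]; first by split.
by split=> // v; apply: IH; exact: Df.
Qed.

Lemma smooth_upto_eq k U f g : open U -> (forall x, U x -> f x = g x) ->
  smooth_upto k U f -> smooth_upto k U g.
Proof.
move=> oU; elim: k f g => [|k IH] f g fg [df Df].
  split=> // x Ux; apply: near_eq_differentiable (df _ Ux).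
  by move: (open_nbhs_nbhs (conj oU Ux)); apply: filterS => y /fg.
split=> [x Ux|v].
  apply: near_eq_differentiable (df _ Ux).
  by move: (open_nbhs_nbhs (conj oU Ux)); apply: filterS => y /fg.
apply: IH (Df v) => x Ux; apply: near_eq_derive.
by move: (open_nbhs_nbhs (conj oU Ux)); apply: filterS => y /fg.
Qed.

Lemma smooth_upto_sub k U U' f : U' `<=` U -> smooth_upto k U f -> smooth_upto k U' f.
Proof.
move=> UU; elim: k f => [|k IH] f [df Df].
  by split=> // x /UU; exact: df.
by split=> [x /UU|v]; [exact: df|exact/IH/Df].
Qed.

Lemma smooth_upto_cst k U (c : R) : open U -> smooth_upto k U (fun=> c).
Proof.
move=> oU; elim: k c => [|k IH] c; first by split=> // x Ux; exact: differentiable_cst.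
split=> [x Ux|v]; first exact: differentiable_cst.
apply: smooth_upto_eq (IH 0) => // x Ux.
by rewrite (_ : (fun=> c) = cst c) // derive_cst.
Qed.

Lemma smooth_uptoD k U f g : open U -> smooth_upto k U f -> smooth_upto k U g ->
  smooth_upto k U (f \+ g).
Proof.
move=> oU; elim: k f g => [|k IH] f g [df Df] [dg Dg].
  by split=> // x Ux; apply: differentiableD; [exact: df|exact: dg].
split=> [x Ux|v]; first by apply: differentiableD; [exact: df|exact: dg].
apply: smooth_upto_eq (IH _ _ (Df v) (Dg v)) => // x Ux /=.
by rewrite (_ : f \+ g = f + g) // deriveD //; apply: diff_derivable;
  [exact: df|exact: dg].
Qed.

Lemma smooth_uptoM k U f g : open U -> smooth_upto k U f -> smooth_upto k U g ->
  smooth_upto k U (f \* g).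
Proof.
move=> oU; elim: k f g => [|k IH] f g sf sg.
  case: sf => df _; case: sg => dg _.
  by split=> // x Ux; apply: differentiableM; [exact: df|exact: dg].
have [df Df] := sf; have [dg Dg] := sg.
split=> [x Ux|v]; first by apply: differentiableM; [exact: df|exact: dg].
have H := smooth_uptoD oU (IH _ _ (smooth_uptoW sf) (Dg v))
                          (IH _ _ (smooth_uptoW sg) (Df v)).
apply: smooth_upto_eq H => // x Ux /=.
by rewrite (_ : f \* g = f * g) // deriveM //; apply: diff_derivable;
  [exact: df|exact: dg].
Qed.

Lemma smooth_uptoV k U f : open U -> (forall x, U x -> f x != 0) ->
  smooth_upto k U f -> smooth_upto k U (fun x => (f x)^-1).
Proof.
move=> oU f0; elim: k => [|k IH] sf.
  by case: sf => df _; split=> // x Ux; apply: differentiableV; [exact: df|exact: f0].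
have [df Df] := sf.
split=> [x Ux|v]; first by apply: differentiableV; [exact: df|exact: f0].
have s1 := IH (smooth_uptoW sf).
have H := smooth_uptoM oU (smooth_uptoM oU (smooth_upto_cst k (-1) oU)
            (smooth_uptoM oU s1 s1)) (Df v).
apply: smooth_upto_eq H => // x Ux /=.
rewrite deriveV ?f0 //; last by apply: diff_derivable; exact: df.
by rewrite mulN1r -expr2 exprVn.
Qed.

Lemma smooth_upto_lin k U (f : {linear V -> R}) : open U -> continuous f ->
  smooth_upto k U f.
Proof.
move=> oU cf.
have df x : differentiable f x by exact: linear_differentiable.
case: k => [|k]; first by split.
split=> // v; apply: smooth_upto_eq (smooth_upto_cst k (f v) oU) => // x Ux.
by rewrite deriveE // diff_lin.
Qed.

Lemma smooth_upto_sum k (I : Type) (r : seq I) (P : pred I) U (F : I -> V -> R) :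
  open U -> (forall i, P i -> smooth_upto k U (F i)) ->
  smooth_upto k U (fun x => \sum_(i <- r | P i) F i x).
Proof.
move=> oU sF; elim: r => [|i r IH].
  apply: smooth_upto_eq (smooth_upto_cst k 0 oU) => // x _.
  by rewrite big_nil.
have [Pi|nPi] := boolP (P i); last first.
  by apply: smooth_upto_eq IH => // x _; rewrite big_cons (negbTE nPi).
by apply: smooth_upto_eq (smooth_uptoD oU (sF i Pi) IH) => // x _ /=; rewrite big_cons Pi.
Qed.

Lemma smooth_diff U f x : smooth U f -> U x -> differentiable f x.
Proof. by move=> /(_ 0) [H _]; exact: H. Qed.

Lemma smooth_derivable U f x v : smooth U f -> U x -> derivable f x v.
Proof. by move=> sf Ux; apply: diff_derivable; exact: smooth_diff sf Ux. Qed.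

Lemma smooth_derive U f v : smooth U f -> smooth U ('D_v f).
Proof. by move=> sf k; have [_] := sf k.+1; apply. Qed.

End Closure.

(** Maps into a normed module are handled through finitely many real
coordinates, so that the chain rule only involves real-valued functions. *)
Lemma differentiable_coord_map (V W : normedModType R) (m : nat) (w0 : W)
    (e : 'I_m -> W) (phi : 'I_m -> V -> R) (x : V) :
  (forall i, differentiable (phi i) x) ->
  differentiable (fun z => w0 + \sum_i phi i z *: e i) x.
Proof.
move=> dphi.
have -> : (fun z => w0 + \sum_i phi i z *: e i) =
    cst w0 + \sum_i (fun z => phi i z *: e i).
  by apply/funext => z; rewrite fctE fct_sumE.
apply: differentiableD; first exact: differentiable_cst.
by apply: differentiable_sum => i; apply: differentiableZl.
Qed.

Lemma derive_comp_coord (V W : normedModType R) (m : nat) (F : W -> R) (w0 : W)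
    (e : 'I_m -> W) (phi : 'I_m -> V -> R) (x v : V) :
  let Phi := fun z => w0 + \sum_i phi i z *: e i in
  differentiable F (Phi x) -> (forall i, differentiable (phi i) x) ->
  differentiable (F \o Phi) x /\
  'D_v (F \o Phi) x = \sum_i 'D_v (phi i) x * 'D_(e i) F (Phi x).
Proof.
move=> Phi dF dphi.
have PhiE : Phi = cst w0 + \sum_i (fun z => phi i z *: e i).
  by apply/funext => z; rewrite /Phi fctE fct_sumE.
have dPhi : differentiable Phi x by exact: differentiable_coord_map.
have DPhi : 'd Phi x v = \sum_i 'D_v (phi i) x *: e i.
  rewrite -deriveE // PhiE deriveD; last 2 first.
  - exact: derivable_cst.
  - by apply: derivable_sum => i; apply: diff_derivable; apply: differentiableZl.
  rewrite derive_cst add0r derive_sum; last first.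
    by move=> i; apply: diff_derivable; apply: differentiableZl.
  apply: eq_bigr => i _; rewrite deriveE ?diffZl ?deriveE //.
  exact: differentiableZl.
have dFP : differentiable (F \o Phi) x by exact: differentiable_comp.
split=> //.
rewrite deriveE // diff_comp //= DPhi linear_sum; apply: eq_bigr => i _.
by rewrite linearZ /= -deriveE.
Qed.

Lemma smooth_upto_comp (V W : normedModType R) (m : nat) k (U : set V) (U' : set W)
    (F : W -> R) (w0 : W) (e : 'I_m -> W) (phi : 'I_m -> V -> R) :
  let Phi := fun z => w0 + \sum_i phi i z *: e i in
  open U -> (forall x, U x -> U' (Phi x)) -> (forall i, smooth U (phi i)) ->
  smooth_upto k U' F -> smooth_upto k U (F \o Phi).
Proof.
move=> Phi oU UU' sphi.
have dc (G : W -> R) x v : (forall y, U' y -> differentiable G y) -> U x ->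
    differentiable (G \o Phi) x /\
    'D_v (G \o Phi) x = \sum_i 'D_v (phi i) x * 'D_(e i) G (Phi x).
  move=> dG Ux; apply: derive_comp_coord; first exact/dG/UU'.
  by move=> i; exact: smooth_diff (sphi i) Ux.
elim: k F => [|k IH] F [dF DF].
  by split=> // x Ux; have [] := dc F x 0 dF Ux.
split=> [x Ux|v]; first by have [] := dc F x 0 dF Ux.
suff H : smooth_upto k U (fun x => \sum_i ('D_v (phi i) x * 'D_(e i) F (Phi x))).
  by apply: smooth_upto_eq H => // x Ux; have [] := dc F x v dF Ux.
apply: smooth_upto_sum => // i _.
exact: smooth_uptoM (smooth_derive v (sphi i) k) (IH _ (DF (e i))).
Qed.

Lemma smooth_open_smooth (V : normedModType R) (U : set V) (f : V -> R^o) :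
  smooth_open U f -> smooth U f.
Proof.
move=> sf k.
have : forall vs x, U x -> differentiable (iter_derive vs f) x by [].
elim: k (f) => [|k IH] g sg; first by split=> // x /(sg [::]).
split=> [x /(sg [::]) //|v]; apply: IH => vs x Ux.
by have := sg (rcons vs v) x Ux; rewrite /iter_derive foldr_rcons.
Qed.

End SmoothCalculus.

(** * Derivatives along lines and rays *)

Section Lines.
Context {R : realType} {V : normedModType R}.
Implicit Types (U A : set V) (f F : V -> R) (x v w p : V).

Lemma is_derive_line f x v (s : R) : differentiable f (x + s *: v) ->
  is_derive s 1 (fun s : R => f (x + s *: v)) ('D_v f (x + s *: v)).
Proof.
move=> df.
have -> : (fun s : R => f (x + s *: v)) =
    f \o (fun s : R => x + \sum_(i < 1) s *: v).
  by apply/funext => r /=; rewrite big_ord1.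
have Es : x + s *: v = x + \sum_(i < 1) s *: v by rewrite big_ord1.
have [||d E] := @derive_comp_coord R R V 1 f x (fun=> v) (fun=> id) s 1.
- by rewrite -Es.
- by move=> _.
rewrite -Es big_ord1 derive_id mul1r in E.
by apply: DeriveDef => //; exact: diff_derivable.
Qed.

(** The intermediate point is strictly inside: [derive2_le0_right] needs a
point where the derivative is already known to be positive. *)
Lemma mvt_line f x v (h : R) : 0 < h ->
  (forall s : R, 0 <= s <= h -> differentiable f (x + s *: v)) ->
  exists2 c : R, 0 < c < h & f (x + h *: v) - f x = h * 'D_v f (x + c *: v).
Proof.
move=> h0 df.
have [||c] := @MVT R (fun s => f (x + s *: v)) (fun s => 'D_v f (x + s *: v)) 0 h h0.
- move=> s; rewrite in_itv /= => /andP[s0 sh].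
  by apply: is_derive_line; apply: df; rewrite !ltW.
- apply: derivable_within_continuous => s; rewrite in_itv /= => sh.
  by have [] := is_derive_line (df _ sh).
rewrite in_itv /= => ch; rewrite scale0r addr0 subr0 mulrC => E.
by exists c.
Qed.

Lemma near_square U x v w : open U -> U x ->
  \forall h \near 0^'+, forall s t : R, 0 <= s <= h -> 0 <= t <= h ->
    U (x + s *: v + t *: w).
Proof.
move=> oU Ux.
have c : {for (0:R,0:R), continuous (fun h : R * R => x + h.1 *: v + h.2 *: w)}.
  apply: cvgD; last by apply: cvgZr_tmp; exact: cvg_snd.
  by apply: cvgD; [exact: cvg_cst|apply: cvgZr_tmp; exact: cvg_fst].
have N : nbhs (0:R,0:R) (fun h : R * R => U (x + h.1 *: v + h.2 *: w)).
  apply: c => /=; rewrite !scale0r !addr0; exact: open_nbhs_nbhs.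
have [e /= e0 H] := (nbhs_ballP _ _).1 N.
near=> h => s t /andP[s0 sh] /andP[t0 th].
apply: (H (s, t)); split; rewrite /ball /= sub0r normrN ger0_norm //.
- by apply: le_lt_trans sh _; near: h; exact: nbhs_right_lt.
- by apply: le_lt_trans th _; near: h; exact: nbhs_right_lt.
Unshelve. all: by end_near. Qed.

(** The mean value theorem, once in each direction. The left-hand side is
symmetric in [v] and [w], which is what yields [derive_sym]. *)
Lemma second_difference U f x v w (h : R) : smooth U f -> 0 < h ->
  (forall s t : R, 0 <= s <= h -> 0 <= t <= h -> U (x + s *: v + t *: w)) ->
  exists s t : R, [/\ 0 <= s <= h, 0 <= t <= h &
    f (x + h *: v + h *: w) - f (x + h *: v) - f (x + h *: w) + f x =
    h * h * 'D_w ('D_v f) (x + s *: v + t *: w)].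
Proof.
move=> sf h0 HU.
pose g := fun y => f (y + h *: w) - f y.
have dfs (s t : R) : 0 <= s <= h -> 0 <= t <= h ->
    differentiable f (x + s *: v + t *: w).
  by move=> ? ?; apply: smooth_diff sf _; exact: HU.
have h00 : (0:R) <= 0 <= h by rewrite lexx ltW.
have hh : 0 <= h <= h by rewrite lexx ltW.
have dsh (s : R) : 0 <= s <= h -> differentiable (f \o +%R^~ (h *: w)) (x + s *: v).
  move=> sh; apply: differentiable_comp; last exact: dfs.
  by apply: differentiableD => //; exact: differentiable_cst.
have dg (s : R) : 0 <= s <= h -> differentiable g (x + s *: v).
  move=> sh; apply: differentiableB; first exact: dsh.
  by have := dfs s 0 sh h00; rewrite scale0r addr0.
have [s sh E1] := mvt_line h0 dg.
have sh' : 0 <= s <= h by case/andP: sh => /ltW -> /ltW ->.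
have dv (t : R) : 0 <= t <= h -> differentiable ('D_v f) (x + s *: v + t *: w).
  by move=> th; apply: smooth_diff (smooth_derive v sf) _; exact: HU.
have [t th E2] := mvt_line h0 dv.
exists s, t; split=> //; first by case/andP: th => /ltW -> /ltW ->.
rewrite -mulrA -E2.
have -> : 'D_v f (x + s *: v + h *: w) - 'D_v f (x + s *: v) =
          'D_v g (x + s *: v).
  have d0 : differentiable f (x + s *: v).
    by have := dfs s 0 sh' h00; rewrite scale0r addr0.
  rewrite (_ : g = (f \o +%R^~ (h *: w)) - f) // deriveB; last 2 first.
  - exact/diff_derivable/dsh.
  - exact: diff_derivable.
  congr (_ - _); rewrite /derive.
  suff -> : (fun r => r^-1 *: ((f \o shift (x + s *: v + h *: w)) (r *: v) -
        f (x + s *: v + h *: w))) =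
      (fun r => r^-1 *: (((f \o +%R^~ (h *: w)) \o shift (x + s *: v)) (r *: v) -
        (f \o +%R^~ (h *: w)) (x + s *: v))) by [].
  by apply/funext => r /=; rewrite addrA.
by rewrite -E1 /g; ring.
Qed.

(** Both mixed derivatives are limits of the same second difference divided by
the square of the step. *)
Lemma derive_sym U f x v w : open U -> smooth U f -> U x ->
  'D_w ('D_v f) x = 'D_v ('D_w f) x.
Proof.
move=> oU sf Ux; apply/eqP; rewrite -subr_eq0 -normr_le0.
apply/ler_addgt0Pr => e e0; rewrite add0r.
have e2 : 0 < e / 2 by rewrite divr_gt0.
have tri (a b c : R) : `|a - c| < e / 2 -> `|b - c| < e / 2 -> `|a - b| <= e.
  move=> ac bc; rewrite -(subrKA c) (splitr e).
  by apply: le_trans (ler_normD _ _) _; rewrite lerD ?ltW // distrC.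
have near_of (g : V -> R) : smooth U g -> exists2 U' : set V, open U' &
    U' x /\ forall y, U' y -> `|g x - g y| < e / 2.
  move=> sg; have cg := differentiable_continuous (smooth_diff sg Ux).
  move: cg => /cvgrPdist_lt/(_ _ e2) /nbhs_ballP[d /= d0 H].
  exists (ball x d)^°; first exact: open_interior.
  split; first by apply: nbhs_singleton; apply: nbhs_interior; exact: nbhsx_ballx.
  by move=> y /interior_subset /H.
have [U1 oU1 [U1x H1]] := near_of _ (smooth_derive w (smooth_derive v sf)).
have [U2 oU2 [U2x H2]] := near_of _ (smooth_derive v (smooth_derive w sf)).
have oUU : open (U `&` U1 `&` U2) by apply: openI => //; exact: openI.
have UUx : (U `&` U1 `&` U2) x by [].
have Nvw := near_square v w oUU UUx.
have Nwv := near_square w v oUU UUx.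
near (0:R)^'+ => h.
have h0 : 0 < h by near: h; exact: nbhs_right_gt.
have hvw : forall s t : R, 0 <= s <= h -> 0 <= t <= h ->
    (U `&` U1 `&` U2) (x + s *: v + t *: w) by near: h.
have hwv : forall s t : R, 0 <= s <= h -> 0 <= t <= h ->
    (U `&` U1 `&` U2) (x + s *: w + t *: v) by near: h.
have [|s [t [sh th E1]]] := @second_difference U f x v w h sf h0.
  by move=> a b ha hb; have [[]] := hvw _ _ ha hb.
have [|s' [t' [sh' th' E2]]] := @second_difference U f x w v h sf h0.
  by move=> a b ha hb; have [[]] := hwv _ _ ha hb.
have hh : h * h != 0 by rewrite mulf_neq0 // gt_eqF.
have E : 'D_w ('D_v f) (x + s *: v + t *: w) = 'D_v ('D_w f) (x + s' *: w + t' *: v).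
  have mulI (a b : R) : h * h * a = h * h * b -> a = b by exact: (mulfI hh).
  apply: mulI; rewrite -[LHS]E1 -[RHS]E2.
  by rewrite [x + h *: w + h *: v]addrAC; congr (_ + f x); rewrite [LHS]addrAC.
have [[_ /H1 B1] _] := hvw _ _ sh th.
have [_ /H2 B2] := hwv _ _ sh' th'.
rewrite -E in B2.
exact: tri B1 B2.
Unshelve. all: by end_near. Qed.

Lemma right_to_dnbhs0 : (0:R)^'+ `=>` (0:R)^'.
Proof.
by move=> A; apply: (@filterS _ (nbhs (0:R))) => x /= Ax x0; apply: Ax; rewrite gt_eqF.
Qed.

Lemma cvg_right_derive f p v : derivable f p v ->
  (fun h : R => h^-1 * (f (p + h *: v) - f p)) @ 0^'+ --> 'D_v f p.
Proof.
move=> /cvg_ex [l fl].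
have -> : 'D_v f p = l by exact: cvg_lim fl.
have s := right_to_dnbhs0.
have := cvg_trans (cvg_app _ s) fl.
by apply: cvg_trans; apply: near_eq_cvg; near=> h; rewrite /= [_ *: v + p]addrC.
Unshelve. all: by end_near. Qed.

Lemma derive_le0_right f p v : derivable f p v ->
  (\forall h \near 0^'+, f (p + h *: v) <= f p) -> 'D_v f p <= 0.
Proof.
move=> df H; rewrite leNgt; apply/negP => D0.
have N := cvgr_gt _ (cvg_right_derive df) _ D0.
near (0:R)^'+ => h.
have h0 : 0 < h by near: h; exact: nbhs_right_gt.
have fh : f (p + h *: v) <= f p by near: h.
have : 0 < h^-1 * (f (p + h *: v) - f p) by near: h; exact: N.
by rewrite pmulr_rgt0 ?invr_gt0 // subr_gt0 ltNge fh.
Unshelve. all: by end_near. Qed.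

(** If the second derivative were positive, the first derivative, zero at [p],
would be positive just after [p], and [f] would exceed [f p] on the ray. Only
one side is used, so that [p] may lie on the boundary of the region where [f]
is maximal. *)
Lemma derive2_le0_right U f p v : open U -> smooth U f -> U p ->
  (\forall h \near 0^'+, f (p + h *: v) <= f p) -> 'D_v f p = 0 ->
  'D_v ('D_v f) p <= 0.
Proof.
move=> oU sf Up H D0; rewrite leNgt; apply/negP => c0.
have C := cvg_right_derive (smooth_derivable (v := v) (smooth_derive v sf) Up).
have N := cvgr_gt _ C _ c0.
have NU := near_square v 0 oU Up.
have N' : nbhs (0:R) (fun h : R => 0 < h -> 0 < h^-1 * ('D_v f (p + h *: v) - 'D_v f p)) by exact: N.
have [d /= d0 Hd] := (nbhs_ballP _ _).1 N'.
near (0:R)^'+ => h.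
have h0 : 0 < h by near: h; exact: nbhs_right_gt.
have hd : h < d by near: h; exact: nbhs_right_lt.
have hU : forall s t : R, 0 <= s <= h -> 0 <= t <= h -> U (p + s *: v + t *: 0) by near: h.
have fh : f (p + h *: v) <= f p by near: h.
have [|c /andP[ch0 ch] E] := @mvt_line f p v h h0.
  move=> s sh; apply: smooth_diff sf _; have := hU s 0 sh.
  by rewrite lexx ltW // scale0r addr0; apply.
have := Hd c; rewrite /ball /= sub0r normrN gtr0_norm // => /(_ (lt_trans ch hd) ch0).
rewrite D0 subr0 pmulr_rgt0 ?invr_gt0 // => g0.
have : 0 < f (p + h *: v) - f p by rewrite E mulr_gt0.
by rewrite subr_gt0 ltNge fh.
Unshelve. all: by end_near. Qed.

(** A direction pointing into [A], at least weakly. At a boundary point of a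
half-space, this holds for [v] or for [- v]. *)
Definition ray A p v := \forall h \near 0^'+, A (p + h *: v).

Lemma ray_near A p v (P : set R) : ray A p v \/ ray A p (- v) ->
  (\forall h \near (0:R)^', P h) -> exists2 h : R, A (p + h *: v) & P h.
Proof.
move=> [r|r] NP.
  have s := right_to_dnbhs0.
  have NP' := s _ NP.
  near (0:R)^'+ => h.
  by exists h; near: h.
have NP' : \forall h \near (0:R)^'+, P (- h).
  have : \forall h \near (0:R)^', P (- h).
    have NP' : nbhs (0:R) (fun y : R => y != 0 -> P y) by exact: NP.
    have [e /= e0 H] := (nbhs_ballP _ _).1 NP'.
    apply: (_ : nbhs (0:R) (fun y : R => y != 0 -> P (- y))).
    apply/nbhs_ballP; exists e => //= y; rewrite /ball /= sub0r normrN => ye y0.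
    by apply: H; rewrite /ball /= ?sub0r ?normrN ?oppr_eq0.
  exact: right_to_dnbhs0.
near (0:R)^'+ => h.
exists (- h); last by near: h.
by rewrite scaleNr -scalerN; near: h.
Unshelve. all: by end_near. Qed.

Lemma near_ray (P : set V) p v : (\forall y \near p, P y) ->
  \forall h \near (0:R), P (p + h *: v).
Proof.
move=> NP.
have c : {for (0:R), continuous (fun h : R => p + h *: v)}.
  by apply: cvgD; [exact: cvg_cst|apply: cvgZr_tmp; exact: cvg_id].
by apply: c; rewrite scale0r addr0.
Qed.

(** A derivative within [A] can be computed on any extension, from one side if
need be; this is how every statement about [derive_in] becomes one about
ordinary derivatives. *)
Lemma derive_in_ext (W : normedModType R) A (f F : V -> W) v p :
  ray A p v \/ ray A p (- v) -> A p -> derivable F p v ->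
  (\forall y \near p, A y -> F y = f y) -> derive_in A f v p = 'D_v F p.
Proof.
move=> r Ap dF NF.
have Fp : F p = f p by move/nbhs_singleton: NF; apply.
have PF : ProperFilter (within [set h : R | A (p + h *: v)] 0^').
  split; last exact: within_filter.
  move=> N; have [h Ah] := ray_near r N.
  by apply.
apply: cvg_lim; first exact: norm_hausdorff.
have /cvg_ex[l Fl] := dF.
have -> : 'D_v F p = l by apply: cvg_lim Fl; exact: norm_hausdorff.
have := cvg_trans (cvg_app _ (@cvg_within _ (0:R)^' _ [set h : R | A (p + h *: v)])) Fl => C.
apply: cvg_trans (C _).
apply: near_eq_cvg; rewrite near_withinE.
have H : \forall h \near (0:R)^', A (p + h *: v) -> F (p + h *: v) = f (p + h *: v).
  by apply: cvg_within; exact: near_ray NF.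
by apply: filterS H => h + Ah => /(_ Ah) E /=; rewrite [_ *: v + p]addrC E Fp.
Qed.

End Lines.

(** * Functions with smooth local extensions *)

Section Regular.
Context {R : realType} {n : nat}.
Local Notation E := (R^o * 'rV[R]_n)%type.
Implicit Types (A B : set 'rV[R]_n) (f g : R -> 'rV[R]_n -> R) (p v w : 'rV[R]_n) (t : R).

Definition relopen A := exists2 U : set 'rV[R]_n, open U & A = U `&` halfspace.

Lemma halfspace_ray p v : halfspace p ->
  (forall i : 'I_n, i = 0%N :> nat -> 0 <= v 0 i) -> ray halfspace p v.
Proof.
move=> Hp Hv; near=> h => i i0; rewrite !mxE addr_ge0 ?Hp // mulr_ge0 ?Hv //.
Unshelve. all: by end_near. Qed.

(** The coordinate of index 0 must not decrease, so that the half-space is not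
left. *)
Lemma relopen_ray_in A p v : relopen A -> A p ->
  (forall i : 'I_n, i = 0%N :> nat -> 0 <= v 0 i) -> ray A p v.
Proof.
move=> [U oU ->] [Up Hp] Hv.
have NU : \forall h \near (0:R)^'+, U (p + h *: v).
  by apply: cvg_within; apply: near_ray; exact: open_nbhs_nbhs.
by apply: filterS2 NU (halfspace_ray Hp Hv) => h.
Qed.

Lemma relopen_ray A p v : relopen A -> A p -> ray A p v \/ ray A p (- v).
Proof.
move=> rA Ap.
have [H|/existsNP[i /not_implyP[i0 /negP]]] :=
  pselect (forall i : 'I_n, i = 0%N :> nat -> 0 <= v 0 i).
  by left; exact: relopen_ray_in.
rewrite -ltNge => vi; right; apply: relopen_ray_in => // j j0.
have -> : j = i by apply: val_inj; rewrite /= j0 i0.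
by rewrite mxE oppr_ge0 ltW.
Qed.

Lemma interior_ray A p v : relopen A -> A p -> ~ halfspace_bd p -> ray A p v.
Proof.
move=> [U oU ->] [Up Hp] nbd.
have NU : \forall h \near (0:R)^'+, U (p + h *: v).
  by apply: cvg_within; apply: near_ray; exact: open_nbhs_nbhs.
have NH : \forall h \near (0:R)^'+, halfspace (p + h *: v).
  have [[i i0]|noi] := pselect (exists i : 'I_n, i = 0%N :> nat); last first.
    by near=> h => i i0; case: noi; exists i.
  have pi0 : 0 < p 0 i.
    rewrite lt_neqAle Hp // andbT; apply/eqP => pi; apply: nbd; by exists i.
  have C : (fun h : R => p 0 i + h * v 0 i) @ (0:R)^'+ --> p 0 i.
    have C0 : (fun h : R => p 0 i + h * v 0 i) @ (0:R) --> p 0 i + 0 * v 0 i.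
      by apply: cvgD; [exact: cvg_cst|apply: cvgM; [exact: cvg_id|exact: cvg_cst]].
    by rewrite mul0r addr0 in C0; exact: cvg_within_filter.
  have : \forall h \near (0:R)^'+, 0 < p 0 i + h * v 0 i by exact: cvgr_gt C _ pi0.
  apply: filterS => h hi j j0.
  have -> : j = i by apply: val_inj; rewrite /= j0 i0.
  by rewrite !mxE ltW.
by apply: filterS2 NU NH => h.
Unshelve. all: by end_near. Qed.

Definition extends A f (U : set E) (F : E -> R) :=
  [/\ open U, smooth U F &
   forall t p, 0 <= t <= 1 -> A p -> U (t, p) -> F (t, p) = f t p].

(** The class of functions on [0,1] times a set to which the calculus applies:
locally restrictions of smooth functions of time and space. Time-independent
functions belong to it as constant families. *)
Definition regular A f := forall t p, 0 <= t <= 1 -> A p ->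
  exists (U : set E) (F : E -> R), U (t, p) /\ extends A f U F.

(** The derivative in space at a fixed time, in a fixed direction. On [regular]
functions it obeys the usual rules, at boundary points and at the end points of
time too. *)
Definition dv A v f : R -> 'rV[R]_n -> R :=
  fun t p => derive_in A (f t : 'rV[R]_n -> R^o) v p.

(** Links the derivative in space at fixed [t] to the one in the product of
time and space. *)
Lemma derive_slice (F : E -> R) t p v :
  'D_v (fun q => F (t, q)) p = 'D_(0, v) F (t, p) /\
  (derivable F (t, p) (0, v) -> derivable (fun q => F (t, q)) p v).
Proof.
have EE : (fun h : R => h^-1 *: (((fun q => F (t, q)) \o shift p) (h *: v) - F (t, p)))
  = (fun h : R => h^-1 *: ((F \o shift (t, p)) (h *: (0, v)) - F (t, p))).
  apply/funext => h /=.
  have -> // : h *: ((0 : R^o), v) + (t, p) = (t, h *: v + p).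
  have E1 : h *: (0 : R^o) + t = t by rewrite scaler0 add0r.
  by rewrite -[RHS](congr1 (fun s => (s, h *: v + p)) E1).
by split; [rewrite /derive EE|rewrite /derivable EE].
Qed.

Lemma differentiable_slice (U : set E) (F : E -> R) t p : smooth U F -> U (t, p) ->
  differentiable (fun q => F (t, q)) p.
Proof.
move=> sF Utp.
have dF := smooth_diff sF Utp.
pose c : 'rV[R]_n -> R^o := fun=> t.
pose i : 'rV[R]_n -> 'rV[R]_n := id.
have dc : differentiable c p by exact: differentiable_cst.
have di : differentiable i p by exact: ex_diff.
have dP := differentiable_pair dc di.
exact: (differentiable_comp dP dF).
Qed.

(** The extension can be differentiated: this makes [regular] stable under [dv]
and reduces the identities below to those of smooth functions on open sets. *)
Lemma extends_dv A f U F v : relopen A -> extends A f U F ->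
  extends A (dv A v f) U ('D_(0, v) F).
Proof.
move=> rA [oU sF FE]; split=> // [|t p t01 Ap Utp]; first exact: smooth_derive.
have [<- dF] := derive_slice F t p v.
rewrite /dv (@derive_in_ext R _ R A (f t) (fun q => F (t, q)) v p) //.
- exact: relopen_ray.
- by apply: dF; exact: smooth_derivable sF Utp.
- have NU : nbhs (t, p) U by exact: open_nbhs_nbhs.
  have : \forall y \near p, U (t, y).
    have [[B1 B2] [/= N1 N2] H] := NU.
    by apply: filterS N2 => y By; apply: (H (t, y)); split=> //=; exact: nbhs_singleton.
  by apply: filterS => y Uy Ay; exact: FE.
Qed.

Lemma regular_dv A f v : relopen A -> regular A f -> regular A (dv A v f).
Proof.
move=> rA rf t p t01 Ap; have [U [F [Utp H]]] := rf t p t01 Ap.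
by exists U, ('D_(0, v) F); split=> //; exact: extends_dv.
Qed.

Lemma extends_eq A f g U F : (forall t p, 0 <= t <= 1 -> A p -> f t p = g t p) ->
  extends A f U F -> extends A g U F.
Proof. by move=> fg [oU sF FE]; split=> // t p t01 Ap Utp; rewrite FE // fg. Qed.

Lemma regular_eq A f g : (forall t p, 0 <= t <= 1 -> A p -> f t p = g t p) ->
  regular A f -> regular A g.
Proof.
move=> fg rf t p t01 Ap; have [U [F [Utp H]]] := rf t p t01 Ap.
by exists U, F; split=> //; exact: extends_eq fg _.
Qed.

Lemma extends_sub A f U U' F : open U' -> U' `<=` U -> extends A f U F -> extends A f U' F.
Proof.
move=> oU' UU [oU sF FE]; split=> // [k|t p t01 Ap /UU Utp].
  exact: smooth_upto_sub UU _.
exact: FE.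
Qed.

Lemma regular_common_domain A f g t p : regular A f -> regular A g -> 0 <= t <= 1 -> A p ->
  exists U F G, [/\ U (t, p), extends A f U F & extends A g U G].
Proof.
move=> rf rg t01 Ap.
have [U [F [Utp H]]] := rf t p t01 Ap.
have [U' [G [Utp' H']]] := rg t p t01 Ap.
have oUU : open (U `&` U') by apply: openI; [case: H|case: H'].
exists (U `&` U'), F, G; split=> //.
- by apply: extends_sub H => // ? [].
- by apply: extends_sub H' => // ? [].
Qed.

Lemma dv_ext A f U F v t p : relopen A -> extends A f U F -> 0 <= t <= 1 -> A p ->
  U (t, p) -> dv A v f t p = 'D_(0, v) F (t, p).
Proof. by move=> rA H t01 Ap Utp; have [_ _ ->] := extends_dv v rA H. Qed.

Lemma dv_eq A f g v t p : relopen A ->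
  (forall p, A p -> f t p = g t p) ->
  0 <= t <= 1 -> A p -> dv A v f t p = dv A v g t p.
Proof.
move=> rA fg t01 Ap; rewrite /dv /derive_in; congr (lim _).
have PF : ProperFilter (within [set h : R | A (p + h *: v)] 0^').
  split; last exact: within_filter.
  by move=> N; have [h Ah] := ray_near (relopen_ray v rA Ap) N; apply.
rewrite eqEsubset; split; apply: near_eq_cvg; rewrite near_withinE; near=> h => Ah;
  by rewrite !fg.
Unshelve. all: by end_near. Qed.

Lemma regular_cst A (c : R) : regular A (fun _ _ => c).
Proof.
move=> t p t01 Ap; exists setT, (fun=> c); split=> //; split=> //; first exact: openT.
by move=> k; apply: smooth_upto_cst; exact: openT.
Qed.

Lemma dv_cst A (c : R -> R) v t p : relopen A -> 0 <= t <= 1 -> A p ->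
  dv A v (fun t _ => c t) t p = 0.
Proof.
move=> rA t01 Ap; rewrite (_ : dv A v _ t p = dv A v (fun _ _ => c t) t p) //.
have H : extends A (fun _ _ => c t) setT (fun=> c t).
  split=> //; first exact: openT.
  by move=> k; apply: smooth_upto_cst; exact: openT.
rewrite (dv_ext v rA H) // (_ : (fun=> c t) = cst (c t)) // derive_cst.
by [].
Qed.

Section Binary.
Variables (A : set 'rV[R]_n) (f g : R -> 'rV[R]_n -> R).
Hypotheses (rA : relopen A) (rf : regular A f) (rg : regular A g).

Lemma regularD : regular A (fun t p => f t p + g t p).
Proof.
move=> t p t01 Ap; have [U [F [G [Utp [oU sF FE] [_ sG GE]]]]] := regular_common_domain rf rg t01 Ap.
exists U, (F \+ G); split=> //; split=> //.
  by move=> k; exact: smooth_uptoD (sF k) (sG k).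
by move=> s q s01 Aq Uq /=; rewrite FE // GE.
Qed.

Lemma regularM : regular A (fun t p => f t p * g t p).
Proof.
move=> t p t01 Ap; have [U [F [G [Utp [oU sF FE] [_ sG GE]]]]] := regular_common_domain rf rg t01 Ap.
exists U, (F \* G); split=> //; split=> //.
  by move=> k; exact: smooth_uptoM (sF k) (sG k).
by move=> s q s01 Aq Uq /=; rewrite FE // GE.
Qed.

Lemma dvD v t p : 0 <= t <= 1 -> A p ->
  dv A v (fun t p => f t p + g t p) t p = dv A v f t p + dv A v g t p.
Proof.
move=> t01 Ap; have [U [F [G [Utp HF HG]]]] := regular_common_domain rf rg t01 Ap.
have [oU sF FE] := HF; have [_ sG GE] := HG.
have H : extends A (fun t p => f t p + g t p) U (F + G).
  split=> //; first by move=> k; exact: smooth_uptoD (sF k) (sG k).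
  by move=> s q s01 Aq Uq; rewrite fctE FE // GE.
rewrite (dv_ext v rA H) // (dv_ext v rA HF) // (dv_ext v rA HG) //.
by rewrite deriveD //; [exact: smooth_derivable sF Utp|exact: smooth_derivable sG Utp].
Qed.

Lemma dvM v t p : 0 <= t <= 1 -> A p ->
  dv A v (fun t p => f t p * g t p) t p = f t p * dv A v g t p + g t p * dv A v f t p.
Proof.
move=> t01 Ap; have [U [F [G [Utp HF HG]]]] := regular_common_domain rf rg t01 Ap.
have [oU sF FE] := HF; have [_ sG GE] := HG.
have H : extends A (fun t p => f t p * g t p) U (F * G).
  split=> //; first by move=> k; exact: smooth_uptoM (sF k) (sG k).
  by move=> s q s01 Aq Uq; rewrite fctE FE // GE.
rewrite (dv_ext v rA H) // (dv_ext v rA HF) // (dv_ext v rA HG) //.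
by rewrite deriveM; [rewrite FE // GE|exact: smooth_derivable sF Utp|exact: smooth_derivable sG Utp].
Qed.

End Binary.

Lemma regularV A f : (forall t p, 0 <= t <= 1 -> A p -> f t p != 0) ->
  regular A f -> regular A (fun t p => (f t p)^-1).
Proof.
move=> f0 rf t p t01 Ap; have [U [F [Utp [oU sF FE]]]] := rf t p t01 Ap.
have oU' : open (U `&` F @^-1` [set x | x != 0]).
  move: (oU); rewrite !openE => oU1 x [Ux Fx].
  have N1 : nbhs x U by exact: oU1.
  have cF : {for x, continuous F} by exact: differentiable_continuous (smooth_diff sF Ux).
  have N2 : nbhs x (F @^-1` [set x | x != 0]).
    by apply: cF; apply: open_nbhs_nbhs; split=> //; exact: open_neq.
  exact: filterI N1 N2.
exists (U `&` F @^-1` [set x | x != 0]), (fun x => (F x)^-1); split.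
  by split=> //=; rewrite FE // f0.
split=> // [k|s q s01 Aq [Uq _]]; last by rewrite FE.
apply: smooth_uptoV => // [x []//|].
by apply: smooth_upto_sub (sF k) => x [].
Qed.

Lemma regular_sum A (I : Type) (r : seq I) (P : pred I) (F : I -> R -> 'rV[R]_n -> R) :
  (forall i, P i -> regular A (F i)) ->
  regular A (fun t p => \sum_(i <- r | P i) F i t p).
Proof.
move=> rF; elim: r => [|i r IH].
  by apply: regular_eq (regular_cst (A := A) 0) => t p _ _; rewrite big_nil.
have [Pi|nPi] := boolP (P i).
  by apply: regular_eq (regularD (rF i Pi) IH) => t p _ _; rewrite big_cons Pi.
by apply: regular_eq IH => t p _ _; rewrite big_cons (negbTE nPi).
Qed.

Lemma regular_prod A (I : Type) (r : seq I) (P : pred I) (F : I -> R -> 'rV[R]_n -> R) :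
  (forall i, P i -> regular A (F i)) ->
  regular A (fun t p => \prod_(i <- r | P i) F i t p).
Proof.
move=> rF; elim: r => [|i r IH].
  by apply: regular_eq (regular_cst (A := A) 1) => t p _ _; rewrite big_nil.
have [Pi|nPi] := boolP (P i).
  by apply: regular_eq (regularM (rF i Pi) IH) => t p _ _; rewrite big_cons Pi.
by apply: regular_eq IH => t p _ _; rewrite big_cons (negbTE nPi).
Qed.

Lemma dv_sum A (I : Type) (r : seq I) (P : pred I) (F : I -> R -> 'rV[R]_n -> R) v t p :
  relopen A -> (forall i, P i -> regular A (F i)) -> 0 <= t <= 1 -> A p ->
  dv A v (fun t p => \sum_(i <- r | P i) F i t p) t p = \sum_(i <- r | P i) dv A v (F i) t p.
Proof.
move=> rA rF t01 Ap; elim: r => [|i r IH].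
  rewrite big_nil -[RHS](dv_cst (fun=> 0) v rA t01 Ap).
  by congr (dv A v _ t p); apply/funext => s; apply/funext => q; rewrite big_nil.
rewrite big_cons; have [Pi|nPi] := boolP (P i); last first.
  by rewrite -IH; congr (dv A v _ t p); apply/funext => s; apply/funext => q;
    rewrite big_cons (negbTE nPi).
rewrite -IH -dvD //; [|exact: rF|exact: regular_sum].
by congr (dv A v _ t p); apply/funext => s; apply/funext => q; rewrite big_cons Pi.
Qed.

(** The extension is differentiable, hence its derivative is linear in the
direction, although [dv] itself may only be one-sided. *)
Lemma dv_coord A f v t p : relopen A -> regular A f -> 0 <= t <= 1 -> A p ->
  dv A v f t p = \sum_j v 0 j * dv A (delta_mx 0 j) f t p.
Proof.
move=> rA rf t01 Ap; have [U [F [Utp H]]] := rf t p t01 Ap.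
have [oU sF FE] := H.
have dF := differentiable_slice sF Utp.
rewrite (dv_ext v rA H) // -(derive_slice F t p v).1.
under eq_bigr do rewrite (dv_ext _ rA H) // -(derive_slice F t p _).1.
rewrite deriveE // [in LHS](row_sum_delta v) linear_sum.
by apply: eq_bigr => j _; rewrite linearZ /= -deriveE.
Qed.

Lemma dv_sym A f v w t p : relopen A -> regular A f -> 0 <= t <= 1 -> A p ->
  dv A w (dv A v f) t p = dv A v (dv A w f) t p.
Proof.
move=> rA rf t01 Ap; have [U [F [Utp H]]] := rf t p t01 Ap.
have [oU sF _] := H.
have E1 := dv_ext w rA (extends_dv v rA H) t01 Ap Utp.
have E2 := dv_ext v rA (extends_dv w rA H) t01 Ap Utp.
apply: (etrans E1); apply: (etrans _ (esym E2)).
exact: derive_sym oU sF Utp.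
Qed.

Lemma regular_subset A B f : B `<=` A -> regular A f -> regular B f.
Proof.
move=> BA rf t p t01 Bp; have [U [F [Utp [oU sF FE]]]] := rf t p t01 (BA _ Bp).
by exists U, F; split=> //; split=> // s q s01 /BA Aq; exact: FE.
Qed.

(** Charts are compared on their overlap, a smaller relatively open set; this
does not affect derivatives. *)
Lemma dv_subset A B f v t p : relopen A -> relopen B -> B `<=` A -> regular A f ->
  0 <= t <= 1 -> B p -> dv A v f t p = dv B v f t p.
Proof.
move=> rA rB BA rf t01 Bp; have [U [F [Utp H]]] := rf t p t01 (BA _ Bp).
have H' : extends B f U F.
  by have [oU sF FE] := H; split=> // s q s01 /BA Aq; exact: FE.
by rewrite (dv_ext v rA H) ?(dv_ext v rB H') //; exact: BA.
Qed.

End Regular.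

(** * Composition, determinants and inverse matrices *)

Section DetReplace.
Variables (R : comNzRingType) (m : nat).
Implicit Types (D M : 'M[R]_m).

Definition replace_row D M (i : 'I_m) : 'M[R]_m :=
  \matrix_(k, l) if k == i then D k l else M k l.

(** The left-hand side is what the product rule gives for the derivative of a
determinant; expanding each term along its replaced row gives the cofactors. *)
Lemma sum_det_replace_row D M :
  \sum_i \det (replace_row D M i) = \tr (D *m \adj M).
Proof.
rewrite /mxtrace; apply: eq_bigr => i _; rewrite (expand_det_row _ i) mxE.
apply: eq_bigr => l _; rewrite !mxE eqxx; congr (_ * (_ * \det _)).
by apply/matrixP => a b; rewrite !mxE eq_sym (negbTE (neq_lift _ _)).
Qed.
End DetReplace.

Section RegularCalculus.
Context {R : realType} {n : nat}.
Local Notation E := (R^o * 'rV[R]_n)%type.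
Implicit Types (A B : set 'rV[R]_n) (f g : R -> 'rV[R]_n -> R) (p v w : 'rV[R]_n) (t : R).

Lemma pairDE (a b : R^o) (v w : 'rV[R]_n) : ((a, v) : E) + (b, w) = (a + b, v + w).
Proof. by []. Qed.
Lemma pairZE (a b : R) (v : 'rV[R]_n) : a *: ((b, v) : E) = (a * b, a *: v).
Proof. by []. Qed.
Lemma sum_pair0E m (x : 'I_m -> R) (e : 'I_m -> 'rV[R]_n) :
  \sum_i x i *: ((0, e i) : E) = (0, \sum_i x i *: e i).
Proof.
elim/big_ind2: _ => // [a a' b b' -> ->|i _]; first by rewrite pairDE addr0.
by rewrite pairZE mulr0.
Qed.

Lemma smooth_fst (U : set E) : open U -> smooth U (fst : E -> R).
Proof. by move=> oU k; apply: smooth_upto_lin => // x; exact: cvg_fst. Qed.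

Lemma smooth_coord (U : set E) k : open U -> smooth U (fun z => z.2 0 k).
Proof.
move=> oU m.
have @f : {linear E -> R}.
  by exists (fun z : E => z.2 0 k); do 2![eexists]; do ?[constructor];
     rewrite ?mxE// => ? *; rewrite ?mxE//; move=> ?; rewrite !mxE.
apply: (@smooth_upto_lin _ _ m U f) => // x.
apply: (@continuous_comp _ _ _ (snd : E -> 'rV[R]_n) (fun y : 'rV[R]_n => y 0 k)).
  exact: cvg_snd.
exact: coord_continuous.
Qed.

Lemma regular_time A f : smooth_in_time A f -> regular A f.
Proof.
move=> sf t p t01 Ap.
have [|U [F [oU Utp sF FE]]] := sf (t, p); first by split=> //=; rewrite in_itv.
exists U, F; split=> //; split=> //; first exact: smooth_open_smooth.
by move=> s q s01 Aq Usq; rewrite FE //; split=> //=; rewrite in_itv.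
Qed.

Lemma open_snd (U : set 'rV[R]_n) : open U -> open ((snd : E -> 'rV[R]_n) @^-1` U).
Proof. by apply: open_comp => x _; exact: cvg_snd. Qed.

(** An extension in space gives one in time and space by composing with the
second projection. *)
Lemma regular_smooth_on A (f : 'rV[R]_n -> R^o) : smooth_on A f ->
  regular A (fun _ => f).
Proof.
move=> sf t p t01 Ap; have [U [F [oU Up sF FE]]] := sf p Ap.
have oV := open_snd oU.
exists (snd @^-1` U), (F \o snd); split=> //; split=> // [k|s q _ Aq Uq]; last exact: FE.
pose Phi := fun z : E => 0 + \sum_k z.2 0 k *: (delta_mx 0 k : 'rV[R]_n).
have PhiE : (snd : E -> 'rV[R]_n) = Phi.
  by apply/funext => z; rewrite /Phi add0r; exact: row_sum_delta.
rewrite PhiE.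
apply: (@smooth_upto_comp R E 'rV[R]_n n k _ U F 0 (fun k => delta_mx 0 k) (fun k z => z.2 0 k)) => //.
- by rewrite -PhiE.
- by move=> i; apply: smooth_coord; rewrite -PhiE.
- exact: smooth_open_smooth.
Qed.

Section Compose.
Variables (A B : set 'rV[R]_n) (g : R -> 'rV[R]_n -> R) (psi : 'rV[R]_n -> 'rV[R]_n).
Hypotheses (rA : relopen A) (rB : relopen B) (rg : regular B g).
Hypotheses (rpsi : forall k, regular A (fun _ p => psi p 0 k)).
Hypothesis AB : forall p, A p -> B (psi p).

Let ee (i : 'I_n.+1) : E := oapp (fun j => (0, delta_mx 0 j)) (1, 0) (unlift ord0 i).

Let Phi (P : 'I_n -> E -> R) (z : E) : E :=
  (0, 0) + \sum_i (oapp P (fst : E -> R) (unlift ord0 i)) z *: ee i.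

Let PhiE P z : Phi P z = (z.1, \row_k P k z).
Proof.
rewrite /Phi big_ord_recl /ee unlift_none /=.
under eq_bigr do rewrite liftK /=.
rewrite sum_pair0E pairZE !pairDE scaler0 mulr1 !add0r addr0.
congr (_, _); apply/rowP => k; rewrite mxE summxE (bigD1 k) //= big1 ?addr0.
  by rewrite !mxE !eqxx mulr1.
by move=> j jk; rewrite !mxE eqxx eq_sym (negbTE jk) mulr0.
Qed.

Lemma extends_family t p : 0 <= t <= 1 -> A p -> exists (U : set E) (P : 'I_n -> E -> R),
  [/\ open U, U (t, p) & forall k, extends A (fun _ p => psi p 0 k) U (P k)].
Proof.
move=> t01 Ap.
pose Q (k : 'I_n) (x : set E * (E -> R)) := x.1 (t, p) /\ extends A (fun _ p => psi p 0 k) x.1 x.2.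
have exQ k : exists x, Q k x.
  by have [U [F H]] := rpsi k t01 Ap; exists (U, F).
have [G HG] : exists G : 'I_n -> set E * (E -> R), forall k, Q k (G k).
  by exists (fun k => sval (cid (exQ k))) => k; exact: svalP (cid (exQ k)).
have oU : open (\bigcap_(k in [set: 'I_n]) (G k).1).
  rewrite openE => z Hz; rewrite /interior /=.
  suff N : \forall y \near z, forall k, (G k).1 y.
    by apply: filterS N => y Hy k _; exact: Hy.
  apply: (@filter_forall _ _ (fun k => (G k).1) (nbhs z) _) => k; have [_ [oU _ _]] := HG k.
  by apply: open_nbhs_nbhs; split=> //; exact: Hz.
exists (\bigcap_(k in [set: 'I_n]) (G k).1), (fun k => (G k).2); split=> //.
  by move=> k _; have [] := HG k.
move=> k; have [_ H] := HG k.
by apply: extends_sub H => // z; apply.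
Qed.

(** The extension of [psi] must be combined with the time coordinate, so the
map is taken with values in time and space; it has one coordinate function more
than [psi], the time, put at index 0. *)
Lemma compose_ext t p : 0 <= t <= 1 -> A p -> exists U P V G,
  [/\ U (t, p) /\ V (t, psi p), extends A (fun t p => g t (psi p)) U (G \o Phi P),
      extends B g V G, forall k, extends A (fun _ p => psi p 0 k) U (P k) &
      forall z, U z -> V (Phi P z)].
Proof.
move=> t01 Ap.
have [U [P [oU Utp HP]]] := extends_family t01 Ap.
have [V [G [Vt HG]]] := rg t01 (AB Ap).
have [oV sG GE] := HG.
have PhiA s q : 0 <= s <= 1 -> A q -> U (s, q) -> Phi P (s, q) = (s, psi q).
  move=> s01 Aq Usq; rewrite PhiE /=; congr (_, _); apply/rowP => k.
  by rewrite mxE; have [_ _ ->] := HP k.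
have dphi z i : U z -> differentiable (oapp P (fst : E -> R) (unlift ord0 i)) z.
  move=> Uz; case: unliftP => [j _|_] /=.
    by have [_ sP _] := HP j; exact: smooth_diff sP Uz.
  exact: smooth_diff (smooth_fst oU) Uz.
have cPhi z : U z -> {for z, continuous (Phi P)}.
  move=> Uz; apply: differentiable_continuous; apply: differentiable_coord_map.
  by move=> i; exact: dphi.
have oU' : open (U `&` Phi P @^-1` V).
  rewrite openE => z [Uz Vz]; rewrite /interior /=.
  apply: filterI; first exact: open_nbhs_nbhs.
  by apply: (cPhi z Uz); exact: open_nbhs_nbhs.
exists (U `&` Phi P @^-1` V), P, V, G; split=> //.
- by split=> //; split=> //=; rewrite PhiA.
- split=> // [k|s q s01 Aq [Uq Vq]].
    apply: smooth_upto_comp (sG k) => // [z []//|i].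
    case: unliftP => [j _|_] /=; last exact: smooth_fst.
    have [_ sP _] := HP j => k'.
    by apply: smooth_upto_sub (sP k') => z [].
  by move: Vq; rewrite /preimage /= PhiA // => Vq; rewrite GE //; exact: AB.
- by move=> k; apply: extends_sub (HP k) => // z [].
- by move=> z [].
Qed.

Lemma regular_comp : regular A (fun t p => g t (psi p)).
Proof.
move=> t p t01 Ap; have [U [P [V [G [[Utp _] H _ _ _]]]]] := compose_ext t01 Ap.
by exists U, (G \o Phi P).
Qed.

Lemma dv_comp v t p : 0 <= t <= 1 -> A p ->
  dv A v (fun t p => g t (psi p)) t p =
  \sum_k dv A v (fun _ p => psi p 0 k) t p * dv B (delta_mx 0 k) g t (psi p).
Proof.
move=> t01 Ap; have [U [P [V [G [[Utp Vtp] H HG HP UV]]]]] := compose_ext t01 Ap.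
have [oU _ _] := H; have [_ sG _] := HG.
have PhiA : Phi P (t, p) = (t, psi p).
  rewrite PhiE /=; congr (_, _); apply/rowP => k.
  by rewrite mxE; have [_ _ ->] := HP k.
rewrite (dv_ext v rA H t01 Ap Utp).
have dphi i : differentiable (oapp P (fst : E -> R) (unlift ord0 i)) (t, p).
  case: unliftP => [j _|_] /=.
    by have [_ sP _] := HP j; exact: smooth_diff sP Utp.
  exact: smooth_diff (smooth_fst oU) Utp.
have dG : differentiable G (Phi P (t, p)) by apply: smooth_diff sG _; exact: UV.
have [_ ->] := derive_comp_coord (0, v) dG dphi.
rewrite big_ord_recl unlift_none /=.
have -> : 'D_(0, v) (fst : E -> R) (t, p) = 0.
  rewrite deriveE; last exact: smooth_diff (smooth_fst oU) Utp.
  by rewrite diff_lin // => z; exact: cvg_fst.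
rewrite mul0r add0r; apply: eq_bigr => k _.
rewrite liftK /= (dv_ext v rA (HP k) t01 Ap Utp) /ee liftK /= -/(Phi P (t, p)) PhiA.
by rewrite (dv_ext (delta_mx 0 k) rB HG t01 (AB Ap) Vtp).
Qed.

End Compose.

(** Freezing the time is the composition of an extension with an affine map. *)
Lemma regular_fix A f t0 : regular A f -> 0 <= t0 <= 1 -> regular A (fun _ => f t0).
Proof.
move=> rf t01 t p _ Ap; have [U [F [Utp [oU sF FE]]]] := rf t0 p t01 Ap.
pose Phi := fun z : E => ((t0, 0) : E) + \sum_k z.2 0 k *: ((0, delta_mx 0 k) : E).
have PhiE z : Phi z = (t0, z.2).
  by rewrite /Phi sum_pair0E pairDE addr0 add0r -row_sum_delta.
have oV : open (Phi @^-1` U).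
  apply: open_comp => // z _; apply: differentiable_continuous.
  apply: differentiable_coord_map => i.
  exact: smooth_diff (smooth_coord i openT) I.
exists (Phi @^-1` U), (F \o Phi); split; first by rewrite /preimage /= PhiE.
split=> // [k|s q _ Aq]; last by rewrite /preimage /= PhiE => Uq; exact: FE.
apply: smooth_upto_comp (sF k) => // i; exact: smooth_coord.
Qed.

Lemma regular_near A f t p : regular A f -> 0 <= t <= 1 -> A p ->
  forall e : R, 0 < e -> \forall z \near (t, p),
    0 <= z.1 <= 1 -> A z.2 -> `|f z.1 z.2 - f t p| < e.
Proof.
move=> rf t01 Ap e e0; have [U [F [Utp [oU sF FE]]]] := rf t p t01 Ap.
have cF := differentiable_continuous (smooth_diff sF Utp).
have N1 : nbhs ((t, p) : E) U by exact: open_nbhs_nbhs.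
have N2 : \forall z \near ((t, p) : E), `|F (t, p) - F z| < e.
  by move: cF => /cvgrPdist_lt/(_ _ e0).
apply: filterS2 N1 N2 => -[s q] Us Fs s01 Aq.
by rewrite distrC -!FE.
Qed.

(** Written with a case distinction inside the product, so that for the entries
selected by a permutation each term is again a term of a determinant. *)
Lemma dv_prod A (I : eqType) (r : seq I) (F : I -> R -> 'rV[R]_n -> R) v t p :
  relopen A -> uniq r -> (forall i, regular A (F i)) -> 0 <= t <= 1 -> A p ->
  dv A v (fun t p => \prod_(i <- r) F i t p) t p =
  \sum_(i <- r) \prod_(k <- r) (if k == i then dv A v (F k) t p else F k t p).
Proof.
move=> rA + rF t01 Ap; elim: r => [_|a r IH /= /andP[ar ur]].
  rewrite big_nil -[RHS](dv_cst (fun=> 1) v rA t01 Ap).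
  by congr (dv A v _ t p); apply/funext => s; apply/funext => q; rewrite big_nil.
have -> : (fun t p => \prod_(i <- a :: r) F i t p) =
    (fun t p => F a t p * (\prod_(i <- r) F i t p)).
  by apply/funext => s; apply/funext => q; rewrite big_cons.
rewrite dvM //; last exact: regular_prod.
rewrite big_cons big_cons eqxx addrC IH // mulr_sumr; congr (_ + _).
  rewrite mulrC; congr (_ * _); apply: eq_big_seq => k kr.
  by case: eqP => // ka; rewrite -ka kr in ar.
apply: eq_big_seq => i ir; rewrite big_cons; case: eqP => // ai.
by rewrite ai ir in ar.
Qed.

Section RegularMatrix.
Variables (m : nat) (A : set 'rV[R]_n) (J : R -> 'rV[R]_n -> 'M[R]_m).
Hypotheses (rA : relopen A) (rJ : forall i j, regular A (fun t p => J t p i j)).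

Definition dv_mx v t p : 'M[R]_m := \matrix_(i, j) dv A v (fun t p => J t p i j) t p.

Lemma dv_mxE v t p i j : dv_mx v t p i j = dv A v (fun t p => J t p i j) t p.
Proof. by rewrite mxE. Qed.

Lemma dv_det v t p : 0 <= t <= 1 -> A p ->
  dv A v (fun t p => \det (J t p)) t p = \tr (dv_mx v t p *m \adj (J t p)).
Proof.
move=> t01 Ap; rewrite -sum_det_replace_row.
have rP (s : {perm 'I_m}) : regular A (fun t p => \prod_i J t p i (s i)) by exact: regular_prod.
rewrite /determinant dv_sum //; last first.
  by move=> s _; apply: regularM => //; exact: regular_cst.
rewrite exchange_big /=; apply: eq_bigr => s _.
rewrite (dvM rA (regular_cst _) (rP s)) // (dv_cst (fun=> _)) // mulr0 addr0 -mulr_sumr.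
congr (_ * _); rewrite (dv_prod _ rA) ?index_enum_uniq //.
apply: eq_bigr => i _; apply: eq_bigr => k _; rewrite !mxE.
by case: eqP => // ->; rewrite mxE.
Qed.

End RegularMatrix.

Lemma regular_det m A (J : R -> 'rV[R]_n -> 'M[R]_m) :
  (forall i j, regular A (fun t p => J t p i j)) -> regular A (fun t p => \det (J t p)).
Proof.
move=> rJ; apply: regular_sum => s _; apply: regularM; first exact: regular_cst.
exact: regular_prod.
Qed.

Lemma regular_invmx m A (J : R -> 'rV[R]_n -> 'M[R]_m) i j :
  (forall i j, regular A (fun t p => J t p i j)) ->
  (forall t p, 0 <= t <= 1 -> A p -> J t p \in unitmx) ->
  regular A (fun t p => invmx (J t p) i j).
Proof.
move=> rJ uJ.
have H : regular A (fun t p => (\det (J t p))^-1 * cofactor (J t p) j i).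
  apply: regularM.
    apply: regularV; last exact: regular_det.
    by move=> t p t01 Ap; have := uJ t p t01 Ap; rewrite unitmxE unitfE.
  apply: regularM; first exact: regular_cst.
  apply: regular_det => a b.
  by apply: regular_eq (rJ (lift j a) (lift i b)) => t p _ _; rewrite !mxE.
by apply: regular_eq H => t p t01 Ap; rewrite /invmx uJ // !mxE.
Qed.

End RegularCalculus.

(** * The Piola identity *)

Section PiolaAlgebra.
Variables (R : comNzRingType) (n : nat).

(** The invariance of the divergence at one point, with the derivatives as
independent variables: [x] and [y] stand for a vector field times the density
of the volume form in the two charts, [dX] and [dY] for their derivatives, [dJ]
for the second derivatives of the transition map. The hypothesis is the
derivative of [x *m J = d *: y]. Multiplied by the inverse Jacobian and traced,
it has two terms with second derivatives; they cancel because [dJ] is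
symmetric. *)
Lemma piola_algebra (x y : 'rV[R]_n) (J K dX dY : 'M[R]_n) (dJ : 'I_n -> 'M[R]_n) (d : R) :
  J *m K = 1%:M -> K *m J = 1%:M -> x *m J = d *: y ->
  (forall l j k, dJ l j k = dJ j l k) ->
  (forall l k, \sum_j (x 0 j * dJ l j k + J j k * dX l j) =
     d * (\sum_m J l m * dY m k) + y 0 k * (d * \tr (dJ l *m K))) ->
  \tr dX = d * \tr dY.
Proof.
move=> JK KJ xJ sJ H.
pose S := \matrix_(l, k) \sum_j x 0 j * dJ l j k.
pose t := \col_l \tr (dJ l *m K).
have HM : S + dX *m J = d *: (J *m dY) + d *: (t *m y).
  apply/matrixP => l k; rewrite !mxE big_ord1 !mxE.
  transitivity (\sum_j (x 0 j * dJ l j k + J j k * dX l j)).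
    by rewrite big_split /=; congr (_ + _); apply: eq_bigr => j _; rewrite mulrC.
  by rewrite H; congr (_ + _); rewrite mulrCA; congr (_ * _); rewrite mulrC.
have xE : d *: (y *m K) = x by rewrite scalemxAl -xJ -mulmxA JK mulmx1.
have := congr1 (fun Z => \tr (Z *m K)) HM.
rewrite !mulmxDl !mxtraceD -mulmxA JK mulmx1.
rewrite -!scalemxAl [\tr (d *: (J *m dY *m K))]mxtraceZ.
have -> : \tr (J *m dY *m K) = \tr dY by rewrite -mulmxA mxtrace_mulC -mulmxA KJ mulmx1.
rewrite -[t *m y *m K]mulmxA scalemxAr xE.
have -> : \tr (S *m K) = \tr (t *m x).
  rewrite /mxtrace.
  under eq_bigr do rewrite mxE.
  under [RHS]eq_bigr do rewrite mxE big_ord1 mxE mulrC /mxtrace mulr_sumr.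
  transitivity (\sum_l \sum_j \sum_k x 0 j * (dJ l j k * K k l)).
    apply: eq_bigr => l _; rewrite exchange_big; apply: eq_bigr => k _.
    by rewrite mxE mulr_suml; apply: eq_bigr => j _; rewrite mulrA.
  rewrite exchange_big; apply: eq_bigr => j _; apply: eq_bigr => l _.
  by rewrite mxE mulr_sumr; apply: eq_bigr => k _; rewrite sJ.
by rewrite addrC => /addIr.
Qed.

(** How the inverse of a Gram matrix transforms; stated with [J] on the right
so that no inverse of [J] occurs. *)
Lemma conj_invmx (F : fieldType) m (J G : 'M[F]_m) : J \in unitmx -> G \in unitmx ->
  J^T *m invmx (J *m G *m J^T) *m J = invmx G.
Proof.
move=> uJ uG; have uJT : J^T \in unitmx by rewrite unitmx_tr.
have uT : J *m G *m J^T \in unitmx by rewrite !unitmx_mul uJ uG.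
have H : J *m G *m (J^T *m invmx (J *m G *m J^T) *m J) = J *m G *m invmx G.
  by rewrite !mulmxA mulmxV // mul1mx mulmxK.
have uJG : J *m G \in unitmx by rewrite unitmx_mul uJ.
by rewrite -[LHS](mulKmx uJG) H mulKmx.
Qed.

End PiolaAlgebra.

Section Piola.
Context {R : realType} {n : nat}.
Implicit Types (A B : set 'rV[R]_n) (f g : R -> 'rV[R]_n -> R) (p v w : 'rV[R]_n) (t : R).

Definition jacobian_in A (psi : 'rV[R]_n -> 'rV[R]_n) t p : 'M[R]_n :=
  \matrix_(i, k) dv A 'e_i (fun _ p => psi p 0 k) t p.

(** A vector field times the density of the volume form is multiplied by the
Jacobian matrix and divided by its determinant when the chart changes; its
coordinate divergence is then only divided by the determinant. *)
Lemma piola A B (psi : 'rV[R]_n -> 'rV[R]_n) (X Y : R -> 'rV[R]_n -> 'rV[R]_n) t p :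
  relopen A -> relopen B -> (forall k, regular A (fun _ p => psi p 0 k)) ->
  (forall p, A p -> B (psi p)) ->
  (forall k, regular A (fun t p => X t p 0 k)) ->
  (forall k, regular B (fun t p => Y t p 0 k)) ->
  (forall t p, 0 <= t <= 1 -> A p -> jacobian_in A psi t p \in unitmx) ->
  (forall t p, 0 <= t <= 1 -> A p -> X t p *m jacobian_in A psi t p =
      \det (jacobian_in A psi t p) *: Y t (psi p)) ->
  0 <= t <= 1 -> A p ->
  \sum_j dv A 'e_j (fun t p => X t p 0 j) t p =
  \det (jacobian_in A psi t p) * \sum_j dv B 'e_j (fun t p => Y t p 0 j) t (psi p).
Proof.
move=> rA rB rpsi AB rX rY uJ XY t01 Ap.
set J := jacobian_in A psi.
have rJ i k : regular A (fun t p => J t p i k).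
  by apply: regular_eq (regular_dv 'e_i rA (rpsi k)) => s q _ _; rewrite mxE.
pose dX := \matrix_(l, j) dv A 'e_l (fun t p => X t p 0 j) t p.
pose dY := \matrix_(l, j) dv B 'e_l (fun t p => Y t p 0 j) t (psi p).
pose dJ l := dv_mx A J 'e_l t p.
have uJp := uJ t p t01 Ap.
have := @piola_algebra R n (X t p) (Y t (psi p)) (J t p) (invmx (J t p)) dX dY dJ (\det (J t p)).
have -> : \tr dX = \sum_j dv A 'e_j (fun t p => X t p 0 j) t p.
  by apply: eq_bigr => j _; rewrite mxE.
have -> : \tr dY = \sum_j dv B 'e_j (fun t p => Y t p 0 j) t (psi p).
  by apply: eq_bigr => j _; rewrite mxE.
apply; [exact: mulmxV|exact: mulVmx|exact: XY| |].
  have dJE l j k : dJ l j k = dv A 'e_l (dv A 'e_j (fun _ p => psi p 0 k)) t p.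
    apply: (etrans (dv_mxE _ _ _ _ _ _ _)).
    by apply: dv_eq => // q Aq; rewrite /J mxE.
  move=> l j k; apply: (etrans (dJE l j k)); apply: (etrans _ (esym (dJE j l k))).
  exact: dv_sym.
move=> l k.
have rYpsi : regular A (fun t p => Y t (psi p) 0 k).
  exact: (regular_comp (rY k) rpsi AB).
have E : dv A 'e_l (fun t p => \sum_j X t p 0 j * J t p j k) t p =
         dv A 'e_l (fun t p => \det (J t p) * Y t (psi p) 0 k) t p.
  apply: dv_eq => // q Aq.
  by have /(congr1 (fun Z : 'rV[R]_n => Z 0 k)) := XY t q t01 Aq; rewrite !mxE.
rewrite dv_sum // in E; last by move=> j _; exact: regularM.
rewrite (dvM rA (regular_det rJ) rYpsi) // in E.
rewrite (dv_comp rA rB (rY k) rpsi AB) // in E.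
rewrite (dv_det rA rJ) // in E.
transitivity (\sum_j dv A 'e_l (fun t p => X t p 0 j * J t p j k) t p).
  apply: eq_bigr => j _; rewrite (dvM rA (rX j) (rJ j k)) // !mxE.
  by [].
rewrite E; congr (_ * _ + _ * _).
  by apply: eq_bigr => m _; rewrite !mxE.
rewrite -mxtraceZ scalemxAr; congr (\tr (_ *m _)).
by rewrite /invmx uJp scalerA divff ?scale1r //; rewrite unitmxE unitfE in uJp.
Qed.

End Piola.

(** * Contraction of a volume form *)

Section DetForm.
Variable R : comNzRingType.

Definition rows n (vs : seq 'rV[R]_n) : 'M[R]_n :=
  \matrix_(k < n, l < n) (nth 0 vs k) 0 l.

(** Expansion along the first row, which holds the contracted vector field. *)
Lemma det_interior n (X : 'rV[R]_n) (vs : seq 'rV[R]_n) (i : 'I_n) : size vs = n ->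
  \det (rows (X :: (take i vs ++ drop i.+1 vs))) =
  (-1) ^+ i * \sum_l X 0 l * cofactor (rows vs) i l.
Proof.
case: n X vs i => [|m] X vs i; first by case: i.
move=> sz; rewrite (expand_det_row _ ord0) mulr_sumr; apply: eq_bigr => l _.
rewrite mxE /= [RHS]mulrCA; congr (_ * _); rewrite /cofactor [(ord0 + l)%N]add0n exprD !mulrA -exprD.
rewrite addnn -mul2n exprM sqrrN !expr1n mul1r; congr (_ * \det _).
apply/matrixP => a b; rewrite !mxE /= nth_cat size_takel; last first.
  by rewrite sz ltnW.
congr (fun_of_matrix _ _ _); rewrite /bump; have [ai|ia] := ltnP a i.
  by rewrite nth_take // add0n.
by rewrite nth_drop add1n addSn subnKC.
Qed.

(** Applied to [D] the matrix of derivatives of the field: only the diagonal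
survives because the adjugate times the matrix is scalar. This is why an
identity required for all lists of vectors reduces to one number. *)
Lemma sum_cofactor_diag n (V D : 'M[R]_n) :
  \sum_i \sum_l cofactor V i l * (\sum_j V i j * D j l) = \det V * \tr D.
Proof.
have -> : \det V * \tr D = \tr (\adj V *m V *m D) by rewrite mul_adj_mx mul_scalar_mx mxtraceZ.
rewrite -mulmxA /mxtrace exchange_big; apply: eq_bigr => l _.
by rewrite mxE; apply: eq_bigr => i _; rewrite !mxE.
Qed.

Lemma rows_basis n : rows [seq 'e_i | i <- enum 'I_n] = 1%:M :> 'M[R]_n.
Proof.
apply/matrixP => i j; rewrite !mxE (nth_map i) ?size_enum_ord // nth_ord_enum mxE eqxx.
by rewrite eq_sym.
Qed.

End DetForm.

Lemma iter_derive_coord (R : realType) n (V : normedModType R) (U : set V)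
    (F : V -> 'rV[R]_n) (k : 'I_n) vs : open U -> smooth_open U F ->
  forall x, U x -> iter_derive vs (fun x => F x 0 k : R^o) x = (iter_derive vs F x) 0 k.
Proof.
move=> oU sF; elim: vs => [|v vs IH] x Ux //=.
rewrite derive_mx ?mxE; last exact/diff_derivable/sF.
apply: near_eq_derive.
by move: (open_nbhs_nbhs (conj oU Ux)); apply: filterS => y /IH.
Qed.

Lemma smooth_open_coord (R : realType) n (V : normedModType R) (U : set V)
    (F : V -> 'rV[R]_n) (k : 'I_n) : open U -> smooth_open U F ->
  smooth_open U (fun x => F x 0 k : R^o).
Proof.
move=> oU sF vs x Ux.
apply: (@near_eq_differentiable _ _ _ (fun x => (iter_derive vs F x) 0 k : R^o)).
  move: (open_nbhs_nbhs (conj oU Ux)); apply: filterS => y Uy.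
  by rewrite -(iter_derive_coord k vs oU sF).
apply: (@differentiable_comp _ _ _ _ (iter_derive vs F) (fun N : 'rV[R]_n => N 0 k : R)).
  exact: sF.
exact: differentiable_coord.
Qed.

(** * Charts and transition maps *)

Section Charts.
Context {R : realType} {n : nat} {M : manifold R n}.
Implicit Types (a b : chart M) (x : M) (p : 'rV[R]_n) (t : R).

Lemma phiVK a x : dom a x -> phiV a (phi a x) = x.
Proof. by move=> ax; apply: phiK; rewrite inE. Qed.

Lemma img_phi a x : dom a x -> img a (phi a x).
Proof. by move=> ax; exists x. Qed.

Lemma img_dom a p : img a p -> dom a (phiV a p).
Proof. by move=> [x ax <-]; rewrite phiVK. Qed.

Lemma phiVV a p : img a p -> phi a (phiV a p) = p.
Proof. by move=> [x ax <-]; rewrite phiVK. Qed.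

Lemma relopen_img a : relopen (img a).
Proof. by have [U oU E] := img_open a; exists U. Qed.

Definition overlap a b : set 'rV[R]_n := phi a @` (dom a `&` dom b).

Definition transition_map a b : 'rV[R]_n -> 'rV[R]_n := phi b \o phiV a.

Lemma overlapP a b p : overlap a b p <-> img a p /\ dom b (phiV a p).
Proof.
split=> [[x [ax bx] <-]|[[x ax <-]]]; first by rewrite phiVK //; split=> //; exact: img_phi.
by rewrite phiVK // => bx; exists x.
Qed.

Lemma overlap_sub a b : overlap a b `<=` img a.
Proof. by move=> p /overlapP[]. Qed.

(** The domain of a chart is open and the inverse of a chart is continuous on
its image. *)
Lemma relopen_overlap a b : relopen (overlap a b).
Proof.
have [U oU E] := img_open a.
pose V : set 'rV[R]_n := [set q | img a q -> dom b (phiV a q)]°.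
exists (U `&` V); first by apply: openI => //; exact: open_interior.
have EE q : img a q <-> (U `&` halfspace) q by rewrite /img E.
apply/seteqP; split=> p.
  move=> /overlapP[Ap bp]; have [Up Hp] := (EE p).1 Ap.
  do 2 split=> //.
  have C := (subspace_continuousP _ _).1 (@phiV_continuous _ _ _ a) p Ap.
  by apply: C; apply: open_nbhs_nbhs; split=> //; exact: dom_open.
move=> [[Up Vp] Hp]; have Ap : img a p by apply/EE.
by apply/overlapP; split=> //; exact: (interior_subset Vp).
Qed.

Lemma transition_map_overlap a b p : overlap a b p -> overlap b a (transition_map a b p).
Proof.
by move=> [x [ax bx] <-]; exists x; [split|rewrite /transition_map /= phiVK].
Qed.

Lemma phiV_transition_map a b p : overlap a b p -> phiV b (transition_map a b p) = phiV a p.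
Proof. by move=> [x [ax bx] <-]; rewrite /transition_map /= phiVK // phiVK. Qed.

Lemma regular_transition_map a b k : regular (overlap a b) (fun _ p => transition_map a b p 0 k).
Proof.
apply: regular_smooth_on => p Bp.
have [U [F [oU Up sF FE]]] := transition_smooth (m := M) Bp.
exists U, (fun q => F q 0 k); split=> //; first exact: smooth_open_coord.
by move=> q Uq Bq; rewrite FE.
Qed.

(** The differential of a vector-valued map is taken componentwise. *)
Lemma jac_jacobian_in a b p t : overlap a b p -> 0 <= t <= 1 ->
  jac a b (phiV a p) = jacobian_in (overlap a b) (transition_map a b) t p.
Proof.
move=> Bp t01; apply/matrixP => i k; rewrite !mxE (phiVV (overlap_sub Bp)).
have [U [F [oU Up sF FE]]] := transition_smooth (m := M) Bp.
have rB := relopen_overlap a b.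
have N : \forall y \near p, U y by exact: open_nbhs_nbhs.
have dF : derivable F p 'e_i by apply: diff_derivable; exact: (sF [::]).
rewrite (@derive_in_ext _ _ _ (overlap a b) _ F) //; last 2 first.
- exact: relopen_ray.
- by apply: filterS N => y Uy By; rewrite FE.
rewrite derive_mx // mxE /dv.
rewrite (@derive_in_ext _ _ _ (overlap a b) _ (fun q => F q 0 k : R^o)) //.
- exact: relopen_ray.
- by apply: diff_derivable; exact: (smooth_open_coord k oU sF [::]).
- by apply: filterS N => y Uy By; rewrite FE.
Qed.

End Charts.

(** * The Laplacian in a chart *)

Section Laplacian.
Context {R : realType} {n : nat} {M : manifold R n} (omega : volume_form M)
  (g : metric_family M).
Implicit Types (a b : chart M) (x : M) (p : 'rV[R]_n) (t : R) (f : R -> M -> R).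

Definition in_chart a f : R -> 'rV[R]_n -> R := fun t p => f t (phiV a p).
(** Smoothness on [0,1] times [M], read in every chart; also used for functions
on [M], as constant families. *)
Definition regular_evolution f := forall a, regular (img a) (in_chart a f).

Definition chart_gram a t p : 'M[R]_n := g t a (phiV a p).
Definition chart_density a t p : R := density omega a (phiV a p).
Definition chart_differential a f t p : 'rV[R]_n := \row_i dv (img a) 'e_i (in_chart a f) t p.
(** The gradient times the density of the volume form: its coordinate
divergence is the density times the Laplacian. *)
Definition flux a f t p : 'rV[R]_n :=
  chart_density a t p *: (chart_differential a f t p *m invmx (chart_gram a t p)).
(** The classical coordinate formula for the Laplacian. *)
Definition chart_laplacian a f t p : R :=
  (chart_density a t p)^-1 * \sum_j dv (img a) 'e_j (fun t p => flux a f t p 0 j) t p.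

Lemma scale_rowE (c : R) (v : 'rV[R]_n) l : (c *: v) 0 l = c * v 0 l.
Proof. by rewrite mxE. Qed.

Lemma posdef_unit m (G : 'M[R]_m) :
  (forall v : 'rV[R]_m, v != 0 -> 0 < (v *m G *m v^T) 0 0) -> G \in unitmx.
Proof.
move=> H; rewrite -row_free_unit -kermx_eq0; apply/rowV0P => v /sub_kermxP vG.
by apply/eqP; apply: contraT => /H; rewrite vG mul0mx mxE ltxx.
Qed.

Lemma chart_gram_unit a t p : 0 <= t <= 1 -> img a p -> chart_gram a t p \in unitmx.
Proof.
move=> t01 Ap; apply: posdef_unit => v v0.
by apply: metric_pos => //; exact: img_dom.
Qed.

Lemma chart_density_neq0 a t p : img a p -> chart_density a t p != 0.
Proof. by move=> Ap; apply: density_neq0; exact: img_dom. Qed.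

Lemma regular_chart_density a : regular (img a) (chart_density a).
Proof.
have H := regular_smooth_on (@density_smooth _ _ _ omega a).
by apply: regular_eq H.
Qed.

Lemma regular_chart_gram a i j : regular (img a) (fun t p => chart_gram a t p i j).
Proof.
have H := regular_time (@metric_smooth _ _ _ g a i j).
by apply: regular_eq H.
Qed.

Lemma regular_chart_invgram a i j : regular (img a) (fun t p => invmx (chart_gram a t p) i j).
Proof. by apply: regular_invmx; [exact: regular_chart_gram|exact: chart_gram_unit]. Qed.

Lemma fluxE a f j : (fun t p => flux a f t p 0 j) = (fun t p => \sum_i
  dv (img a) 'e_i (in_chart a f) t p * (chart_density a t p * invmx (chart_gram a t p) i j)).
Proof.
apply/funext => t; apply/funext => p; rewrite !mxE mulr_sumr.
by apply: eq_bigr => i _; rewrite !mxE mulrCA.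
Qed.

Lemma regular_flux a f j : regular_evolution f -> regular (img a) (fun t p => flux a f t p 0 j).
Proof.
move=> sf; rewrite fluxE; apply: regular_sum => i _; apply: regularM.
  by apply: regular_dv; [exact: relopen_img|exact: sf].
by apply: regularM; [exact: regular_chart_density|exact: regular_chart_invgram].
Qed.

Lemma regular_chart_laplacian a f : regular_evolution f -> regular (img a) (chart_laplacian a f).
Proof.
move=> sf; apply: regularM.
  by apply: regularV; [move=> t p _; exact: chart_density_neq0|exact: regular_chart_density].
apply: regular_sum => j _; apply: regular_dv; first exact: relopen_img.
exact: regular_flux.
Qed.

(** The term with index [i] is the determinant of the vectors with the [i]-th
replaced by the derivative of the flux in its own direction; summing them
produces the trace. *)
Lemma exterior_derivative_flux a f t p vs : regular_evolution f -> 0 <= t <= 1 -> img a p ->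
  size vs = n ->
  exterior_derivative (img a)
     (fun q => interior_product (gradient (g t) (f t) a (phiV a q))
                 (eval_form omega a (phiV a q))) p vs =
  \det (rows vs) * \sum_j dv (img a) 'e_j (fun t p => flux a f t p 0 j) t p.
Proof.
move=> sf t01 Ap sz.
pose D : 'M[R]_n := \matrix_(j, l) dv (img a) 'e_j (fun t p => flux a f t p 0 l) t p.
have -> : \sum_j dv (img a) 'e_j (fun t p => flux a f t p 0 j) t p = \tr D.
  by apply: eq_bigr => j _; rewrite mxE.
rewrite -sum_cofactor_diag /exterior_derivative.
have rA := relopen_img a.
rewrite -(big_mkord xpredT (fun i => (-1) ^+ i * derive_in (img a)
  ((fun q => interior_product (gradient (g t) (f t) a (phiV a q))
                 (eval_form omega a (phiV a q)) (take i vs ++ drop i.+1 vs)) : 'rV[R]_n -> R^o)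
  (nth 0 vs i) p)) sz big_mkord.
apply: eq_bigr => i _.
set h := (X in derive_in _ X _ _).
have hE : forall q, img a q ->
    h q = \sum_l flux a f t q 0 l * ((-1) ^+ i * cofactor (rows vs) i l).
  move=> q Aq; rewrite /h /interior_product /eval_form.
  rewrite -/(rows (_ :: (take i vs ++ drop i.+1 vs))) det_interior //.
  rewrite !mulr_sumr; apply: eq_bigr => l _.
  have -> : flux a f t q 0 l =
      density omega a (phiV a q) * gradient (g t) (f t) a (phiV a q) 0 l.
    have -> : gradient (g t) (f t) a (phiV a q) = chart_differential a f t q *m invmx (chart_gram a t q).
      by congr (_ *m _); apply/rowP => j; rewrite !mxE phiVV.
    exact: scale_rowE.
  by ring.
have rF l : regular (img a) (fun t p => flux a f t p 0 l) by exact: regular_flux.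
have -> : derive_in (img a) h (nth 0 vs i) p =
   \sum_l dv (img a) (nth 0 vs i) (fun t p => flux a f t p 0 l) t p *
     ((-1) ^+ i * cofactor (rows vs) i l).
  transitivity (dv (img a) (nth 0 vs i)
      (fun t p => \sum_l flux a f t p 0 l * ((-1) ^+ i * cofactor (rows vs) i l)) t p).
    apply: (@dv_eq _ _ _ (fun _ => h)) => // q Aq; exact: hE.
  rewrite dv_sum //; last by move=> l _; apply: regularM => //; exact: regular_cst.
  apply: eq_bigr => l _; rewrite (dvM rA (rF l) (regular_cst _)) //.
  by rewrite (dv_cst (fun=> _)) // mulr0 add0r mulrC.
rewrite mulr_sumr; apply: eq_bigr => l _.
have s2 : (-1) ^+ i * (-1) ^+ i = 1 :> R by rewrite -exprD addnn -mul2n exprM sqrrN !expr1n.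
have cancel (s u c : R) : s * s = 1 -> s * (u * (s * c)) = c * u.
  by move=> ss; rewrite mulrCA [s * (s * c)]mulrA ss mul1r mulrC.
rewrite (cancel _ _ _ s2); congr (_ * _).
rewrite dv_coord //; apply: eq_bigr => j _; rewrite !mxE.
by [].
Qed.

(** The transformation rules of the differential, the Gram matrix and the
density combine into the one required by [piola]. *)
Lemma flux_transition a b f t p : regular_evolution f -> 0 <= t <= 1 -> overlap a b p ->
  flux a f t p *m jacobian_in (overlap a b) (transition_map a b) t p =
  \det (jacobian_in (overlap a b) (transition_map a b) t p) *: flux b f t (transition_map a b p).
Proof.
move=> sf t01 Bp; have Ap := overlap_sub Bp.
have rA := relopen_img a; have rO := relopen_overlap a b; have rO' := relopen_overlap b a.
have xa := img_dom Ap; have xb := ((overlapP a b p).1 Bp).2.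
rewrite -(jac_jacobian_in Bp t01); set J := jac a b (phiV a p).
have rhoE : chart_density a t p = \det J * chart_density b t (transition_map a b p).
  by rewrite /chart_density phiV_transition_map // (density_transition omega xa xb).
have uJ : J \in unitmx.
  rewrite unitmxE unitfE; apply: contraNneq (chart_density_neq0 t Ap) => J0.
  by rewrite rhoE J0 mul0r.
have Bq := transition_map_overlap Bp.
have Ap' := overlap_sub Bq.
have GE : chart_gram a t p = J *m chart_gram b t (transition_map a b p) *m J^T.
  by rewrite /chart_gram phiV_transition_map //; exact: metric_transition.
have JE i k : J i k = dv (overlap a b) 'e_i (fun _ p => transition_map a b p 0 k) t p.
  by rewrite /J (jac_jacobian_in Bp t01) mxE.
clearbody J.
have dE : chart_differential a f t p = chart_differential b f t (transition_map a b p) *m J^T.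
  apply/rowP => i; rewrite !mxE.
  rewrite (dv_subset 'e_i rA rO (@overlap_sub _ _ _ a b) (sf a) t01 Bp).
  transitivity (dv (overlap a b) 'e_i (fun t p => in_chart b f t (transition_map a b p)) t p).
    by apply: dv_eq => // q Bq'; rewrite /in_chart phiV_transition_map.
  have sfb : regular (overlap b a) (in_chart b f).
    by apply: regular_subset (sf b); exact: overlap_sub.
  rewrite (dv_comp rO rO' sfb (@regular_transition_map _ _ _ a b) (@transition_map_overlap _ _ _ a b)) //.
  apply: eq_bigr => k _; rewrite !mxE mulrC; congr (_ * _).
    by rewrite (dv_subset 'e_k (relopen_img b) rO' (@overlap_sub _ _ _ b a) (sf b)).
  by rewrite JE.
rewrite /flux rhoE GE dE -!scalemxAl scalerA; congr (_ *: _).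
rewrite -(@conj_invmx _ _ J (chart_gram b t (transition_map a b p))) //; last exact: chart_gram_unit.
by rewrite !mulmxA.
Qed.

Lemma chart_laplacian_transition a b f t p : regular_evolution f -> 0 <= t <= 1 -> overlap a b p ->
  chart_laplacian a f t p = chart_laplacian b f t (transition_map a b p).
Proof.
move=> sf t01 Bp; have Ap := overlap_sub Bp.
have rA := relopen_img a; have rO := relopen_overlap a b; have rO' := relopen_overlap b a.
have Bq := transition_map_overlap Bp; have Aq := overlap_sub Bq.
have uJ : forall t p, 0 <= t <= 1 -> overlap a b p ->
    jacobian_in (overlap a b) (transition_map a b) t p \in unitmx.
  move=> s q s01 Bq'; rewrite -jac_jacobian_in // unitmxE unitfE.
  have qa := img_dom (overlap_sub Bq'); have qb := ((overlapP a b q).1 Bq').2.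
  apply: contraNneq (density_neq0 omega qa) => J0.
  by rewrite (density_transition omega qa qb) J0 mul0r.
have rF c j : regular (img c) (fun t p => flux c f t p 0 j) by exact: regular_flux.
have P := @piola R n (overlap a b) (overlap b a) (transition_map a b) (flux a f) (flux b f) t p
  rO rO' (@regular_transition_map _ _ _ a b) (@transition_map_overlap _ _ _ a b)
  (fun j => regular_subset (@overlap_sub _ _ _ a b) (rF a j))
  (fun j => regular_subset (@overlap_sub _ _ _ b a) (rF b j)) uJ
  (fun t p t01 Bp => flux_transition sf t01 Bp) t01 Bp.
rewrite /chart_laplacian.
under eq_bigr do rewrite (dv_subset _ rA rO (@overlap_sub _ _ _ a b) (rF a _) t01 Bp).
rewrite P.
under [in RHS]eq_bigr do
  rewrite (dv_subset _ (relopen_img b) rO' (@overlap_sub _ _ _ b a) (rF b _) t01 Bq).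
rewrite mulrA; congr (_ * _).
have -> : chart_density a t p =
    \det (jacobian_in (overlap a b) (transition_map a b) t p) *
    chart_density b t (transition_map a b p).
  rewrite /chart_density phiV_transition_map // -jac_jacobian_in //.
  by rewrite (density_transition omega (img_dom Ap) ((overlapP a b p).1 Bp).2).
have dJ : \det (jacobian_in (overlap a b) (transition_map a b) t p) != 0.
  by have := uJ t p t01 Bp; rewrite unitmxE unitfE.
by rewrite invfM -mulrA mulrCA mulVf // mulr1.
Qed.

(** The coordinate expression satisfies the defining identity in every chart by
[chart_laplacian_transition], and is the only number that does because the
density does not vanish. *)
Lemma laplacianE a f t x : regular_evolution f -> 0 <= t <= 1 -> dom a x ->
  laplacian omega (g t) (f t) x = chart_laplacian a f t (phi a x).
Proof.
move=> sf t01 xa; rewrite /laplacian /divergence.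
set P := [set c | _].
have key b : dom b x -> chart_laplacian b f t (phi b x) * density omega b x =
    \sum_j dv (img b) 'e_j (fun t p => flux b f t p 0 j) t (phi b x).
  move=> xb; rewrite /chart_laplacian mulrC mulrA /chart_density phiVK // mulfV ?mul1r //.
  exact: density_neq0.
have Pl : P (chart_laplacian a f t (phi a x)).
  move=> b xb vs sz; rewrite exterior_derivative_flux //; last exact: img_phi.
  rewrite /eval_form -/(rows vs).
  have Ba : overlap a b (phi a x) by exists x.
  rewrite (chart_laplacian_transition sf t01 Ba) /transition_map /= phiVK //.
  by rewrite mulrA key // mulrC.
have uP c : P c -> c = chart_laplacian a f t (phi a x).
  move=> Pc; have sz : size [seq ('e_i : 'rV[R]_n) | i <- enum 'I_n] = n.
    by rewrite size_map size_enum_ord.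
  have := Pc a xa _ sz.
  have := Pl a xa _ sz; rewrite /eval_form -/(rows _) rows_basis det1 mulr1 => <-.
  by apply: mulIf; exact: density_neq0.
by apply: uP; apply: (xgetPex 0); exists (chart_laplacian a f t (phi a x)).
Qed.

Lemma regular_evolution_laplacian f : regular_evolution f ->
  regular_evolution (fun t x => laplacian omega (g t) (f t) x).
Proof.
move=> sf a; have H : regular (img a) (chart_laplacian a f) by exact: regular_chart_laplacian.
apply: regular_eq H => t p t01 Ap.
by rewrite /in_chart (@laplacianE a) ?phiVV //; exact: img_dom.
Qed.

Lemma regular_evolution_comb f h (c : R) : regular_evolution f -> regular_evolution h ->
  regular_evolution (fun t x => f t x + c * h t x).
Proof.
move=> sf sh a; apply: (regularD (sf a)).
by apply: regularM; [exact: regular_cst|exact: sh].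
Qed.

Lemma dv_in_chart_comb a f h (c : R) v t p : regular_evolution f -> regular_evolution h ->
  0 <= t <= 1 -> img a p ->
  dv (img a) v (in_chart a (fun t x => f t x + c * h t x)) t p =
  dv (img a) v (in_chart a f) t p + c * dv (img a) v (in_chart a h) t p.
Proof.
move=> sf sh t01 Ap; have rA := relopen_img a.
have rch : regular (img a) (fun t p => c * in_chart a h t p).
  by apply: regularM; [exact: regular_cst|exact: sh].
rewrite (dvD rA (sf a) rch) // (dvM rA (regular_cst _) (sh a)) //.
by rewrite (dv_cst (fun=> c)) // mulr0 addr0.
Qed.

Lemma chart_laplacian_comb a f h (c : R) t p : regular_evolution f -> regular_evolution h ->
  0 <= t <= 1 -> img a p ->
  chart_laplacian a (fun t x => f t x + c * h t x) t p =
  chart_laplacian a f t p + c * chart_laplacian a h t p.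
Proof.
move=> sf sh t01 Ap; have rA := relopen_img a.
rewrite /chart_laplacian mulrCA -mulrDr; congr (_ * _).
rewrite mulr_sumr -big_split /=; apply: eq_bigr => j _.
have rF k : regular_evolution k -> regular (img a) (fun t p => flux a k t p 0 j).
  by move=> sk; exact: regular_flux.
have rcF : regular (img a) (fun t p => c * flux a h t p 0 j).
  by apply: regularM; [exact: regular_cst|exact: rF].
transitivity (dv (img a) 'e_j (fun t p => flux a f t p 0 j + c * flux a h t p 0 j) t p).
  apply: dv_eq => // q Aq.
  have E k : flux a k t q 0 j = \sum_i dv (img a) 'e_i (in_chart a k) t q *
      (chart_density a t q * invmx (chart_gram a t q) i j).
    by have /(congr1 (fun F => F t q)) := fluxE a k j.
  rewrite !E mulr_sumr -big_split /=; apply: eq_bigr => i _.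
  by rewrite dv_in_chart_comb // mulrDl -[c * _ * _]mulrA.
rewrite (dvD rA (rF _ sf) rcF) // (dvM rA (regular_cst _) (rF _ sh)) //.
by rewrite (dv_cst (fun=> c)) // mulr0 addr0.
Qed.

Lemma laplacian_comb f h (c : R) t x : regular_evolution f -> regular_evolution h -> 0 <= t <= 1 ->
  laplacian omega (g t) (fun x => f t x + c * h t x) x =
  laplacian omega (g t) (f t) x + c * laplacian omega (g t) (h t) x.
Proof.
move=> sf sh t01; have [a xa] := dom_cover x.
rewrite (laplacianE (regular_evolution_comb c sf sh) t01 xa) (laplacianE sf t01 xa) (laplacianE sh t01 xa).
by rewrite chart_laplacian_comb //; exact: img_phi.
Qed.

(** The divergence form expanded by the product rule. Coefficients and
derivatives of [f] are separated, which allows them to be taken at different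
times in [laplacian_bounded]. *)
Lemma chart_laplacian_expand a f t p : regular_evolution f -> 0 <= t <= 1 -> img a p ->
  chart_laplacian a f t p = (chart_density a t p)^-1 * \sum_j \sum_i
    (dv (img a) 'e_i (in_chart a f) t p *
       dv (img a) 'e_j (fun t p => chart_density a t p * invmx (chart_gram a t p) i j) t p +
     chart_density a t p * invmx (chart_gram a t p) i j *
       dv (img a) 'e_j (dv (img a) 'e_i (in_chart a f)) t p).
Proof.
move=> sf t01 Ap; have rA := relopen_img a.
have rP i : regular (img a) (dv (img a) 'e_i (in_chart a f)) by apply: regular_dv => //; exact: sf.
have rH i j : regular (img a) (fun t p => chart_density a t p * invmx (chart_gram a t p) i j).
  by apply: regularM; [exact: regular_chart_density|exact: regular_chart_invgram].
rewrite /chart_laplacian; congr (_ * _); apply: eq_bigr => j _.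
rewrite fluxE dv_sum //; last by move=> i _; exact: regularM.
by apply: eq_bigr => i _; rewrite (dvM rA (rP i) (rH i j)).
Qed.

Lemma chart_laplacian_critical a f t p : regular_evolution f -> 0 <= t <= 1 -> img a p ->
  (forall v, dv (img a) v (in_chart a f) t p = 0) ->
  chart_laplacian a f t p = \sum_i \sum_j invmx (chart_gram a t p) i j *
     dv (img a) 'e_j (dv (img a) 'e_i (in_chart a f)) t p.
Proof.
move=> sf t01 Ap crit; rewrite chart_laplacian_expand // [RHS]exchange_big mulr_sumr.
apply: eq_bigr => j _; rewrite mulr_sumr; apply: eq_bigr => i _.
by rewrite crit mul0r add0r -mulrA mulKf //; exact: chart_density_neq0.
Qed.

End Laplacian.

(** * Sign of the Laplacian at a maximum *)

Section TraceInequality.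
Variable R : realFieldType.

Definition posdef m (P : 'M[R]_m) := forall v : 'rV[R]_m, v != 0 -> 0 < (v *m P *m v^T) 0 0.
Definition negsemidef m (Q : 'M[R]_m) := forall v : 'rV[R]_m, (v *m Q *m v^T) 0 0 <= 0.

(** One step of a Cholesky decomposition: completing the square in the first
variable leaves a rank one matrix and the Schur complement, which is again
positive definite. *)
Lemma posdef_peel m (P : 'M[R]_(1 + m)) : P^T = P -> posdef P ->
  exists (c : 'rV[R]_(1 + m)) (a : R) (S : 'M[R]_m), [/\ 0 < a, S^T = S, posdef S &
    P = a *: (c^T *m c) + block_mx 0 0 0 S].
Proof.
move=> sP pP.
pose a := P 0 0; pose b : 'rV[R]_m := ursubmx P; pose D : 'M[R]_m := drsubmx P.
have PE : P = block_mx (a%:M) b b^T D.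
  rewrite -[LHS]submxK; congr block_mx.
    by apply/matrixP => i j; rewrite !ord1 !mxE eqxx mulr1n /a; congr (P _ _); apply/val_inj.
  by rewrite /b trmx_ursub sP.
have sD : D^T = D by rewrite /D trmx_drsub sP.
have a0 : 0 < a.
  have := pP (row_mx 1%:M 0); rewrite PE mul_row_block tr_row_mx mul_row_col.
  rewrite !mul1mx !mul0mx trmx1 trmx0 mulmx0 !addr0 mulmx1 mxE eqxx mulr1n; apply.
  apply/eqP => /(congr1 (fun Z : 'rV[R]_(1 + m) => lsubmx Z 0 0)).
  by rewrite row_mxKl !mxE eqxx => /eqP; rewrite oner_eq0.
pose S := D - a^-1 *: (b^T *m b).
exists (row_mx a%:M b), a^-1, S; split; first by rewrite invr_gt0.
- by rewrite /S linearB linearZ /= trmx_mul trmxK sD.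
- move=> w w0.
  (* This first coordinate minimizes the quadratic form of P over the vectors
     that extend w. *)
  pose s := - (a^-1 * (b *m w^T) 0 0).
  have := pP (row_mx s%:M w); rewrite PE mul_row_block tr_row_mx mul_row_col.
  have -> : (s%:M *m a%:M + w *m b^T) *m (s%:M)^T + (s%:M *m b + w *m D) *m w^T =
      w *m S *m w^T.
    apply/matrixP => i j; rewrite !ord1 /S.
    rewrite mulmxBr mulmxBl -scalemxAr -scalemxAl.
    rewrite tr_scalar_mx mul_mx_scalar -scalar_mxM mul_scalar_mx !mulmxDl -scalemxAl.
    rewrite [w *m (b^T *m b)]mulmxA -[w *m b^T *m b *m w^T]mulmxA.
    have wb : w *m b^T = ((b *m w^T) 0 0)%:M.
      by rewrite [LHS]mx11_scalar; congr (_%:M); rewrite -[w]trmxK -trmx_mul mxE trmxK.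
    rewrite wb [b *m w^T]mx11_scalar.
    set z := (b *m w^T) 0 0.
    rewrite !mxE eqxx !mulr1n big_ord1 !mxE eqxx !mulr1n /s -/z.
    by field; rewrite gt_eqF.
  apply; apply/eqP => /(congr1 (fun Z : 'rV[R]_(1 + m) => rsubmx Z)).
  by rewrite row_mxKr linear0; exact/eqP.
- rewrite PE tr_row_mx mul_col_row scale_block_mx add_block_mx !addr0.
  rewrite tr_scalar_mx mul_mx_scalar !mul_scalar_mx !scalerA /S.
  rewrite mulVf ?gt_eqF // !scale1r addrC subrK; congr block_mx.
  by rewrite mul_mx_scalar scalerA mulVf ?gt_eqF // scale1r.
Qed.

(** By induction through [posdef_peel], the trace is a sum of nonpositive
values of the quadratic form of [Q]. *)
Lemma trace_posdef_negsemidef m (P Q : 'M[R]_m) : P^T = P -> posdef P -> negsemidef Q ->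
  \tr (P *m Q) <= 0.
Proof.
elim: m P Q => [|m IH] P Q sP pP nQ; first by rewrite /mxtrace big_ord0.
rewrite -[m.+1]/(1 + m)%N in P Q sP pP nQ *.
have [c [a [S [a0 sS pS ->]]]] := @posdef_peel m P sP pP.
rewrite mulmxDl mxtraceD -scalemxAl mxtraceZ -mulmxA mxtrace_mulC.
have -> : \tr (c *m Q *m c^T) = (c *m Q *m c^T) 0 0 by rewrite /mxtrace big_ord1.
have H1 : a * (c *m Q *m c^T) 0 0 <= 0 by rewrite pmulr_rle0.
have H2 : \tr (block_mx 0 0 0 S *m Q) <= 0.
  rewrite -[Q]submxK mulmx_block !mul0mx !add0r mxtrace_block mxtrace0 add0r.
  apply: IH => // v; have := nQ (row_mx 0 v).
  rewrite -{1}[Q]submxK mul_row_block tr_row_mx mul_row_col !mul0mx !add0r trmx0.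
  by rewrite mulmx0 add0r.
by rewrite -[leRHS]addr0 lerD.
Qed.

End TraceInequality.

Section MaxRegular.
Context {R : realType} {n : nat}.
Implicit Types (A : set 'rV[R]_n) (f : R -> 'rV[R]_n -> R) (p v w : 'rV[R]_n) (t : R).

Lemma dv_lin A f t p v w (c : R) : relopen A -> regular A f -> 0 <= t <= 1 -> A p ->
  dv A (v + c *: w) f t p = dv A v f t p + c * dv A w f t p.
Proof.
move=> rA rf t01 Ap; rewrite !(dv_coord _ rA rf t01 Ap) mulr_sumr -big_split /=.
by apply: eq_bigr => j _; rewrite !mxE mulrDl mulrA.
Qed.

Lemma dvN A f t p v : relopen A -> regular A f -> 0 <= t <= 1 -> A p ->
  dv A (- v) f t p = - dv A v f t p.
Proof.
move=> rA rf t01 Ap; rewrite !(dv_coord _ rA rf t01 Ap) -sumrN.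
by apply: eq_bigr => j _; rewrite mxE mulNr.
Qed.

Lemma pair_line t p v (h : R) :
  ((t, p) : R^o * 'rV[R]_n) + h *: ((0, v) : R^o * 'rV[R]_n) = (t, p + h *: v).
Proof. by rewrite pairZE pairDE mulr0 addr0. Qed.

Lemma ray_below A f U F t p v : extends A f U F -> 0 <= t <= 1 -> A p -> U (t, p) ->
  (forall q, A q -> f t q <= f t p) -> ray A p v ->
  \forall h \near 0^'+, F ((t, p) + h *: (0, v)) <= F (t, p).
Proof.
move=> [oU sF FE] t01 Ap Utp fm rv.
have NU : \forall h \near (0:R)^'+, U ((t, p) + h *: (0, v)).
  by apply: cvg_within; apply: near_ray; exact: open_nbhs_nbhs.
apply: filterS2 NU rv => h; rewrite pair_line => Uh Ah.
by rewrite !FE //; exact: fm.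
Qed.

Lemma dv_max_le0 A f t p v : relopen A -> regular A f -> 0 <= t <= 1 -> A p ->
  (forall q, A q -> f t q <= f t p) -> ray A p v -> dv A v f t p <= 0.
Proof.
move=> rA rf t01 Ap fm rv; have [U [F [Utp H]]] := rf t p t01 Ap.
rewrite (dv_ext v rA H) //; have [_ sF _] := H.
apply: derive_le0_right (ray_below H t01 Ap Utp fm rv).
exact: smooth_derivable sF Utp.
Qed.

(** Second derivatives in [v] and [- v] agree, and one of the two directions
points into [A]. *)
Lemma dv2_max_le0 A f t p v : relopen A -> regular A f -> 0 <= t <= 1 -> A p ->
  (forall q, A q -> f t q <= f t p) -> (forall v, dv A v f t p = 0) ->
  dv A v (dv A v f) t p <= 0.
Proof.
move=> rA rf t01 Ap fm crit.
have key w : ray A p w -> dv A w (dv A w f) t p <= 0.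
  move=> rw; have [U [F [Utp H]]] := rf t p t01 Ap.
  rewrite (dv_ext w rA (extends_dv w rA H) t01 Ap Utp); have [oU sF _] := H.
  apply: (derive2_le0_right oU sF Utp (ray_below H t01 Ap Utp fm rw)).
  by rewrite -(dv_ext w rA H t01 Ap Utp).
have [/key //|/key] := relopen_ray v rA Ap.
rewrite dvN //; last exact: regular_dv.
have -> : dv A v (dv A (- v) f) t p = dv A v (fun t p => - 1 * dv A v f t p) t p.
  by apply: dv_eq => // q Aq; rewrite dvN // mulN1r.
rewrite (dvM rA (regular_cst _) (regular_dv v rA rf)) // (dv_cst (fun=> _)) //.
by rewrite mulr0 addr0 mulN1r opprK.
Qed.

Definition hessian A f t p : 'M[R]_n := \matrix_(j, i) dv A 'e_j (dv A 'e_i f) t p.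

Lemma hessian_quad A f t p v : relopen A -> regular A f -> 0 <= t <= 1 -> A p ->
  (v *m hessian A f t p *m v^T) 0 0 = dv A v (dv A v f) t p.
Proof.
move=> rA rf t01 Ap.
have rd w : regular A (dv A w f) by exact: regular_dv.
rewrite dv_coord // mxE.
have E j : dv A 'e_j (dv A v f) t p = \sum_i v 0 i * dv A 'e_j (dv A 'e_i f) t p.
  transitivity (dv A 'e_j (fun t p => \sum_i v 0 i * dv A 'e_i f t p) t p).
    by apply: dv_eq => // q Aq; rewrite dv_coord.
  rewrite dv_sum //; last by move=> i _; apply: regularM => //; exact: regular_cst.
  apply: eq_bigr => i _; rewrite (dvM rA (regular_cst _) (rd _)) //.
  by rewrite (dv_cst (fun=> _)) // mulr0 addr0.
under [RHS]eq_bigr do rewrite E mulr_sumr.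
rewrite exchange_big; apply: eq_bigr => i _.
rewrite !mxE mulr_suml; apply: eq_bigr => j _; rewrite mxE; ring.
Qed.

(** In the interior the derivative is nonpositive in both [v] and [- v]. On the
boundary this holds for tangential directions, and together with the transverse
direction [nu] these span the whole space. *)
Lemma max_critical A f t p : relopen A -> regular A f -> 0 <= t <= 1 -> A p ->
  (forall q, A q -> f t q <= f t p) ->
  (halfspace_bd p -> exists (i : 'I_n) (nu : 'rV[R]_n),
     [/\ i = 0%N :> nat, nu 0 i != 0 & dv A nu f t p = 0]) ->
  forall v, dv A v f t p = 0.
Proof.
move=> rA rf t01 Ap fm bd.
have two v : ray A p v -> ray A p (- v) -> dv A v f t p = 0.
  move=> rv rNv; apply/eqP; rewrite eq_le dv_max_le0 //=.
  by rewrite -oppr_le0 -dvN // dv_max_le0.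
have [pbd|nbd] := pselect (halfspace_bd p); last first.
  by move=> v; apply: two; exact: interior_ray.
have [i [nu [i0 nui dnu]]] := bd pbd.
move=> v; pose w := v - (v 0 i / nu 0 i) *: nu.
(* w is the projection of v along nu onto the directions tangent to the boundary. *)
have tw : forall j : 'I_n, j = 0%N :> nat -> w 0 j = 0.
  move=> j j0; have -> : j = i by apply: val_inj; rewrite /= j0 i0.
  by rewrite !mxE divfK // subrr.
have <- : w + (v 0 i / nu 0 i) *: nu = v by rewrite subrK.
rewrite dv_lin // dnu mulr0 addr0.
by apply: two; apply: relopen_ray_in => // j j0; [rewrite tw|rewrite mxE tw // oppr0].
Qed.

End MaxRegular.

Section MaxManifold.
Context {R : realType} {n : nat} {M : manifold R n} (omega : volume_form M)
  (g : metric_family M).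
Implicit Types (a b : chart M) (x : M) (p : 'rV[R]_n) (t : R).

(** The part of a Neumann condition that the maximum principle uses: a
vanishing derivative in a direction transverse to the boundary. The family is
constant in time and 0 is just a time to read it at. *)
Definition stationary_bd (f : M -> R) x := boundary M x ->
  exists (a : chart M) (i : 'I_n) (nu : 'rV[R]_n),
    [/\ dom a x, i = 0%N :> nat, phi a x 0 i = 0, nu 0 i != 0 &
        dv (img a) nu (in_chart a (fun=> f)) 0 (phi a x) = 0].

Lemma posdef_invmx m (G : 'M[R]_m) : G^T = G -> posdef G -> posdef (invmx G).
Proof.
move=> sG pG v v0; have uG := posdef_unit pG.
have w0 : v *m invmx G != 0.
  by apply: contra_neq v0 => w0; rewrite -[v](mulmxKV uG) w0 mul0mx.
have := pG _ w0; rewrite mulmxKV // trmx_mul trmx_inv sG.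
by rewrite mulmxA.
Qed.

Lemma laplacian_max_le0 (f : M -> R) t x : regular_evolution (fun=> f) -> 0 <= t <= 1 ->
  (forall y, f y <= f x) -> stationary_bd f x -> laplacian omega (g t) f x <= 0.
Proof.
move=> sf t01 fm sbd.
have [a [xa crit]] : exists a, dom a x /\
    forall v, dv (img a) v (in_chart a (fun=> f)) t (phi a x) = 0.
  have h a : dom a x -> (halfspace_bd (phi a x) -> exists (i : 'I_n) (nu : 'rV[R]_n),
     [/\ i = 0%N :> nat, nu 0 i != 0 & dv (img a) nu (in_chart a (fun=> f)) t (phi a x) = 0]) ->
     forall v, dv (img a) v (in_chart a (fun=> f)) t (phi a x) = 0.
    move=> xa; apply: max_critical => //; first exact: relopen_img.
      exact: img_phi.
    by move=> q Aq; rewrite /in_chart phiVK.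
  have [/sbd [a [i [nu [xa i0 _ nui dnu]]]]|nbd] := pselect (boundary M x).
    by exists a; split=> //; apply: h => // _; exists i, nu.
  have [a xa] := dom_cover x; exists a; split=> //; apply: h => // bd.
  by exfalso; apply: nbd; exists a.
have Ap := img_phi xa.
rewrite (@laplacianE _ _ _ omega g a (fun=> f) t x) // chart_laplacian_critical //.
have -> : \sum_i \sum_j invmx (chart_gram g a t (phi a x)) i j *
     dv (img a) 'e_j (dv (img a) 'e_i (in_chart a (fun=> f))) t (phi a x) =
   \tr (invmx (chart_gram g a t (phi a x)) *m hessian (img a) (in_chart a (fun=> f)) t (phi a x)).
  by apply: eq_bigr => i _; rewrite mxE; apply: eq_bigr => j _; rewrite mxE.
have sG : (chart_gram g a t (phi a x))^T = chart_gram g a t (phi a x).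
  by rewrite /chart_gram phiVK //; exact: Defs.metric_sym.
have pG : posdef (chart_gram g a t (phi a x)).
  by move=> v v0; rewrite /chart_gram phiVK //; exact: metric_pos.
apply: trace_posdef_negsemidef.
- by rewrite trmx_inv sG.
- exact: posdef_invmx.
- move=> v; rewrite hessian_quad //; last exact: relopen_img.
  apply: dv2_max_le0 => //; first exact: relopen_img.
  by move=> q Aq; rewrite /in_chart phiVK.
Qed.

(** The normal is the row of the inverse metric dual to the coordinate of index
0, rescaled. It is transverse because a diagonal entry of a positive definite
matrix is positive. *)
Lemma unit_normal_exists m (P : 'M[R]_m) (i : 'I_m) : i = 0%N :> nat ->
  P \in unitmx -> 0 < P i i ->
  exists2 nu : 'rV[R]_m, unit_normal (invmx P) nu & nu 0 i != 0.
Proof.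
move=> i0 uP Pii.
pose k := (Num.sqrt (P i i))^-1.
have sP : Num.sqrt (P i i) ^+ 2 = P i i by rewrite sqr_sqrtr // ltW.
have s0 : Num.sqrt (P i i) != 0 by rewrite gt_eqF // sqrtr_gt0.
exists (k *: row i P); last by rewrite !mxE mulf_neq0 ?invr_eq0 // gt_eqF.
have E : (k *: row i P) *m invmx P = k *: 'e_i.
  by rewrite -scalemxAl rowE mulmxK.
split=> [v tv|]; rewrite E -scalemxAl !mxE.
  rewrite (bigD1 i) //= big1 => [|j ji]; last by rewrite !mxE (negbTE ji) andbF mul0r.
  by rewrite !mxE tv // mulr0 addr0 mulr0.
rewrite (bigD1 i) //= big1 => [|j ji]; last by rewrite !mxE (negbTE ji) andbF mul0r.
by rewrite !mxE !eqxx addr0 mul1r /k -{3}sP; field.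
Qed.

End MaxManifold.

(** * Uniform bounds from compactness *)

Section Compactness.
Context {R : realType} {n : nat} {M : manifold R n}.
Implicit Types (a b : chart M) (x : M) (p : 'rV[R]_n) (s t : R) (f : R -> M -> R).

(** Domains of charts are open, so continuity within them is continuity. *)
Lemma near_phi a x (P : set 'rV[R]_n) : dom a x -> nbhs (phi a x) P ->
  \forall y \near x, dom a y /\ P (phi a y).
Proof.
move=> xa NP.
have C := (subspace_continuousP _ _).1 (@phi_continuous _ _ _ a) x xa.
have N1 : nbhs x (dom a) by apply: open_nbhs_nbhs; split=> //; exact: dom_open.
have N2 : nbhs x (fun y => dom a y -> P (phi a y)) by exact: C.
by apply: filterS2 N1 N2 => y ya /(_ ya).
Qed.

Lemma near_time_chart a (t : R) x (P : set (R * 'rV[R]_n)) : dom a x ->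
  nbhs (t, phi a x) P -> exists (B1 : set R) (B2 : set M), [/\ nbhs t B1, nbhs x B2 &
    forall s y, B1 s -> B2 y -> dom a y /\ P (s, phi a y)].
Proof.
move=> xa [[B1 B2] [/= N1 N2] H].
exists B1, [set y | dom a y /\ B2 (phi a y)]; split=> //; first exact: near_phi.
by move=> s y Bs [ya By]; split=> //; apply: H.
Qed.

Lemma regular_evolution_near f t x (e : R) : regular_evolution f -> 0 <= t <= 1 -> 0 < e ->
  exists (B1 : set R) (B2 : set M), [/\ nbhs t B1, nbhs x B2 &
    forall s y, B1 s -> B2 y -> 0 <= s <= 1 -> `|f s y - f t x| < e].
Proof.
move=> sf t01 e0; have [a xa] := dom_cover x.
have N := regular_near (sf a) t01 (img_phi xa) e0.
have [B1 [B2 [N1 N2 H]]] := near_time_chart xa N.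
exists B1, B2; split=> // s y Bs By s01; have [ya] := H s y Bs By.
by rewrite /= /in_chart !phiVK //; apply => //; exact: img_phi.
Qed.

Section Bounds.
Hypothesis cM : compact [set: M].

Lemma compact01 : compact (`[0, 1]%classic : set R).
Proof. exact: segment_compact. Qed.

(** Near each point of [0,1] times [M], two values at nearby times both differ
little from the value at the point; compactness makes the time step uniform. *)
Lemma regular_evolution_unif f (e : R) : regular_evolution f -> 0 < e ->
  exists2 d : R, 0 < d & forall s t x, 0 <= s <= 1 -> 0 <= t <= 1 -> `|s - t| < d ->
    `|f s x - f t x| <= e.
Proof.
move=> sf e0.
have K : compact (`[0, 1]%classic `*` [set: M] : set (R * M)%type).
  by apply: compact_setX => //; exact: compact01.
have e2 : 0 < e / 2 by rewrite divr_gt0.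
have [|d0 /= d00 Hd] := (compact_near_coveringP _).1 K R (0:R)^'+
  (fun d z => forall s, 0 <= s <= 1 -> 0 <= z.1 <= 1 -> `|s - z.1| < d -> `|f s z.2 - f z.1 z.2| <= e) _.
  move=> [t x] [/= t01 _]; rewrite in_itv /= in t01.
  have [B1 [B2 [N1 N2 H]]] := regular_evolution_near x sf t01 e2.
  have [r /= r0 Br] := (nbhs_ballP _ _).1 N1.
  have r2 : 0 < r / 2 by rewrite divr_gt0.
  exists ([set z | ball t (r / 2) z.1 /\ B2 z.2], [set d | d < r / 2]) => /=.
    split; last exact: nbhs_right_lt.
    by exists (ball t (r / 2), B2) => //=; split=> //; exact: nbhsx_ballx.
  move=> [[t' x'] d] [/= [tt' Bx'] dr] s s01 t'01 sd.
  have Bs : B1 s.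
    apply: Br; rewrite (splitr r); apply: ball_triangle tt' _.
    by rewrite /ball /= distrC; apply: lt_trans sd dr.
  have Bt' : B1 t'.
    by apply: Br; rewrite (splitr r); apply: ball_triangle tt' _; exact: ballxx.
  rewrite (splitr e) -(subrKA (f t x)); apply: le_trans (ler_normD _ _) _.
  apply: lerD; apply: ltW; first exact: H.
  by rewrite distrC; exact: H.
exists (d0 / 2); first by rewrite divr_gt0.
move=> s t x s01 t01 st.
have d20 : 0 < d0 / 2 by rewrite divr_gt0.
have dd : d0 / 2 < d0 by rewrite ltr_pdivrMr // ltr_pMr // ltr1n.
apply: (Hd (d0 / 2) _ d20 (t, x)) => //.
  by rewrite /ball_ /= sub0r normrN gtr0_norm.
Qed.

(** A function of two times and a point, because the Laplacian at time [t] acts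
on a function taken at another time [s]. *)
Definition locally_bounded (s0 t0 : R) (x0 : M) (h : R -> R -> M -> R) := exists B : R,
  exists (B1 B2 : set R) (B3 : set M), [/\ nbhs s0 B1, nbhs t0 B2, nbhs x0 B3 &
  forall s t x, B1 s -> B2 t -> B3 x -> 0 <= s <= 1 -> 0 <= t <= 1 -> `|h s t x| <= B].

Section LocallyBounded.
Variables (s0 t0 : R) (x0 : M).

Lemma locally_bounded_cst c : locally_bounded s0 t0 x0 (fun _ _ _ => c).
Proof. by exists `|c|, setT, setT, setT; split=> //; exact: filterT. Qed.

Lemma locally_boundedD h k : locally_bounded s0 t0 x0 h -> locally_bounded s0 t0 x0 k ->
  locally_bounded s0 t0 x0 (fun s t x => h s t x + k s t x).
Proof.
move=> [B [B1 [B2 [B3 [N1 N2 N3 H]]]]] [C [C1 [C2 [C3 [N1' N2' N3' K]]]]].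
exists (B + C), (B1 `&` C1), (B2 `&` C2), (B3 `&` C3); split; try exact: filterI.
move=> s t x [b1 c1] [b2 c2] [b3 c3] s01 t01; apply: le_trans (ler_normD _ _) _.
by apply: lerD; [exact: H|exact: K].
Qed.

Lemma locally_boundedM h k : locally_bounded s0 t0 x0 h -> locally_bounded s0 t0 x0 k ->
  locally_bounded s0 t0 x0 (fun s t x => h s t x * k s t x).
Proof.
move=> [B [B1 [B2 [B3 [N1 N2 N3 H]]]]] [C [C1 [C2 [C3 [N1' N2' N3' K]]]]].
exists (B * C), (B1 `&` C1), (B2 `&` C2), (B3 `&` C3); split; try exact: filterI.
move=> s t x [b1 c1] [b2 c2] [b3 c3] s01 t01; rewrite normrM.
by apply: ler_pM => //; [exact: H|exact: K].
Qed.

Lemma locally_bounded_sum (I : Type) (r : seq I) (h : I -> R -> R -> M -> R) :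
  (forall i, locally_bounded s0 t0 x0 (h i)) ->
  locally_bounded s0 t0 x0 (fun s t x => \sum_(i <- r) h i s t x).
Proof.
move=> H; elim: r => [|i r IH].
  have -> : (fun s t x => \sum_(i <- [::]) h i s t x) = (fun _ _ _ => 0).
    by apply/funext => s; apply/funext => t; apply/funext => x; rewrite big_nil.
  exact: locally_bounded_cst.
have -> : (fun s t x => \sum_(j <- i :: r) h j s t x) =
    (fun s t x => h i s t x + \sum_(j <- r) h j s t x).
  by apply/funext => s; apply/funext => t; apply/funext => x; rewrite big_cons.
exact: locally_boundedD.
Qed.

Lemma regular_bound_near a : dom a x0 -> 0 <= s0 <= 1 ->
  forall h : R -> 'rV[R]_n -> R, regular (img a) h ->
  exists (B : R) (B1 : set R) (B3 : set M), [/\ nbhs s0 B1, nbhs x0 B3 &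
   forall s x, B1 s -> B3 x -> 0 <= s <= 1 -> dom a x /\ `|h s (phi a x)| <= B].
Proof.
move=> xa s01 h rh.
have N := regular_near rh s01 (img_phi xa) ltr01.
have [B1 [B2 [N1 N2 H]]] := near_time_chart xa N.
exists (1 + `|h s0 (phi a x0)|), B1, B2; split=> // s y Bs By s01'.
have [ya /= Hs] := H s y Bs By; split=> //.
rewrite -[h s _](subrK (h s0 (phi a x0))); apply: le_trans (ler_normD _ _) _.
by apply: lerD => //; apply: ltW; apply: Hs => //; exact: img_phi.
Qed.
End LocallyBounded.

Lemma regular_locally_bounded1 s0 t0 x0 a h : dom a x0 -> 0 <= s0 <= 1 -> regular (img a) h ->
  locally_bounded s0 t0 x0 (fun s t x => h s (phi a x)).
Proof.
move=> xa s01 rh; have [B [B1 [B3 [N1 N3 H]]]] := regular_bound_near xa s01 rh.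
exists B, B1, setT, B3; split=> //; first exact: filterT.
by move=> s t x Bs _ Bx s01' _; have [] := H s x Bs Bx s01'.
Qed.

Lemma regular_locally_bounded2 s0 t0 x0 a h : dom a x0 -> 0 <= t0 <= 1 -> regular (img a) h ->
  locally_bounded s0 t0 x0 (fun s t x => h t (phi a x)).
Proof.
move=> xa s01 rh; have [B [B1 [B3 [N1 N3 H]]]] := regular_bound_near xa s01 rh.
exists B, setT, B1, B3; split=> //; first exact: filterT.
by move=> s t x _ Bs Bx _ s01'; have [] := H t x Bs Bx s01'.
Qed.

Lemma locally_bounded_compact (h : R -> R -> M -> R) :
  (forall s t x, 0 <= s <= 1 -> 0 <= t <= 1 -> locally_bounded s t x h) ->
  exists C : R, forall s t x, 0 <= s <= 1 -> 0 <= t <= 1 -> `|h s t x| <= C.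
Proof.
move=> lh.
have K : compact ((`[0, 1]%classic `*` `[0, 1]%classic) `*` [set: M] : set ((R * R) * M)%type).
  by apply: compact_setX => //; apply: compact_setX; exact: compact01.
have [|d0 /= [_ Hd]] := (compact_near_coveringP _).1 K R +oo%R
  (fun C z => 0 <= z.1.1 <= 1 -> 0 <= z.1.2 <= 1 -> `|h z.1.1 z.1.2 z.2| <= C) _.
  move=> [[s t] x] [/= [s01 t01] _]; rewrite !in_itv /= in s01 t01.
  have [B [B1 [B2 [B3 [N1 N2 N3 H]]]]] := lh s t x s01 t01.
  exists ([set z | (B1 z.1.1 /\ B2 z.1.2) /\ B3 z.2], [set C | B <= C]) => /=.
    split; last by apply: nbhs_pinfty_ge; exact: num_real.
    exists ([set z | B1 z.1 /\ B2 z.2], B3) => //=; split=> //.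
    by exists (B1, B2) => //=.
  move=> [[[s' t'] x'] C] [/= [[Bs Bt] Bx] BC] s'01 t'01.
  exact: le_trans (H _ _ _ Bs Bt Bx s'01 t'01) BC.
exists (d0 + 1) => s t x s01 t01.
have d1 : d0 < d0 + 1 by rewrite ltrDl.
by apply: (Hd (d0 + 1) d1 ((s, t), x)) => //; do 2 split=> //=; rewrite in_itv.
Qed.

End Bounds.
End Compactness.

(** * Time derivatives and the maximum principle *)

Section Bounded.
Context {R : realType} {n : nat} {M : manifold R n} (omega : volume_form M)
  (g : metric_family M).
Implicit Types (a b : chart M) (x : M) (p : 'rV[R]_n) (s t : R) (f : R -> M -> R).

Lemma locally_bounded_eq s0 t0 x0 (D : set M) (h k : R -> R -> M -> R) : nbhs x0 D ->
  (forall s t x, D x -> 0 <= s <= 1 -> 0 <= t <= 1 -> h s t x = k s t x) ->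
  locally_bounded s0 t0 x0 h -> locally_bounded s0 t0 x0 k.
Proof.
move=> ND E [B [B1 [B2 [B3 [N1 N2 N3 H]]]]].
exists B, B1, B2, (B3 `&` D); split=> //; first exact: filterI.
by move=> s t x Bs Bt [Bx Dx] s01 t01; rewrite -E //; exact: H.
Qed.

Lemma regular_evolution_fix f s : regular_evolution f -> 0 <= s <= 1 -> regular_evolution (fun=> f s).
Proof. by move=> sf s01 a; exact: (regular_fix (sf a) s01). Qed.

(** In a chart, the Laplacian at time [t] of [Q s] is a sum of products of
coefficients at time [t] with derivatives of [Q] at time [s]. All are
continuous, hence locally bounded. *)
Lemma laplacian_bounded (Q : R -> M -> R) : compact [set: M] -> regular_evolution Q ->
  exists C : R, forall s t x, 0 <= s <= 1 -> 0 <= t <= 1 ->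
    `|laplacian omega (g t) (Q s) x| <= C.
Proof.
move=> cM sQ; apply: (locally_bounded_compact cM) => s0 t0 x0 s01 t01.
have [a xa] := dom_cover x0.
have rA := relopen_img a.
have ND : nbhs x0 (dom a) by apply: open_nbhs_nbhs; split=> //; exact: dom_open.
pose Fn := fun s t x => (chart_density omega a t (phi a x))^-1 * \sum_j \sum_i
    (dv (img a) 'e_i (in_chart a Q) s (phi a x) *
       dv (img a) 'e_j (fun t p => chart_density omega a t p * invmx (chart_gram g a t p) i j) t (phi a x) +
     chart_density omega a t (phi a x) * invmx (chart_gram g a t (phi a x)) i j *
       dv (img a) 'e_j (dv (img a) 'e_i (in_chart a Q)) s (phi a x)).
apply: (@locally_bounded_eq _ _ _ _ Fn _ ND).
  move=> s t x ya s01' t01'.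
  have sQs := regular_evolution_fix sQ s01'.
  by rewrite (laplacianE _ _ sQs t01' ya) chart_laplacian_expand //; exact: img_phi.
have rP i : regular (img a) (dv (img a) 'e_i (in_chart a Q)) by apply: regular_dv => //; exact: sQ.
have rI i j : regular (img a) (fun t p => invmx (chart_gram g a t p) i j) by exact: regular_chart_invgram.
have rR : regular (img a) (chart_density omega a) by exact: regular_chart_density.
have rH i j : regular (img a) (fun t p => chart_density omega a t p * invmx (chart_gram g a t p) i j).
  exact: regularM.
apply: locally_boundedM.
  apply: (@regular_locally_bounded2 _ _ _ s0 t0 x0 a (fun t p => (chart_density omega a t p)^-1)) => //.
  by apply: regularV => // t p _; exact: chart_density_neq0.
apply: locally_bounded_sum => j; apply: locally_bounded_sum => i.
apply: locally_boundedD; apply: locally_boundedM.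
- exact: (@regular_locally_bounded1 _ _ _ s0 t0 x0 a _ xa s01 (rP i)).
- exact: (@regular_locally_bounded2 _ _ _ s0 t0 x0 a _ xa t01 (regular_dv 'e_j rA (rH i j))).
- exact: (@regular_locally_bounded2 _ _ _ s0 t0 x0 a _ xa t01 (rH i j)).
- exact: (@regular_locally_bounded1 _ _ _ s0 t0 x0 a _ xa s01 (regular_dv 'e_j rA (rP i))).
Qed.

Definition time_derive f t x := derive_in (`[0, 1]%classic : set R^o)
  ((fun s => f s x) : R^o -> R^o) 1 t.

(** The extension in time and space restricts to an ordinary derivable function
of time. *)
Lemma time_ext f t x : regular_evolution f -> 0 <= t <= 1 -> exists F : R -> R,
  derivable F t 1 /\ (\forall s \near t, 0 <= s <= 1 -> F s = f s x).
Proof.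
move=> sf t01; have [a xa] := dom_cover x.
have [U [F [Utp [oU sF FE]]]] := sf a t (phi a x) t01 (img_phi xa).
exists (fun s => F (s, phi a x)); split.
  pose z0 : R^o * 'rV[R]_n := (0, phi a x).
  pose v0 : R^o * 'rV[R]_n := (1, 0).
  have zE (s : R) : z0 + s *: v0 = (s, phi a x).
    by rewrite /z0 /v0 pairZE pairDE scaler0 addr0 add0r mulr1.
  have -> : (fun s => F (s, phi a x)) = (fun s : R => F (z0 + s *: v0)).
    by apply/funext => s; rewrite zE.
  have df : differentiable F (z0 + t *: v0) by rewrite zE; exact: smooth_diff sF Utp.
  by have [] := is_derive_line df.
have [[B1 B2] [/= N1 N2] H] := open_nbhs_nbhs (conj oU Utp).
apply: filterS N1 => s Bs s01.
rewrite FE //; first by rewrite /in_chart phiVK.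
  exact: img_phi.
by apply: (H (s, phi a x)); split=> //=; exact: nbhs_singleton.
Qed.

Lemma ray01 t : 0 <= t <= 1 ->
  ray (`[0, 1]%classic : set R^o) t 1 \/ ray (`[0, 1]%classic : set R^o) t (- 1).
Proof.
move=> /andP[t0 t1]; have [tl|tg] := ltP t 1.
  left; have N : \forall h \near (0:R)^'+, h < 1 - t by apply: nbhs_right_lt; rewrite subr_gt0.
  have N0 : \forall h \near (0:R)^'+, 0 <= h by exact: nbhs_right_ge.
  apply: filterS2 N N0 => h ht h0; rewrite /= in_itv /= [h *: _]mulr1.
  by rewrite addr_ge0 //= addrC -lerBrDr ltW.
right; have N : \forall h \near (0:R)^'+, h < 1 by exact: nbhs_right_lt.
have N0 : \forall h \near (0:R)^'+, 0 <= h by exact: nbhs_right_ge.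
apply: filterS2 N N0 => h h1 h0; rewrite /= in_itv /= [h *: _]mulrN1.
by rewrite subr_ge0 (le_trans (ltW h1) tg) /= lerBlDr (le_trans t1) // lerDl.
Qed.

Lemma time_deriveE (F : R -> R) f t x : 0 <= t <= 1 -> derivable F t 1 ->
  (\forall s \near t, 0 <= s <= 1 -> F s = f s x) -> time_derive f t x = 'D_1 F t.
Proof.
move=> t01 dF N; rewrite /time_derive.
rewrite (@derive_in_ext R R^o R _ (fun s => f s x) F 1 t) //; exact: ray01.
Qed.

Lemma derive_affine (c0 c1 t1 t : R) (A := fun s : R => c0 + c1 * (s - t1)) :
  derivable A t 1 /\ 'D_1 A t = c1.
Proof.
have C : (fun h : R => h^-1 *: ((A \o shift t) (h *: 1) - A t)) @ (0:R)^' --> c1.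
  have H : (cst c1 : R -> R) @ (0:R)^' --> c1 by exact: cvg_cst.
  apply: cvg_trans H; apply: near_eq_cvg.
  have N : \forall h \near (0:R)^', h != 0 by exact: nbhs_dnbhs_neq.
  apply: filterS N => h h0.
  have -> : (A \o shift t) (h *: 1) - A t = c1 * h.
    by rewrite /A /= [h *: 1]mulr1; ring.
  by rewrite [_ *: _]mulrC mulfK.
split; first by apply/cvg_ex; exists c1.
by apply: cvg_lim C; exact: norm_hausdorff.
Qed.

Lemma time_derive_affine f t x (k c0 c1 t1 : R) : regular_evolution f -> 0 <= t <= 1 ->
  time_derive (fun s y => k * f s y + (c0 + c1 * (s - t1))) t x = k * time_derive f t x + c1.
Proof.
move=> sf t01; have [F [dF N]] := time_ext x sf t01.
have [dA DA] := derive_affine c0 c1 t1 t.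
set A := fun s : R => _ in dA DA.
pose kF : R -> R := cst k * F.
have dk : derivable (cst k : R -> R) t 1 by exact: derivable_cst.
have dkF : derivable kF t 1 by apply: derivableM.
have DkF : 'D_1 kF t = k * 'D_1 F t.
  by apply: (etrans (deriveM dk dF)); rewrite derive_cst scaler0 addr0.
have dS : derivable (kF + A) t 1 by exact: derivableD.
have -> : k * time_derive f t x + c1 = 'D_1 (kF + A) t.
  by rewrite deriveD // DkF DA (time_deriveE t01 dF N).
apply: time_deriveE => //; apply: filterS N => s Hs s01.
by rewrite -(Hs s01).
Qed.

(** Only the past is compared with, so that the final time is allowed. *)
Lemma time_derive_max f t x (K : R) : regular_evolution f -> 0 < t <= 1 ->
  (\forall h \near 0^'+, f (t - h) x + K * h <= f t x) -> K <= time_derive f t x.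
Proof.
move=> sf /andP[t0 t1] H; have t01 : 0 <= t <= 1 by rewrite ltW.
have [F [dF N]] := time_ext x sf t01; rewrite (time_deriveE t01 dF N).
have Ft : F t = f t x by move/nbhs_singleton: N; apply.
have diffF : differentiable F t by exact/derivable1_diffP.
have dF1 : derivable F t (- 1) by exact: diff_derivable.
(* f(t - h) + K h <= f(t) says that s |-> f(s) - K s does not increase
   towards the past. *)
pose Kid : R -> R := cst K * id.
have dK : derivable Kid t (- 1) by apply: derivableM; [exact: derivable_cst|exact: derivable_id].
have DK : 'D_(- 1) Kid t = - K.
  rewrite /Kid deriveM ?derive_cst ?derive_id ?scaler0 ?addr0; last exact: derivable_id.
    by rewrite /GRing.scale /= mulrN1.
  exact: derivable_cst.
pose G : R -> R := F - Kid.
have dG : derivable G t (- 1) by exact: derivableB.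
have DF : 'D_(- 1) F t = - 'D_1 F t by rewrite !deriveE // linearN.
have DG : 'D_(- 1) G t = - ('D_1 F t - K).
  by rewrite /G deriveB // DF DK opprK opprB addrC.
have : 'D_(- 1) G t <= 0.
  apply: (derive_le0_right dG).
  have N1 : \forall h \near (0:R)^'+, 0 <= t + h *: -1 <= 1 -> F (t + h *: -1) = f (t + h *: -1) x.
    by apply: cvg_within; exact: (@near_ray _ R^o _ _ _ N).
  have N2 : \forall h \near (0:R)^'+, h <= t by exact: nbhs_right_le.
  have N3 : \forall h \near (0:R)^'+, 0 <= h by exact: nbhs_right_ge.
  near=> h.
  have hE : t + h *: -1 = t - h by rewrite [h *: _]mulrN1.
  have E1 : F (t - h) = f (t - h) x.
    rewrite -hE; near: h; apply: filterS3 N1 N2 N3 => h + ht h0; apply.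
    by rewrite [h *: _]mulrN1 subr_ge0 ht /= lerBlDr (le_trans t1) // lerDl.
  have fh : f (t - h) x + K * h <= f t x by near: h.
  rewrite hE.
  have GE s : G s = F s - K * s by [].
  by rewrite !GE E1 Ft; lra.
by rewrite DG oppr_le0 subr_ge0.
Unshelve. all: by end_near. Qed.

(** The weak maximum principle. Subtracting [(K + d) * (t - t1)] makes the
differential inequality strict, which excludes a positive maximum after time
[t1]: there the time derivative would be at least [K + d], while the equation
bounds it by [K]. The slack [d] is then sent to 0. *)
Lemma comparison (L : R -> (M -> R) -> M -> R) (r : R -> M -> R) (eps K m t1 t2 : R) :
  compact [set: M] -> regular_evolution r -> 0 <= eps -> 0 <= K -> 0 <= m ->
  0 <= t1 -> t1 < t2 -> t2 <= 1 ->
  (forall t x, t1 < t <= t2 -> time_derive r t x <= eps * L t (r t) x + K) ->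
  (forall t x, t1 < t <= t2 -> (forall y, r t y <= r t x) -> 0 < r t x ->
     L t (r t) x <= 0) ->
  (forall x, r t1 x <= m) -> forall x, r t2 x <= m + K * (t2 - t1).
Proof.
move=> cM sr eps0 K0 m0 t10 t12 t21 Hdt Hmax Hm x.
have t12' : 0 < t2 - t1 by rewrite subr_gt0.
apply/ler_addgt0Pr => e e0.
(* The slack d accumulates to e over the whole slab. *)
pose d := e / (t2 - t1).
have d0 : 0 < d by rewrite divr_gt0.
suff H : r t2 x - (K + d) * (t2 - t1) <= m.
  have ed : d * (t2 - t1) = e by rewrite divfK // gt_eqF.
  by rewrite mulrDl ed in H; lra.
pose v := fun z : R * M => r z.1 z.2 - (K + d) * (z.1 - t1).
pose A : set (R * M) := `[t1, t2]%classic `*` [set: M].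
have cA : compact A by apply: compact_setX => //; exact: segment_compact.
have A01 t y : A (t, y) -> 0 <= t <= 1.
  move=> [/= + _]; rewrite in_itv /= => /andP[h1 h2].
  by rewrite (le_trans t10 h1) (le_trans h2 t21).
have cv : {within A, continuous v}.
  apply/subspace_continuousP => -[t y] Aty.
  apply: cvgB.
    apply/cvgrPdist_lt => e' e'0.
    have [B1 [B2 [N1 N2 H]]] := regular_evolution_near y sr (A01 _ _ Aty) e'0.
    have N : nbhs (t, y) (B1 `*` B2) by exists (B1, B2).
    rewrite near_withinE; apply: filterS N => -[t' y'] [/= Bt By] Aty'.
    by rewrite distrC; apply: H => //; exact: A01 Aty'.
  apply: cvgM; first exact: cvg_cst.
  apply: cvgB; last exact: cvg_cst.
  by apply: cvg_within_filter; exact: cvg_fst.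
have A0 : A !=set0 by exists (t2, x); split=> //=; rewrite in_itv /= lexx ltW.
have [[t y] /set_mem Aty vmax] := compact_EVT_max A0 cA cv.
have vm t' y' : t1 <= t' <= t2 -> v (t', y') <= v (t, y).
  by move=> h; apply: vmax; rewrite inE; split=> //=; rewrite in_itv.
apply: le_trans (vm t2 x _) _; first by rewrite lexx ltW.
have /andP[t1t tt2] : t1 <= t <= t2 by have [/= + _] := Aty; rewrite in_itv.
have Kd : 0 < K + d by rewrite ltr_wpDl.
(* Where r <= 0, in particular on a Dirichlet boundary, the bound is trivial
   as 0 <= m. *)
have [rpos|rneg] := ltP 0 (r t y); last first.
  rewrite /v /= (le_trans _ m0) // subr_le0 (le_trans rneg) // mulr_ge0 ?subr_ge0 //.
  exact: ltW.
move: t1t; rewrite le_eqVlt => /orP[/eqP <-|t1t]; first by rewrite /v /= subrr mulr0 subr0.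
exfalso.
have ymax z : r t z <= r t y.
  have := vm t z; rewrite (ltW t1t) tt2 => /(_ isT).
  by rewrite /v /= lerD2r.
have Lneg : L t (r t) y <= 0 by apply: Hmax => //; rewrite t1t tt2.
have : K + d <= time_derive r t y.
  apply: time_derive_max => //; first by rewrite (le_lt_trans t10 t1t) (le_trans tt2 t21).
  have N : \forall h \near (0:R)^'+, h < t - t1 by apply: nbhs_right_lt; rewrite subr_gt0.
  have N0 : \forall h \near (0:R)^'+, 0 <= h by exact: nbhs_right_ge.
  apply: filterS2 N N0 => h ht h0.
  have := vm (t - h) y; rewrite lerBrDr addrC -lerBrDr (ltW ht).
  have -> : t - h <= t2 by rewrite lerBlDr (le_trans tt2) // lerDl.
  move=> /(_ isT); rewrite /v /=; nra.
have tt : t1 < t <= t2 by rewrite t1t.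
have Hd := Hdt t y tt.
have Le : eps * L t (r t) y <= 0 by rewrite mulr_ge0_le0.
by move=> Kdt; lra.
Qed.

End Bounded.

(** * Integrals over the unit interval *)

Section Integral01.
Context {R : realType}.
Local Notation mu := (@lebesgue_measure R).

Definition continuous01 (phi : R -> R) := forall t e : R, 0 <= t <= 1 -> 0 < e ->
  \forall s \near t, 0 <= s <= 1 -> `|phi s - phi t| < e.

Lemma continuous01_integrable phi : continuous01 phi ->
  mu.-integrable `[0, 1] (EFin \o phi).
Proof.
move=> cphi; apply: continuous_compact_integrable; first exact: segment_compact.
apply/subspace_continuousP => t; rewrite /= in_itv /= => t01.
apply/cvgrPdist_lt => e e0; rewrite near_withinE.
have N := cphi t e t01 e0.
by apply: filterS N => s + s01; rewrite distrC; apply; move: s01; rewrite /= in_itv.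
Qed.

Lemma integral01_cst (c : R) : \int[mu]_(t in `[0, 1]) c = c.
Proof.
have m1 : mu (`[0, 1]%classic : set R) = 1%:E.
  by rewrite lebesgue_measure_itv /= lte_fin ltr01 oppr0 adde0.
rewrite Rintegral_cst; last exact: measurable_itv.
by rewrite [X in _ * fine X]m1 mulr1.
Qed.

Lemma continuous01_cst (c : R) : continuous01 (fun=> c).
Proof. by move=> t e t01 e0; near=> s; rewrite subrr normr0. Unshelve. all: by end_near. Qed.

Lemma integral01_le phi psi : continuous01 phi -> continuous01 psi ->
  (forall t, 0 <= t <= 1 -> phi t <= psi t) ->
  \int[mu]_(t in `[0, 1]) phi t <= \int[mu]_(t in `[0, 1]) psi t.
Proof.
move=> cphi cpsi H; apply: le_Rintegral => //; exact: continuous01_integrable.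
Qed.

Lemma integral01_comb phi psi (c : R) : continuous01 phi -> continuous01 psi ->
  \int[mu]_(t in `[0, 1]) (phi t + c * psi t) =
  \int[mu]_(t in `[0, 1]) phi t + c * \int[mu]_(t in `[0, 1]) psi t.
Proof.
move=> cphi cpsi.
have i1 := continuous01_integrable cphi; have i2 := continuous01_integrable cpsi.
rewrite RintegralD //; last exact: (integrableZl _ c i2).
by rewrite RintegralZl.
Qed.

Lemma continuous01_comb phi psi (c : R) : continuous01 phi -> continuous01 psi ->
  continuous01 (fun t => phi t + c * psi t).
Proof.
move=> cphi cpsi t e t01 e0.
have c0 : 0 < `|c| + 1 by rewrite ltr_wpDl.
have e2 : 0 < e / 2 by rewrite divr_gt0.
have e3 : 0 < e / 2 / (`|c| + 1) by rewrite divr_gt0.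
apply: filterS2 (cphi t _ t01 e2) (cpsi t _ t01 e3) => s H1 H2 s01.
have -> : phi s + c * psi s - (phi t + c * psi t) = (phi s - phi t) + c * (psi s - psi t) by ring.
rewrite (splitr e); apply: le_lt_trans (ler_normD _ _) _; apply: ltrD; first exact: H1.
rewrite normrM; apply: (@le_lt_trans _ _ ((`|c| + 1) * `|psi s - psi t|)).
  by rewrite ler_wpM2r // lerDl.
by rewrite mulrC -ltr_pdivlMr //; exact: H2.
Qed.

Lemma integral01_gt0 phi : continuous01 phi -> (forall t, 0 <= t <= 1 -> 0 < phi t) ->
  0 < \int[mu]_(t in `[0, 1]) phi t.
Proof.
move=> cphi pphi.
have cw : {within (`[0, 1]%classic : set R), continuous phi}.
  apply/subspace_continuousP => t; rewrite /= in_itv /= => t01.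
  apply/cvgrPdist_lt => e e0; rewrite near_withinE.
  have N := cphi t e t01 e0.
  by apply: filterS N => s + s01; rewrite distrC; apply; move: s01; rewrite /= in_itv.
have [c] := @EVT_min R phi 0 1 ler01 cw; rewrite in_itv /= => c01 cmin.
apply: lt_le_trans (pphi c c01) _.
rewrite -[leLHS]integral01_cst; apply: integral01_le => //; first exact: continuous01_cst.
Qed.

(** On each step the integrand stays within [eta] of its value at the left
node. *)
Lemma integral01_riemann phi (N : nat) (eta : R) : continuous01 phi -> (0 < N)%N ->
  (forall s t, 0 <= s <= 1 -> 0 <= t <= 1 -> `|s - t| <= N%:R^-1 -> `|phi s - phi t| <= eta) ->
  `|\int[mu]_(t in `[0, 1]) phi t - N%:R^-1 * \sum_(j < N) phi (j%:R / N%:R)| <= eta.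
Proof.
move=> cphi N0 H.
have Nr : 0 < N%:R :> R by rewrite ltr0n.
have i01 := continuous01_integrable cphi.
have key k : (k <= N)%N -> `|\int[mu]_(t in `[0, k%:R / N%:R]) phi t -
    N%:R^-1 * \sum_(j < k) phi (j%:R / N%:R)| <= eta * (k%:R / N%:R).
  elim: k => [_|k IH kN].
    by rewrite mul0r set_itv1 Rintegral_set1 big_ord0 mulr0 subrr normr0 mulr0.
  have kk : k%:R / N%:R <= k.+1%:R / N%:R :> R by rewrite ler_pM2r ?invr_gt0 // ler_nat.
  have k1 : k.+1%:R / N%:R <= 1 :> R by rewrite ler_pdivrMr // mul1r ler_nat.
  have k0 : 0 <= k%:R / N%:R :> R by rewrite divr_ge0.
  have isub (i : interval R) : ([set` i] `<=` `[0, 1]%classic) -> mu.-integrable [set` i] (EFin \o phi).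
    by move=> si; apply: integrableS i01 => //; exact: measurable_itv.
  have ikk : mu.-integrable `]k%:R / N%:R, k.+1%:R / N%:R] (EFin \o phi).
    apply: isub => t; rewrite /= !in_itv /= => /andP[h1 h2].
    by rewrite (le_trans k0 (ltW h1)) (le_trans h2 k1).
  have E : \int[mu]_(t in `[0, k.+1%:R / N%:R]) phi t - \int[mu]_(t in `[0, k%:R / N%:R]) phi t
     = \int[mu]_(t in `]k%:R / N%:R, k.+1%:R / N%:R]) phi t.
    apply: Rintegral_itvB.
    - apply: isub => t; rewrite /= !in_itv /= => /andP[-> h2].
      by rewrite (le_trans h2 k1).
    - by rewrite bnd_simp.
    - by rewrite bnd_simp.
  have kN01 : 0 <= (k%:R / N%:R : R) <= 1 by rewrite k0 (le_trans kk k1).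
  have mukk : fine (mu `]k%:R / N%:R, k.+1%:R / N%:R]) = N%:R^-1.
    have m1 := @lebesgue_measure_itv R `]k%:R / N%:R, k.+1%:R / N%:R].
    rewrite [X in fine X]m1 /= lte_fin ltr_pM2r ?invr_gt0 // ltr_nat ltnSn /=.
    by rewrite -mulrBl -natrB // subSnn mul1r.
  have bnd t : (`]k%:R / N%:R, k.+1%:R / N%:R]%classic : set R) t ->
      `|phi t - phi (k%:R / N%:R)| <= eta.
    rewrite /= in_itv /= => /andP[h1 h2]; apply: H => //.
      by rewrite (le_trans k0 (ltW h1)) (le_trans h2 k1).
    rewrite ger0_norm; last by rewrite subr_ge0 ltW.
    by rewrite lerBlDr (le_trans h2) // -natr1 mulrDl mul1r addrC.
  have icst (c : R) : mu.-integrable `]k%:R / N%:R, k.+1%:R / N%:R] (EFin \o cst c).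
    have := continuous01_integrable (continuous01_cst c).
    apply: integrableS => // t; rewrite /= !in_itv /= => /andP[h1 h2].
    by rewrite (le_trans k0 (ltW h1)) (le_trans h2 k1).
  have cstE (c : R) : \int[mu]_(t in `]k%:R / N%:R, k.+1%:R / N%:R]) c = c / N%:R.
    rewrite Rintegral_cst; last exact: measurable_itv.
    by congr (_ * _); exact: mukk.
  have up : \int[mu]_(t in `]k%:R / N%:R, k.+1%:R / N%:R]) phi t <= (phi (k%:R / N%:R) + eta) / N%:R.
    rewrite -cstE.
    apply: le_Rintegral => //; first exact: icst.
    by move=> t /bnd; rewrite ler_norml => /andP[_]; rewrite lerBlDl.
  have lo : (phi (k%:R / N%:R) - eta) / N%:R <= \int[mu]_(t in `]k%:R / N%:R, k.+1%:R / N%:R]) phi t.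
    rewrite -cstE.
    apply: le_Rintegral => //; first exact: icst.
    by move=> t /bnd; rewrite ler_norml => /andP[+ _]; rewrite lerBrDr addrC.
  have IHk := IH (ltnW kN).
  have e1 : eta * (k.+1%:R / N%:R) = eta * (k%:R / N%:R) + eta / N%:R.
    by rewrite -[k.+1%:R]natr1 mulrDl mul1r mulrDr.
  rewrite big_ord_recr /= mulrDr e1.
  rewrite -E mulrDl in up; rewrite -E mulrBl in lo.
  rewrite [N%:R^-1 * phi _]mulrC.
  move: IHk; rewrite !ler_norml => /andP[h1 h2].
  by apply/andP; split; lra.
have := key N (leqnn N); rewrite divff ?gt_eqF // mulr1.
by [].
Qed.

End Integral01.

(** * Functions constant near a point *)

Section Flat.
Context {R : realType} {n : nat} {M : manifold R n} (omega : volume_form M)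
  (g : metric_family M).
Implicit Types (a b : chart M) (x : M) (p : 'rV[R]_n) (s t : R) (f : M -> R).

Lemma derive_in_near_cst (A : set 'rV[R]_n) (h : 'rV[R]_n -> R) (c : R) v p :
  relopen A -> A p -> (\forall q \near p, A q -> h q = c) ->
  derive_in A (h : 'rV[R]_n -> R^o) v p = 0.
Proof.
move=> rA Ap N.
have dc : derivable (cst c : 'rV[R]_n -> R) p v by exact: derivable_cst.
have Nc : \forall q \near p, A q -> (cst c : 'rV[R]_n -> R) q = h q.
  by apply: filterS N => q Nq Aq; rewrite Nq.
have := @derive_in_ext R _ R A h (cst c) v p (relopen_ray v rA Ap) Ap dc Nc.
by rewrite derive_cst.
Qed.

Lemma near_phiV a x (D : set M) : dom a x -> nbhs x D ->
  \forall q \near phi a x, img a q -> D (phiV a q).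
Proof.
move=> xa ND.
have C := (subspace_continuousP _ _).1 (@phiV_continuous _ _ _ a) (phi a x) (img_phi xa).
have ND' : nbhs (phiV a (phi a x)) D by rewrite phiVK.
exact: C ND'.
Qed.

Lemma dv_flat a f (c : R) v t x : dom a x -> (\forall y \near x, f y = c) ->
  dv (img a) v (in_chart a (fun=> f)) t (phi a x) = 0.
Proof.
move=> xa N; apply: (@derive_in_near_cst _ _ c); first exact: relopen_img.
  exact: img_phi.
exact: near_phiV N.
Qed.

(** The flux vanishes on a whole neighborhood of [x], which is needed to
differentiate it. *)
Lemma laplacian_flat f (c : R) t x : regular_evolution (fun=> f) -> 0 <= t <= 1 ->
  (\forall y \near x, f y = c) -> laplacian omega (g t) f x = 0.
Proof.
move=> sf t01 N; have [a xa] := dom_cover x.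
rewrite (@laplacianE _ _ _ omega g a (fun=> f)) // /chart_laplacian big1 ?mulr0 // => j _.
apply: (@derive_in_near_cst _ _ 0); first exact: relopen_img.
  exact: img_phi.
have NN : \forall y \near x, \forall z \near y, f z = c by exact: nbhs_interior.
have := near_phiV xa NN; apply: filterS => q Hq Aq.
have /(congr1 (fun F => F t q)) /= -> := fluxE omega g a (fun=> f) j.
apply: big1 => i _; have qa := img_dom Aq.
have := dv_flat 'e_i t qa (Hq Aq); rewrite phiVV // => ->.
by rewrite mul0r.
Qed.

End Flat.

(** * The two generators *)

Section Operators.
Context {R : realType} {n : nat} {M : manifold R n} (omega : volume_form M)
  (g : metric_family M).
Implicit Types (a b : chart M) (x : M) (p : 'rV[R]_n) (s t : R) (f h : M -> R).

(** What the comparison argument uses of a generator. Linearity is required for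
smooth functions only, since the divergence of a field that is not smooth may
be meaningless. *)
Definition elliptic (L : R -> (M -> R) -> M -> R) :=
  (forall f h (c : R) t x, regular_evolution (fun=> f) -> regular_evolution (fun=> h) -> 0 <= t <= 1 ->
     L t (fun x => f x + c * h x) x = L t f x + c * L t h x) /\
  (forall f t x, regular_evolution (fun=> f) -> 0 <= t <= 1 -> (forall y, f y <= f x) ->
     stationary_bd f x -> L t f x <= 0).

(** A Neumann condition quantifies over unit normals; it is only useful where a
transverse one exists. *)
Definition has_normals (G : R -> chart M -> M -> 'M[R]_n) :=
  forall t a x (i : 'I_n), 0 <= t <= 1 -> dom a x -> i = 0%N :> nat ->
  exists2 nu, unit_normal (G t a x) nu & nu 0 i != 0.

Lemma posdef_diag m (P : 'M[R]_m) i : posdef P -> 0 < P i i.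
Proof.
move=> pP; have := pP 'e_i; rewrite -rowE.
have -> : (row i P *m ('e_i : 'rV[R]_m)^T) 0 0 = P i i.
  rewrite mxE (bigD1 i) //= big1 => [|j ji]; last by rewrite !mxE (negbTE ji) andbF mulr0.
  by rewrite !mxE !eqxx mulr1 addr0.
apply; apply/eqP => /(congr1 (fun Z : 'rV[R]_m => Z 0 i)).
by rewrite !mxE !eqxx => /eqP; rewrite oner_eq0.
Qed.

Lemma laplacian_elliptic : elliptic (fun t => laplacian omega (g t)).
Proof.
split=> [f h c t x sf sh t01|f t x sf t01 fm sb].
  exact: (laplacian_comb omega g c x sf sh t01).
exact: laplacian_max_le0.
Qed.

Lemma metric_normals : has_normals g.
Proof.
move=> t a x i t01 xa i0.
have sG := Defs.metric_sym g t01 xa.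
have pG : posdef (g t a x) by move=> v v0; exact: metric_pos.
have uG := posdef_unit pG.
have pI := posdef_invmx sG pG.
have := @unit_normal_exists R _ (invmx (g t a x)) i i0 _ (posdef_diag i pI).
by rewrite unitmx_inv invmxK; apply.
Qed.

Lemma regular_evolution_continuous01 (h : R -> M -> R) x : regular_evolution h -> continuous01 (fun t => h t x).
Proof.
move=> sh t e t01 e0; have [B1 [B2 [N1 N2 H]]] := regular_evolution_near x sh t01 e0.
by apply: filterS N1 => s Bs s01; apply: H => //; exact: nbhs_singleton.
Qed.

Lemma laplacian_continuous01 f x : regular_evolution (fun=> f) ->
  continuous01 (fun t => laplacian omega (g t) f x).
Proof.
move=> sf; apply: (regular_evolution_continuous01 x (h := fun t x => laplacian omega (g t) f x)).
exact: (@regular_evolution_laplacian _ _ _ omega g (fun=> f)).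
Qed.

(** Both properties hold at each time and survive integration. *)
Lemma averaged_elliptic : elliptic (fun _ => averaged_laplacian omega g).
Proof.
split=> [f h c t x sf sh t01|f t x sf t01 fm sb]; rewrite /averaged_laplacian.
  rewrite -integral01_comb; [|exact: laplacian_continuous01|exact: laplacian_continuous01].
  apply: eq_Rintegral => s; rewrite inE /= in_itv /= => s01.
  exact: (laplacian_comb omega g c x sf sh s01).
rewrite -[leRHS](integral01_cst 0).
apply: integral01_le; [exact: laplacian_continuous01|exact: continuous01_cst|].
by move=> s s01; exact: laplacian_max_le0.
Qed.

Lemma averaged_laplacian_bound f x (C : R) : regular_evolution (fun=> f) ->
  (forall t, 0 <= t <= 1 -> `|laplacian omega (g t) f x| <= C) ->
  `|averaged_laplacian omega g f x| <= C.
Proof.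
move=> sf H; have cL := laplacian_continuous01 x sf.
have cc := @continuous01_cst R.
rewrite /averaged_laplacian ler_norml; apply/andP; split.
  rewrite -[leLHS]integral01_cst; apply: integral01_le => // t /H.
  by rewrite ler_norml => /andP[].
rewrite -[leRHS]integral01_cst; apply: integral01_le => // t /H.
by rewrite ler_norml => /andP[].
Qed.

Lemma integral01_sum (I : Type) (r : seq I) (c : I -> R) (F : I -> R -> R) :
  (forall i, continuous01 (F i)) ->
  continuous01 (fun t => \sum_(i <- r) c i * F i t) /\
  \int[lebesgue_measure]_(t in `[0, 1]) (\sum_(i <- r) c i * F i t) =
  \sum_(i <- r) c i * \int[lebesgue_measure]_(t in `[0, 1]) F i t.
Proof.
move=> cF; elim: r => [|i r [IH1 IH2]].
  have -> : (fun t => \sum_(i <- [::]) c i * F i t) = (fun=> 0).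
    by apply/funext => t; rewrite big_nil.
  split; first exact: continuous01_cst.
  by rewrite big_nil integral01_cst.
have -> : (fun t => \sum_(j <- i :: r) c j * F j t) =
    (fun t => (\sum_(j <- r) c j * F j t) + c i * F i t).
  by apply/funext => t; rewrite big_cons addrC.
split; first exact: continuous01_comb.
by rewrite integral01_comb // IH2 big_cons addrC.
Qed.

(** The average of the inverse metrics is positive definite, its quadratic form
being the integral of positive continuous functions. *)
Lemma averaged_normals : has_normals (fun _ => averaged_metric g).
Proof.
move=> t a x i t01 xa i0; rewrite /averaged_metric; set P := \matrix_(_, _) _.
have cI k l : continuous01 (fun t => invmx (g t a x) k l).
  move=> s e s01 e0.
  have N := regular_near (@regular_chart_invgram _ _ _ g a k l) s01 (img_phi xa) e0.
  have [B1 [B2 [N1 N2 H]]] := near_time_chart xa N.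
  apply: filterS N1 => r Br r01; have [_ /=] := H r x Br (nbhs_singleton N2).
  by rewrite /chart_gram phiVK //; apply => //; exact: img_phi.
have pP : posdef P.
  move=> v v0.
  pose c (k : 'I_n * 'I_n) := v 0 k.1 * v 0 k.2.
  pose F (k : 'I_n * 'I_n) t := invmx (g t a x) k.1 k.2.
  have cF k : continuous01 (F k) by exact: cI.
  have quad (Q : 'M[R]_n) : (v *m Q *m v^T) 0 0 = \sum_k c k * Q k.1 k.2.
    rewrite -(pair_bigA _ (fun k l => v 0 k * v 0 l * Q k l)) /= exchange_big mxE.
    apply: eq_bigr => l _; rewrite mxE mulr_suml; apply: eq_bigr => k _.
    by rewrite mxE mulrAC.
  have [cS E] := integral01_sum (index_enum _) c cF.
  have -> : (v *m P *m v^T) 0 0 =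
     \int[lebesgue_measure]_(t in `[0, 1]) (\sum_k c k * F k t).
    by rewrite quad E; apply: eq_bigr => k _; rewrite mxE.
  apply: integral01_gt0 => // s s01; rewrite -(quad (invmx (g s a x))).
  apply: posdef_invmx => //; first exact: Defs.metric_sym.
  by move=> w w0; exact: metric_pos.
exact: unit_normal_exists i0 (posdef_unit pP) (posdef_diag i pP).
Qed.

End Operators.

(** * One time step *)

Section Step.
Context {R : realType} {n : nat} {M : manifold R n}.
Implicit Types (a b : chart M) (x : M) (p : 'rV[R]_n) (s t : R) (f h : M -> R).

(** Such functions satisfy the boundary condition [bc] with respect to every
metric, and near the boundary the Laplacian does not see them. *)
Definition flat_bd (bc : boundary_condition) f := forall x, boundary M x ->
  exists2 c : R, \forall y \near x, f y = c & bc = Dirichlet -> c = 0.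

Lemma flat_bd_comb bc f h (c : R) : flat_bd bc f -> flat_bd bc h ->
  flat_bd bc (fun x => f x + c * h x).
Proof.
move=> ff fh x bx; have [d Nd d0] := ff x bx; have [e Ne e0] := fh x bx.
exists (d + c * e); first by apply: filterS2 Nd Ne => y -> ->.
by move=> D; rewrite d0 // e0 // mulr0 addr0.
Qed.

Lemma smooth_evolution_regular (u : R -> M -> R) : smooth_evolution u -> regular_evolution u.
Proof. by move=> su a; exact: regular_time (su a). Qed.

Lemma regular_evolution0 : regular_evolution (fun (_ : R) (_ : M) => 0 : R).
Proof. by move=> a; exact: regular_cst. Qed.

Lemma elliptic0 (L : R -> (M -> R) -> M -> R) t x : elliptic L -> 0 <= t <= 1 ->
  L t (fun=> 0) x = 0.
Proof.
move=> [linL _] t01; have := linL (fun=> 0) (fun=> 0) (-1) t x regular_evolution0 regular_evolution0 t01.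
have -> : (fun _ : M => 0 + -1 * 0 : R) = (fun=> 0).
  by apply/funext => y; rewrite mulr0 addr0.
by rewrite mulN1r subrr.
Qed.

Lemma elliptic_lin (L : R -> (M -> R) -> M -> R) f h (c d : R) t x : elliptic L ->
  regular_evolution (fun=> f) -> regular_evolution (fun=> h) -> 0 <= t <= 1 ->
  L t (fun x => c * f x + d * h x) x = c * L t f x + d * L t h x.
Proof.
move=> eL sf sh t01; have [linL _] := eL.
have E : L t (fun x => c * f x) x = c * L t f x.
  have := linL (fun=> 0) f c t x regular_evolution0 sf t01; rewrite elliptic0 // add0r => <-.
  by congr (L t _ x); apply/funext => y; rewrite add0r.
have sc : regular_evolution (fun=> fun x => c * f x).
  by move=> a; apply: regularM; [exact: regular_cst|exact: sf].
by rewrite (linL _ h d t x sc sh t01) E.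
Qed.

(** The comparison applied to [sgn] times the difference of the solution and of
the approximation [W + eps * (t - t1) * Q], with residual at most [K]. *)
Lemma step_upper bc (L : R -> (M -> R) -> M -> R) G (u0 : M -> R) (eps sgn K m t1 t2 : R)
    (u : R -> M -> R) (W Q : M -> R) :
  compact [set: M] -> elliptic L -> has_normals G -> 0 < eps ->
  is_solution bc L G u0 eps u -> regular_evolution (fun=> W) -> regular_evolution (fun=> Q) ->
  flat_bd bc W -> flat_bd bc Q -> 0 <= K -> 0 <= m ->
  0 <= t1 -> t1 < t2 -> t2 <= 1 ->
  (forall t x, t1 < t <= t2 ->
     sgn * (eps * (L t W x + eps * (t - t1) * L t Q x) - eps * Q x) <= K) ->
  (forall x, sgn * (u t1 x - W x) <= m) ->
  forall x, sgn * (u t2 x - (W x + eps * (t2 - t1) * Q x)) <= m + K * (t2 - t1).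
Proof.
move=> cM eL nG e0 [/smooth_evolution_regular su _ ueq ubc] sW sQ fW fQ K0 m0 t10 t12 t21 HK Hm.
pose w t := fun x => W x + (eps * (t - t1)) * Q x.
have sw t : regular_evolution (fun=> w t) by apply: (regular_evolution_comb _ sW sQ).
have fw t : flat_bd bc (w t) by exact: flat_bd_comb.
pose r t x := sgn * u t x + (- sgn * W x + (- sgn * eps * Q x) * (t - t1)).
have rE t : r t = fun x => sgn * u t x + - sgn * w t x.
  by apply/funext => x; rewrite /r /w; ring.
have sr : regular_evolution r.
  have stime a : regular (img a) (fun (t : R) (_ : 'rV[R]_n) => t - t1).
    move=> t p t01 Ap; exists setT, (fun z : R^o * 'rV[R]_n => z.1 - t1); split=> //.
    split=> //; first exact: openT.
    move=> k; apply: (@smooth_uptoD _ _ k _ (fun z : R^o * 'rV[R]_n => z.1) (fun=> - t1)).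
    - exact: openT.
    - exact: (smooth_fst openT).
    - by apply: smooth_upto_cst; exact: openT.
  move=> a; have rc c : regular (img a) (fun (t : R) (p : 'rV[R]_n) => c) by exact: regular_cst.
  apply: (regularD (f := fun t p => sgn * in_chart a u t p)); first exact: (regularM (rc _) (su a)).
  apply: (regularD (f := fun t p => - sgn * in_chart a (fun=> W) t p)).
    exact: (regularM (rc _) (sW a)).
  by apply: regularM (stime a); exact: (regularM (rc _) (sQ a)).
have t01 t : t1 < t <= t2 -> 0 <= t <= 1.
  by move=> /andP[h1 h2]; rewrite (le_trans t10 (ltW h1)) (le_trans h2 t21).
have sut t : 0 <= t <= 1 -> regular_evolution (fun=> u t) by move=> h; exact: regular_evolution_fix.
have Hdt t x : t1 < t <= t2 -> time_derive r t x <= eps * L t (r t) x + K.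
  move=> tt; have h01 := t01 t tt.
  have -> : time_derive r t x = sgn * time_derive u t x + (- sgn * eps * Q x).
    exact: (@time_derive_affine _ _ _ u t x sgn (- sgn * W x) (- sgn * eps * Q x) t1 su h01).
  rewrite rE (elliptic_lin _ _ _ eL (sut _ h01) (sw t) h01).
  have -> : time_derive u t x = eps * L t (u t) x by exact: ueq.
  have [linL _] := eL.
  rewrite (linL W Q _ t x sW sQ h01).
  have := HK t x tt; nra.
have Hmax t x : t1 < t <= t2 -> (forall y, r t y <= r t x) -> 0 < r t x -> L t (r t) x <= 0.
  move=> tt rm rpos; have h01 := t01 t tt; have [_ maxL] := eL.
  apply: maxL => //; first exact: regular_evolution_fix.
  move=> bx; have [c Nc c0] := fw t x bx.
  have [a xa bda] := bx; have [i i0 pi0] := bda.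
  case: bc fW fQ ubc fw c0 {Nc} => fW fQ ubc fw c0.
    exfalso; have := ubc t h01 x bx => /= ux0.
    have [d Nd d0] := fw t x bx.
    move: rpos; rewrite rE ux0 (nbhs_singleton Nd) d0 // !mulr0 addr0 ltxx.
    by [].
  have [nu nn nui] := nG t a x i h01 xa i0.
  exists a, i, nu; split=> //.
  have [d Nd _] := fw t x bx.
  have Ap := img_phi xa; have z01 : 0 <= (0:R) <= 1 by rewrite lexx ler01.
  have rA := relopen_img a.
  have sru : regular (img a) (fun s p => sgn * in_chart a (fun=> u t) s p).
    by apply: regularM; [exact: regular_cst|exact: sut].
  have srw : regular (img a) (fun s p => - sgn * in_chart a (fun=> w t) s p).
    by apply: regularM; [exact: regular_cst|exact: sw].
  have -> : in_chart a (fun=> r t) = fun s p =>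
      sgn * in_chart a (fun=> u t) s p + - sgn * in_chart a (fun=> w t) s p.
    by rewrite rE.
  rewrite (dvD rA sru srw) //.
  rewrite (dvM rA (regular_cst _) (sut _ h01 a)) // (dvM rA (regular_cst _) (sw t a)) //.
  rewrite !(dv_cst (fun=> _)) // !mulr0 !addr0 (dv_flat nu 0 xa Nd) mulr0 addr0.
  rewrite dv_coord //; last exact: sut.
  have /= bcx := ubc t h01 x a nu bx xa nn.
  have -> : \sum_j nu 0 j * dv (img a) 'e_j (in_chart a (fun=> u t)) 0 (phi a x) =
      (differential (u t) a x *m nu^T) 0 0.
    by rewrite mxE; apply: eq_bigr => j _; rewrite !mxE mulrC.
  by rewrite bcx mulr0.
have Hm' x : r t1 x <= m by rewrite rE /w subrr mulr0 mul0r addr0; have := Hm x; lra.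
move=> x; have := comparison cM sr (ltW e0) K0 m0 t10 t12 t21 Hdt Hmax Hm' x.
by rewrite rE /w; lra.
Qed.

Lemma step bc (L : R -> (M -> R) -> M -> R) G (u0 : M -> R) (eps K m t1 t2 : R)
    (u : R -> M -> R) (W Q : M -> R) :
  compact [set: M] -> elliptic L -> has_normals G -> 0 < eps ->
  is_solution bc L G u0 eps u -> regular_evolution (fun=> W) -> regular_evolution (fun=> Q) ->
  flat_bd bc W -> flat_bd bc Q -> 0 <= K -> 0 <= m ->
  0 <= t1 -> t1 < t2 -> t2 <= 1 ->
  (forall t x, t1 < t <= t2 ->
     `|eps * (L t W x + eps * (t - t1) * L t Q x) - eps * Q x| <= K) ->
  (forall x, `|u t1 x - W x| <= m) ->
  forall x, `|u t2 x - (W x + eps * (t2 - t1) * Q x)| <= m + K * (t2 - t1).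
Proof.
move=> cM eL nG e0 su sW sQ fW fQ K0 m0 t10 t12 t21 HK Hm x.
have H sgn : `|sgn| = 1 -> sgn * (u t2 x - (W x + eps * (t2 - t1) * Q x)) <= m + K * (t2 - t1).
  move=> s1; apply: (step_upper cM eL nG e0 su sW sQ fW fQ) => // [t y tt|y].
    by apply: le_trans (ler_norm _) _; rewrite normrM s1 mul1r; exact: HK.
  by apply: le_trans (ler_norm _) _; rewrite normrM s1 mul1r.
rewrite ler_norml lerNl -mulN1r; apply/andP; split.
  by apply: H; rewrite normrN1.
by rewrite -[leLHS]mul1r; apply: H; rewrite normr1.
Qed.

End Step.

(** * The second order estimate *)

Section Main.
Context {R : realType} {n : nat} {M : manifold R n} (omega : volume_form M)
  (g : metric_family M) (bc : boundary_condition) (u0 : M -> R).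
Hypotheses (cM : compact [set: M]) (au0 : admissible bc u0).

Lemma regular_u0 : regular_evolution (fun=> u0).
Proof. by move=> a; exact: regular_smooth_on (au0.1 a). Qed.

Let Q s x := laplacian omega (g s) u0 x.

Lemma regular_Q : regular_evolution Q.
Proof. exact: (@regular_evolution_laplacian _ _ _ omega g (fun=> u0) regular_u0). Qed.

(** The complement of the closed support is a neighborhood of the boundary in
the Dirichlet case. *)
Lemma flat_u0 : flat_bd bc u0.
Proof.
case: (bc) au0 => [] [_] => [[_ sub]|[U [c [oU bU uU]]]] x bx.
  exists 0 => //.
  have H : (~` closure [set x | u0 x != 0]) x by move=> cx; exact: sub cx bx.
  have O : open (~` closure [set x | u0 x != 0]) by apply: closed_openC; exact: closed_closure.
  have N : nbhs x (~` closure [set x | u0 x != 0]) by exact: open_nbhs_nbhs.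
  apply: filterS N => y cy; apply/eqP; apply: contraPT cy => uy.
  by apply; exact: subset_closure.
exists c => //.
have N : nbhs x U by apply: open_nbhs_nbhs; split=> //; exact: bU.
by apply: filterS N => y /uU.
Qed.

Lemma flat_Q s : 0 <= s <= 1 -> flat_bd bc (Q s).
Proof.
move=> s01 x bx; have [c Nc _] := flat_u0 bx; exists 0 => //.
have NN : \forall y \near x, \forall z \near y, u0 z = c by exact: nbhs_interior.
by apply: filterS NN => y; exact: (laplacian_flat omega g regular_u0 s01).
Qed.

(** Times [eps / N] and added to [u0], the partial sums are the values at the
nodes [k / N] of the approximation that is affine in between; for [k = N],
times [1 / N], this is the Riemann sum of the average. *)
Definition riemann_sum N k x : R := \sum_(j < k) Q (j%:R / N%:R) x.

Lemma node01 N (j k : nat) : (j < k)%N -> (k <= N)%N -> 0 <= (j%:R / N%:R : R) <= 1.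
Proof.
move=> jk kN; have N0 : (0 < N)%N by rewrite (leq_trans _ kN) // (leq_ltn_trans _ jk).
rewrite divr_ge0 //= ler_pdivrMr ?ltr0n // mul1r ler_nat.
exact: leq_trans (ltnW jk) kN.
Qed.

Lemma regular_riemann_sum N k : (k <= N)%N -> regular_evolution (fun=> riemann_sum N k).
Proof.
move=> kN a.
apply: (@regular_sum _ _ (img a) _ _ _ (fun (j : 'I_k) t p => Q (j%:R / N%:R) (phiV a p))) => j _.
exact: (regular_fix (@regular_Q a) (node01 (ltn_ord j) kN)).
Qed.

Lemma riemann_sumS N k : riemann_sum N k.+1 = fun x => riemann_sum N k x + 1 * Q (k%:R / N%:R) x.
Proof. by apply/funext => x; rewrite /riemann_sum big_ord_recr mul1r. Qed.

Lemma riemann_sum0 N : riemann_sum N 0 = fun=> 0.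
Proof. by apply/funext => x; rewrite /riemann_sum big_ord0. Qed.

Lemma flat_riemann_sum N k : (k <= N)%N -> flat_bd bc (riemann_sum N k).
Proof.
elim: k => [_ x bx|k IH kN]; first by exists 0 => //; near=> y; rewrite riemann_sum0.
rewrite riemann_sumS; apply: flat_bd_comb; first exact/IH/ltnW.
exact: flat_Q (node01 (ltnSn k) kN).
Unshelve. all: by end_near. Qed.

Lemma elliptic_riemann_sum L N k t x : elliptic L -> (k <= N)%N -> 0 <= t <= 1 ->
  L t (riemann_sum N k) x = \sum_(j < k) L t (Q (j%:R / N%:R)) x.
Proof.
move=> eL + t01; have [linL _] := eL.
elim: k => [_|k IH kN].
  by rewrite big_ord0 riemann_sum0 elliptic0.
rewrite riemann_sumS big_ord_recr /= -(IH (ltnW kN)) -[X in _ + X]mul1r.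
apply: linL => //; first exact: regular_riemann_sum (ltnW kN).
exact: regular_evolution_fix regular_Q (node01 (ltnSn k) kN).
Qed.

Section Constants.
Variables (C1 : R) (N : nat) (eta eps : R).
Hypotheses (C10 : 0 <= C1) (N0 : (0 < N)%N) (eta0 : 0 <= eta) (eps0 : 0 < eps).
Hypothesis bound_Q : forall s t x, 0 <= s <= 1 -> 0 <= t <= 1 ->
  `|laplacian omega (g t) (Q s) x| <= C1.
Hypothesis unif_Q : forall s t x, 0 <= s <= 1 -> 0 <= t <= 1 ->
  `|s - t| <= N%:R^-1 -> `|Q s x - Q t x| <= eta.

Let K := eps * eta + eps ^+ 2 * C1.

Lemma K_ge0 : 0 <= K.
Proof. by rewrite addr_ge0 // mulr_ge0 ?sqr_ge0 // ltW. Qed.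

Lemma norm_residual (x y A B : R) : `|x| <= A -> `|y| <= B ->
  `|eps * x + eps ^+ 2 * y| <= eps * A + eps ^+ 2 * B.
Proof.
move=> xA yB; apply: le_trans (ler_normD _ _) _; apply: lerD.
  by rewrite normrM gtr0_norm // ler_wpM2l // ltW.
by rewrite normrM (ger0_norm (sqr_ge0 eps)) ler_wpM2l ?sqr_ge0.
Qed.

Lemma bound_riemann_sum k t x : (k <= N)%N -> 0 <= t <= 1 ->
  `|laplacian omega (g t) (riemann_sum N k) x| <= k%:R * C1.
Proof.
move=> kN t01.
rewrite (elliptic_riemann_sum x (laplacian_elliptic omega g) kN t01).
apply: le_trans (ler_norm_sum _ _ _) _.
apply: (@le_trans _ _ (\sum_(j < k) C1)).
  by apply: ler_sum => j _; apply: bound_Q => //; exact: node01 (ltn_ord j) kN.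
by rewrite sumr_const card_ord mulr_natl.
Qed.

(** A single time step, with slope the full Riemann sum. *)
Lemma averaged_solution (v : R -> M -> R) :
  is_solution bc (fun _ => averaged_laplacian omega g) (fun _ => averaged_metric g) u0 eps v ->
  forall x, `|v 1 x - (u0 x + eps * (N%:R^-1 * riemann_sum N N x))| <= K.
Proof.
move=> sv x.
(* The summand 0 presents Qbar as a combination of the kind
   treated by the linearity lemmas. *)
pose Qbar x := 0 + N%:R^-1 * riemann_sum N N x.
have Nr : 0 < N%:R :> R by rewrite ltr0n.
have sR := regular_riemann_sum (leqnn N).
have sQbar : regular_evolution (fun=> Qbar) by exact: (regular_evolution_comb _ regular_evolution0 sR).
have f0 : flat_bd bc (fun _ : M => 0 : R) by rewrite -(riemann_sum0 N); exact: flat_riemann_sum.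
have fQbar : flat_bd bc Qbar by apply: flat_bd_comb => //; exact: flat_riemann_sum.
have LQ t y : 0 <= t <= 1 -> `|laplacian omega (g t) Qbar y| <= C1.
  move=> t01.
  have [linL _] := laplacian_elliptic omega g.
  rewrite (linL (fun=> 0) (riemann_sum N N) N%:R^-1 t y regular_evolution0 sR t01).
  have /= -> := @elliptic0 _ _ _ (fun t => laplacian omega (g t)) t y (laplacian_elliptic omega g) t01.
  rewrite add0r normrM ger0_norm ?invr_ge0 ?ler0n // mulrC ler_pdivrMr // mulrC.
  exact: bound_riemann_sum.
have H := step cM (averaged_elliptic omega g) (averaged_normals g) eps0 sv regular_u0 sQbar
  flat_u0 fQbar K_ge0 (lexx 0) (lexx 0) ltr01 (lexx 1).
have := H _ _ x; rewrite subr0 !mulr1 add0r /Qbar add0r; apply.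
  move=> t y /andP[t0 t1].
  have R1 : `|averaged_laplacian omega g u0 y - Qbar y| <= eta.
    rewrite /Qbar add0r; apply: integral01_riemann => //.
      exact: laplacian_continuous01 regular_u0.
    by move=> s s' s01 s'01 ss'; exact: unif_Q.
  have R2 : `|averaged_laplacian omega g Qbar y| <= C1.
    by apply: averaged_laplacian_bound => // s s01; exact: LQ.
  rewrite subr0; move: R1 R2.
  set a1 := averaged_laplacian omega g u0 y.
  set a2 := averaged_laplacian omega g (fun x => 0 + _) y.
  set b := 0 + _.
  have -> : eps * (a1 + eps * t * a2) - eps * b = eps * (a1 - b) + eps ^+ 2 * (t * a2) by ring.
  move=> R1 R2; apply: norm_residual => //.
  by rewrite normrM (ger0_norm (ltW t0)); apply: le_trans R2; rewrite ler_piMl.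
by move=> y; have [_ -> _ _] := sv; rewrite subrr normr0.
Qed.

(** [N] time steps. On the step that starts at [k / N] the approximation moves
with the generator frozen at that time; the error bounds add up in proportion
to the elapsed time. *)
Lemma exact_solution (v : R -> M -> R) :
  is_solution bc (fun t => laplacian omega (g t)) g u0 eps v ->
  forall x, `|v 1 x - (u0 x + eps * (N%:R^-1 * riemann_sum N N x))| <= K.
Proof.
move=> sv.
have Nr : 0 < N%:R :> R by rewrite ltr0n.
pose W k x := u0 x + eps / N%:R * riemann_sum N k x.
suff key k : (k <= N)%N -> forall x, `|v (k%:R / N%:R) x - W k x| <= K * (k%:R / N%:R).
  by move=> x; have := key N (leqnn N) x; rewrite divff ?gt_eqF // mulr1 /W mulrA.
elim: k => [_ x|k IH kN].
  have [_ v0 _ _] := sv.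
  by rewrite mul0r v0 /W riemann_sum0 mulr0 addr0 subrr normr0 mulr0.
have kN' := ltnW kN.
have k01 := node01 (ltnSn k) kN; have /andP[k0 k1] := k01.
have kk : k%:R / N%:R < k.+1%:R / N%:R :> R by rewrite ltr_pM2r ?invr_gt0 // ltr_nat.
have kS1 : k.+1%:R / N%:R <= 1 :> R by rewrite ler_pdivrMr // mul1r ler_nat.
have dk : k.+1%:R / N%:R - k%:R / N%:R = N%:R^-1 :> R.
  by rewrite -natr1 mulrDl mul1r addrC addKr.
have sR := regular_riemann_sum kN'.
have sQk := regular_evolution_fix regular_Q k01.
have sW : regular_evolution (fun=> W k) by exact: (regular_evolution_comb _ regular_u0 sR).
have fW : flat_bd bc (W k) by apply: flat_bd_comb; [exact: flat_u0|exact: flat_riemann_sum].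
have H := step cM (laplacian_elliptic omega g) (metric_normals g) eps0 sv sW sQk fW
  (flat_Q k01) K_ge0 (mulr_ge0 K_ge0 k0) k0 kk kS1 _ (IH kN').
move=> x.
have -> : W k.+1 x = W k x + eps * (k.+1%:R / N%:R - k%:R / N%:R) * Q (k%:R / N%:R) x.
  by rewrite dk /W riemann_sumS mul1r mulrDr addrA.
have -> : K * (k.+1%:R / N%:R) = K * (k%:R / N%:R) + K * (k.+1%:R / N%:R - k%:R / N%:R) by ring.
apply: H => t y /andP[kt tk].
have t01 : 0 <= t <= 1 by rewrite (le_trans k0 (ltW kt)) (le_trans tk kS1).
have tkN : t - k%:R / N%:R <= N%:R^-1 by rewrite lerBlDr (le_trans tk) // -lerBlDr dk.
have [linL _] := laplacian_elliptic omega g.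
rewrite (linL u0 (riemann_sum N k) _ t y regular_u0 sR t01).
have R1 : `|Q t y - Q (k%:R / N%:R) y| <= eta.
  apply: unif_Q => //; rewrite ger0_norm; last by rewrite subr_ge0 ltW.
  exact: tkN.
have R2 := bound_riemann_sum y kN' t01.
have R3 : `|laplacian omega (g t) (Q (k%:R / N%:R)) y| <= C1 by exact: bound_Q.
rewrite -/(Q t y); move: R1 R2 R3.
set q := Q _ y; set l1 := laplacian _ _ (riemann_sum N k) y; set l2 := laplacian _ _ _ y.
set qk := Q (k%:R / N%:R) y.
have -> : eps * (q + eps / N%:R * l1 + eps * (t - k%:R / N%:R) * l2) - eps * qk =
  eps * (q - qk) + eps ^+ 2 * (l1 / N%:R + (t - k%:R / N%:R) * l2) by ring.
move=> R1 R2 R3; apply: norm_residual => //; apply: le_trans (ler_normD _ _) _.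
have iN0 : 0 <= N%:R^-1 :> R by rewrite invr_ge0 ltW.
rewrite !normrM (ger0_norm iN0).
have tk0 : 0 <= t - k%:R / N%:R by rewrite subr_ge0 ltW.
rewrite (ger0_norm tk0).
apply: (@le_trans _ _ (k%:R * C1 / N%:R + N%:R^-1 * C1)).
  apply: lerD; first by rewrite ler_wpM2r // invr_ge0 ltW.
  exact: ler_pM.
have -> : k%:R * C1 / N%:R + N%:R^-1 * C1 = (k.+1%:R / N%:R) * C1.
  by rewrite -natr1; ring.
by rewrite ler_piMl.
Qed.

End Constants.

(** The number of steps depends on [eps]: it is chosen so large that the
oscillation of the generator on [u0] over one step is at most [eps], while the
constant [C] does not depend on it. *)
Lemma solutions_close : exists C : R, 0 < C /\ forall (eps : R) (v w : R -> M -> R), 0 < eps ->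
  is_solution bc (fun t => laplacian omega (g t)) g u0 eps v ->
  is_solution bc (fun _ => averaged_laplacian omega g) (fun _ => averaged_metric g) u0 eps w ->
  forall x, `|v 1 x - w 1 x| <= C * eps ^+ 2.
Proof.
have [C HC] := laplacian_bounded omega g cM regular_Q.
exists (2 * (1 + `|C|)); split; first by rewrite mulr_gt0 // ltr_pwDl.
move=> eps v w eps0 sv sw x.
(* The oscillation over one step is taken to be at most eps, so that its
   contribution eps * eta is of order 2. *)
have [d d0 Hd] := regular_evolution_unif cM regular_Q eps0.
have [N N0 Nd] : exists2 N, (0 < N)%N & (N%:R^-1 : R) < d.
  have [m _ Hm] := near_infty_natSinv_lt (PosNum d0).
  by exists m.+1 => //; exact: (Hm m (leqnn m)).
have B s t y : 0 <= s <= 1 -> 0 <= t <= 1 -> `|laplacian omega (g t) (Q s) y| <= `|C|.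
  by move=> s01 t01; apply: le_trans (HC s t y s01 t01) (ler_norm _).
have U s t y : 0 <= s <= 1 -> 0 <= t <= 1 -> `|s - t| <= N%:R^-1 -> `|Q s y - Q t y| <= eps.
  by move=> s01 t01 st; apply: Hd => //; exact: le_lt_trans st Nd.
have H1 := exact_solution (normr_ge0 C) N0 (ltW eps0) eps0 B U sv x.
have H2 := averaged_solution (normr_ge0 C) N0 (ltW eps0) eps0 B U sw x.
rewrite -(subrKA (u0 x + eps * (N%:R^-1 * riemann_sum N N x))).
apply: le_trans (ler_normD _ _) _.
rewrite [X in _ + X]distrC; apply: le_trans (lerD H1 H2) _.
by rewrite le_eqVlt; apply/orP; left; apply/eqP; ring.
Qed.

End Main.

Theorem proposition3p1 (R : realType) (n : nat) (M : manifold R n)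
    (o : orientation M) (omega : volume_form M) (g : metric_family M)
    (bc : boundary_condition) (u0 : M -> R) (u ubar : R -> R -> M -> R) :
  compact [set: M] ->
  admissible bc u0 ->
  (forall eps : R, 0 < eps ->
     is_solution bc (fun t => laplacian omega (g t)) g u0 eps (u eps)) ->
  (forall eps : R, 0 < eps ->
     is_solution bc (fun _ => averaged_laplacian omega g)
       (fun _ => averaged_metric g) u0 eps (ubar eps)) ->
  exists C eps0 : R, [/\ 0 < C, 0 < eps0 &
    forall eps : R, 0 < eps < eps0 ->
    forall x : M, `|u eps 1 x - ubar eps 1 x| <= C * eps ^+ 2].
Proof.
move=> cM au0 su subar.
have [C [C0 H]] := solutions_close omega g cM au0.
exists C, 1; split=> // eps /andP[eps0 _].
exact: H eps0 (su eps eps0) (subar eps eps0).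
Qed.
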